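(* There exists a (real) Banach space $X$ with a Schauder basis $(e_n)_{n\in\mathbb{N}}$ such that $X^*$ is isomorphic to $\mathcal{L}_{\mathrm{diag}}(X)$, $X^*$ is nonseparable, and $X^*$ does not contain an isomorphic copy of $\ell_1(\mathbb{N})$ or of $c_0(\mathbb{N})$.
   Context: $\mathcal{L}_{\mathrm{diag}}(X)$ denotes the space, with the operator norm, of all bounded linear operators $T:X\to X$ which are diagonal with respect to the basis $(e_n)$, i.e. for which there is a scalar sequence $(\lambda_n)_{n}$ with $Te_n=\lambda_ne_n$ for all $n$. *)

(* Defs.v *)
From HB Require Import structures.
From mathcomp Require Import all_boot all_order all_algebra.
From mathcomp Require Import all_classical all_reals all_analysis.

Set Implicit Arguments.
Unset Strict Implicit.
Unset Printing Implicit Defensive.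

Import Order.TTheory GRing.Theory Num.Theory.
Import numFieldNormedType.Exports.

Local Open Scope classical_set_scope.
Local Open Scope ring_scope.

Section bounded_operators.
Context (R : realType) (V W : normedModType R).

Definition bounded_linear : {pred V -> W} :=
  mem [set f : V -> W | linear f /\ continuous f].

Record bounded_op := BoundedOp {
  bounded_op_fun :> V -> W;
  bounded_opP : bounded_op_fun \in bounded_linear }.

HB.instance Definition _ := [isSub for bounded_op_fun].
HB.instance Definition _ := [Choice of bounded_op by <:].

Lemma bounded_linear_submod : submod_closed bounded_linear.
Proof.
split=> [|a f g].
  by rewrite inE; split=> [a x y|x]; [rewrite scaler0 addr0|exact: cvg_cst].
rewrite !inE => -[lf cf] [lg cg]; split.
  move=> b x y; rewrite /= !fctE lf lg !scalerDr !scalerA (mulrC a b).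
  by rewrite addrACA.
by move=> x; apply: cvgD; [apply: cvgZl_tmp; exact: cf|exact: cg].
Qed.

HB.instance Definition _ :=
  GRing.isSubmodClosed.Build R (V -> W) bounded_linear bounded_linear_submod.
HB.instance Definition _ := [SubChoice_isSubLmodule of bounded_op by <:].

Lemma bounded_op_linear (T : bounded_op) : linear T.
Proof. by have := bounded_opP T; rewrite inE => -[]. Qed.

HB.instance Definition _ (T : bounded_op) :=
  GRing.isLinear.Build R V W *:%R T (@bounded_op_linear T).

Lemma bounded_op_continuous (T : bounded_op) : continuous T.
Proof. by have := bounded_opP T; rewrite inE => -[]. Qed.

Definition opnorm (T : bounded_op) : R :=
  sup [set `|T x| | x in [set x : V | `|x| <= 1]].

Lemma opnorm_has_sup (T : bounded_op) :
  has_sup [set `|T x| | x in [set x : V | `|x| <= 1]].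
Proof.
split; first by exists `|T 0|, 0 => //=; rewrite normr0 ler01.
have /linear_boundedP/pinfty_ex_gt0[M M0 TM] :=
  continuous_linear_bounded (0 : V) (@bounded_op_continuous T 0).
exists M => _ [x /= x1 <-]; rewrite (le_trans (TM x))//.
by rewrite ler_piMr// ltW.
Qed.

Lemma opnorm_ub (T : bounded_op) (x : V) : `|x| <= 1 -> `|T x| <= opnorm T.
Proof.
by move=> x1; apply: ub_le_sup; [case: (opnorm_has_sup T)|exists x].
Qed.

Lemma opnorm_lub (T : bounded_op) (M : R) :
  (forall x : V, `|x| <= 1 -> `|T x| <= M) -> opnorm T <= M.
Proof.
move=> TM; apply: ge_sup; first by case: (opnorm_has_sup T).
by move=> _ [x /= x1 <-]; exact: TM.
Qed.

Lemma opnorm_ge0 (T : bounded_op) : 0 <= opnorm T.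
Proof.
by apply: le_trans (normr_ge0 (T 0)) (opnorm_ub _ _); rewrite normr0 ler01.
Qed.

Lemma opnormP (T : bounded_op) (x : V) : `|T x| <= opnorm T * `|x|.
Proof.
have [->|x0] := eqVneq x 0; first by rewrite linear0 !normr0 mulr0.
have nx : 0 < `|x| by rewrite normr_gt0.
have : `|T (`|x|^-1 *: x)| <= opnorm T.
  by apply: opnorm_ub; rewrite normrZ normfV normr_id mulVf// gt_eqF.
by rewrite linearZ /= normrZ normfV normr_id mulrC ler_pdivrMr.
Qed.

Lemma opnormD (S T : bounded_op) : opnorm (S + T) <= opnorm S + opnorm T.
Proof.
apply: opnorm_lub => x x1; apply: le_trans (ler_normD (S x) (T x)) _.
by rewrite lerD// opnorm_ub.
Qed.

Lemma opnormZ (a : R) (T : bounded_op) : opnorm (a *: T) = `|a| * opnorm T.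
Proof.
have le_opnormZ (b : R) (S : bounded_op) : opnorm (b *: S) <= `|b| * opnorm S.
  apply: opnorm_lub => x x1.
  rewrite [X in `|X|](_ : _ = b *: S x)// normrZ.
  by rewrite ler_wpM2l// opnorm_ub.
apply/eqP; rewrite eq_le le_opnormZ /=.
have [->|a0] := eqVneq a 0; first by rewrite normr0 mul0r opnorm_ge0.
rewrite -ler_pdivlMl ?normr_gt0// -normfV.
by rewrite -{1}(scale1r T) -(mulVf a0) -scalerA le_opnormZ.
Qed.

Lemma opnorm0_eq0 (T : bounded_op) : opnorm T = 0 -> T = 0.
Proof.
move=> T0; apply/val_inj/funext => x; apply/eqP.
by rewrite -normr_le0 (le_trans (opnormP T x))// T0 mul0r.
Qed.

HB.instance Definition _ := Lmodule_isNormed.Build R bounded_op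
  opnormD opnormZ opnorm0_eq0.

End bounded_operators.

(* [R^o] rather than [R]: the normed module structure on scalars is keyed on
   the regular module. *)
Definition dual (R : realType) (X : normedModType R) : normedModType R :=
  bounded_op X R^o.

Section diagonal_operators.
Context (R : realType) (X : normedModType R) (e : X^nat).

Definition diagonal : {pred bounded_op X X} :=
  mem [set T : bounded_op X X |
        exists lambda : R^nat, forall n, T (e n) = lambda n *: e n].

Record diag_op := DiagOp {
  diag_op_val :> bounded_op X X;
  diag_opP : diag_op_val \in diagonal }.

HB.instance Definition _ := [isSub for diag_op_val].
HB.instance Definition _ := [Choice of diag_op by <:].

Lemma diagonal_submod : submod_closed diagonal.
Proof.
split=> [|a S T].
  by rewrite inE; exists (fun=> 0) => n; rewrite scale0r.
rewrite !inE => -[l Sl] [m Tm]; exists (fun n => a * l n + m n) => n.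
rewrite scalerDl -scalerA -Sl -Tm.
by [].
Qed.

HB.instance Definition _ :=
  GRing.isSubmodClosed.Build R (bounded_op X X) diagonal diagonal_submod.
HB.instance Definition _ := [SubChoice_isSubLmodule of diag_op by <:].

Definition diag_norm (T : diag_op) : R := `|diag_op_val T|.

Lemma diag_normD (S T : diag_op) :
  diag_norm (S + T) <= diag_norm S + diag_norm T.
Proof. exact: ler_normD. Qed.

Lemma diag_normZ (a : R) (T : diag_op) :
  diag_norm (a *: T) = `|a| * diag_norm T.
Proof. exact: normrZ. Qed.

Lemma diag_norm0_eq0 (T : diag_op) : diag_norm T = 0 -> T = 0.
Proof. by move=> /normr0_eq0 T0; exact: val_inj. Qed.

HB.instance Definition _ := Lmodule_isNormed.Build R diag_op
  diag_normD diag_normZ diag_norm0_eq0.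

End diagonal_operators.

Section l1.
Context (R : realType).

Definition summable_seq : {pred nat -> R^o} :=
  mem [set u : nat -> R^o | cvgn [normed series u]].

Record l1 := L1 { l1_seq :> nat -> R^o; l1P : l1_seq \in summable_seq }.

HB.instance Definition _ := [isSub for l1_seq].
HB.instance Definition _ := [Choice of l1 by <:].

Lemma normed_seriesZ (a : R) (u : nat -> R^o) :
  [normed series (a *: u)] = (fun n => `|a| *: ([normed series u] n : R^o)).
Proof.
apply/funext => n; rewrite /series /= scaler_sumr.
by apply: eq_bigr => i _; rewrite normrZ.
Qed.

Lemma le_normed_seriesD (u v : nat -> R^o) (n : nat) :
  [normed series (u + v)] n <= [normed series u] n + [normed series v] n.
Proof.
by rewrite /series /= -big_split; apply: ler_sum => i _; exact: ler_normD.
Qed.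

Lemma summable_seqZ (a : R) (u : nat -> R^o) :
  cvgn [normed series u] -> cvgn [normed series (a *: u)].
Proof. by move=> cu; rewrite normed_seriesZ; exact: is_cvgZl_tmp. Qed.

Lemma summable_seqD (u v : nat -> R^o) :
  cvgn [normed series u] -> cvgn [normed series v] ->
  cvgn [normed series (u + v)].
Proof.
move=> cu cv; apply: (@series_le_cvg R _ (fun n => `|u n| + `|v n|)).
- by move=> n; exact: normr_ge0.
- by move=> n; exact: addr_ge0.
- by move=> n; exact: ler_normD.
- exact: (is_cvg_seriesD cu cv).
Qed.

Lemma summable_seq_submod : submod_closed summable_seq.
Proof.
split=> [|a u v]; rewrite !inE /=.
  rewrite (_ : [normed series 0] = cst 0); first exact: is_cvg_cst.
  by apply/funext => n; apply: big1 => i _; exact: normr0.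
by move=> cu cv; apply: summable_seqD => //; exact: summable_seqZ.
Qed.

HB.instance Definition _ :=
  GRing.isSubmodClosed.Build R (nat -> R^o) summable_seq summable_seq_submod.
HB.instance Definition _ := [SubChoice_isSubLmodule of l1 by <:].

Definition l1_norm (u : l1) : R := limn [normed series u].

Lemma l1_cvg (u : l1) : cvgn [normed series u].
Proof. by have := l1P u; rewrite inE. Qed.

Lemma l1_normD (u v : l1) : l1_norm (u + v) <= l1_norm u + l1_norm v.
Proof.
rewrite /l1_norm -limD; [|exact: l1_cvg..].
apply: ler_lim; [exact: l1_cvg| |by apply: nearW; exact: le_normed_seriesD].
by apply: is_cvgD; exact: l1_cvg.
Qed.

Lemma l1_normZ (a : R) (u : l1) : l1_norm (a *: u) = `|a| * l1_norm u.
Proof.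
rewrite /l1_norm (_ : l1_seq (a *: u) = a *: l1_seq u)// normed_seriesZ.
by apply: limZl_tmp; exact: l1_cvg.
Qed.

Lemma l1_norm0_eq0 (u : l1) : l1_norm u = 0 -> u = 0.
Proof.
move=> u0; apply/val_inj/funext => n; apply/eqP.
have nd : nondecreasing_seq [normed series u].
  by apply: nondecreasing_series => i _ _; exact: normr_ge0.
have := nondecreasing_cvgn_le nd (@l1_cvg u) n.+1.
rewrite -/(l1_norm u) u0 -normr_le0; apply: le_trans.
rewrite /= seriesSr lerDr; apply: sumr_ge0 => i _; exact: normr_ge0.
Qed.

HB.instance Definition _ := Lmodule_isNormed.Build R l1
  l1_normD l1_normZ l1_norm0_eq0.

End l1.

Section c0.
Context (R : realType).

Definition null_seq : {pred nat -> R^o} :=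
  mem [set u : nat -> R^o | u @ \oo --> (0 : R^o)].

Record c0 := C0 { c0_seq :> nat -> R^o; c0P : c0_seq \in null_seq }.

HB.instance Definition _ := [isSub for c0_seq].
HB.instance Definition _ := [Choice of c0 by <:].

Lemma null_seq_submod : submod_closed null_seq.
Proof.
split=> [|a u v]; rewrite !inE /=; first exact: cvg_cst.
move=> cu cv; rewrite -(addr0 (0 : R^o)) -{1}(scaler0 _ a).
by apply: cvgD => //; exact: cvgZl_tmp.
Qed.

HB.instance Definition _ :=
  GRing.isSubmodClosed.Build R (nat -> R^o) null_seq null_seq_submod.
HB.instance Definition _ := [SubChoice_isSubLmodule of c0 by <:].

Definition c0_norm (u : c0) : R := sup (range (fun n => `|u n|)).

Lemma c0_norm_ub (u : c0) (n : nat) : `|u n| <= c0_norm u.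
Proof.
apply: ub_le_sup; last by exists n.
have : cvgn (u : nat -> R^o).
  by apply: (cvgP 0); have := c0P u; rewrite inE.
move=> /cvg_seq_bounded/pinfty_ex_gt0[M _ uM].
by exists M => _ [m _ <-]; exact: uM.
Qed.

Lemma c0_norm_lub (u : c0) (M : R) :
  (forall n, `|u n| <= M) -> c0_norm u <= M.
Proof.
move=> uM; apply: ge_sup; first by exists `|u 0%N|, 0%N.
by move=> _ [n _ <-].
Qed.

Lemma c0_normD (u v : c0) : c0_norm (u + v) <= c0_norm u + c0_norm v.
Proof.
apply: c0_norm_lub => n; apply: le_trans (ler_normD (u n) (v n)) _.
by rewrite lerD// c0_norm_ub.
Qed.

Lemma c0_normZ (a : R) (u : c0) : c0_norm (a *: u) = `|a| * c0_norm u.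
Proof.
have le_c0_normZ (b : R) (v : c0) : c0_norm (b *: v) <= `|b| * c0_norm v.
  apply: c0_norm_lub => n.
  rewrite [X in `|X|](_ : _ = b *: v n)// normrZ.
  by rewrite ler_wpM2l// c0_norm_ub.
apply/eqP; rewrite eq_le le_c0_normZ /=.
have [->|a0] := eqVneq a 0.
  by rewrite normr0 mul0r (le_trans _ (c0_norm_ub _ 0%N)).
rewrite -ler_pdivlMl ?normr_gt0// -normfV.
by rewrite -{1}(scale1r u) -(mulVf a0) -scalerA le_c0_normZ.
Qed.

Lemma c0_norm0_eq0 (u : c0) : c0_norm u = 0 -> u = 0.
Proof.
move=> u0; apply/val_inj/funext => n; apply/eqP.
by rewrite -normr_le0 -u0 c0_norm_ub.
Qed.

HB.instance Definition _ := Lmodule_isNormed.Build R c0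
  c0_normD c0_normZ c0_norm0_eq0.

End c0.

(* Convergence is in norm; the coefficient sequence is unique for each [x]. *)
Definition schauder_basis (R : realType) (X : normedModType R) (e : X^nat) :=
  forall x : X, exists! a : R^nat, series (fun n => a n *: e n) @ \oo --> x.

Definition isomorphic_embedding (R : realType) (X Y : normedModType R)
    (T : {linear X -> Y}) :=
  exists c C : R, [/\ 0 < c, 0 < C &
    forall x : X, c * `|x| <= `|T x| <= C * `|x|].

Definition isomorphic (R : realType) (X Y : normedModType R) :=
  exists T : {linear X -> Y},
    isomorphic_embedding T /\ forall y : Y, exists x : X, T x = y.

(* [X] contains an isomorphic copy of [Y]. *)
Definition contains_copy (R : realType) (X Y : normedModType R) :=
  exists T : {linear Y -> X}, isomorphic_embedding T.

Definition separable (T : topologicalType) :=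
  exists2 D : set T, countable D & dense D.

(* Main.v *)
(* The norm of a sequence [x] is [p_T x + p_J x], where [p_T] is the James tree
   norm for the heap ordering of the nodes of the binary tree by the naturals, and
   [p_J] is James's norm for the usual ordering of the naturals: each is the
   supremum of [sum_n d n * x n] over the sequences [d] that take values [a i] on
   pairwise disjoint segments, with [sum_i (a i) ^ 2 <= 1]. These [d] are closed
   under pointwise products, so the dual is an algebra of coefficient sequences; it
   has the unit [1], a norming sequence of the line. Hence the diagonal operators
   are exactly the multiplications by coefficient sequences of functionals. The
   indicators of the uncountably many branches are uniformly separated.

   If the dual contains l1, split the functionals of the l1-sequence by
   Hahn-Banach into a tree part and a line part. On either tree, a functional is,
   up to a small error on a tail, a finite combination of indicators of branches,
   and tails of such combinations have Hilbertian norms. So suitable signs make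
   averages of l1-vectors small outside a finite block of coordinates, and the
   lower 2-estimate for blocks in the space makes averages of such blocks small in
   the dual, a contradiction. A copy of c0 in a dual space yields, by Rosenthal's
   disjointness lemma, an l1-sequence of Rademacher-like weak* sums. *)
From HB Require Import structures.
Require Import Defs.
From mathcomp Require Import all_boot all_order all_algebra.
From mathcomp Require Import all_classical all_reals all_analysis.
From mathcomp Require Import ring lra zify.

Set Implicit Arguments.
Unset Strict Implicit.
Unset Printing Implicit Defensive.

Import Order.TTheory GRing.Theory Num.Theory.
Import numFieldNormedType.Exports.

Local Open Scope classical_set_scope.
Local Open Scope ring_scope.

(** * Norming sequences and their norms *)

(** The tree norm alone has no unit in its dual, since the sum over all nodes is unbounded on it.
    The line norm supplies one, and products of tree and line test sequences remain test sequences
    because the tree order is contained in the order of the naturals. Both orders are ancestor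
    orders of a parent map ([half] and [predn]), so every tail argument is done once, for a tree
    with finite branching. The refutation of l1 is quantitative and passes to no subsequence. With
    well chosen signs, a sum of K functionals has branch limits and first coordinates of order sqrt
    K only, so division by K makes both small. What survives lives in a window of coordinates, and k
    successive windows cost sqrt k against k. A bound by a sum of two norms does not tell which norm
    controls which part of a functional; hence the Hahn-Banach splitting. It is done one coordinate
    at a time on finitely supported vectors, where all norms are finite. *)

Section sums.
Context {R : realType}.

(** Cauchy-Schwarz, summed from [a b <= (B/A a^2 + A/B b^2) / 2]. If [A] or [B] is zero the weights
    make no sense, but then one of the factors vanishes. *)
Lemma sum_mul_le (I : eqType) (r : seq I) (P : pred I) (a b : I -> R) (A B : R) :
  0 <= A -> 0 <= B ->
  \sum_(i <- r | P i) a i ^+ 2 <= A ^+ 2 -> \sum_(i <- r | P i) b i ^+ 2 <= B ^+ 2 ->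
  \sum_(i <- r | P i) a i * b i <= A * B.
Proof.
move=> A0 B0 ha hb.
have zero (c d : I -> R) : \sum_(i <- r | P i) c i ^+ 2 <= 0 ->
    \sum_(i <- r | P i) c i * d i = 0.
  move=> hc; rewrite big_seq_cond; apply: big1 => i /andP[ir Pi].
  have : \sum_(i <- r | P i) c i ^+ 2 = 0.
    by apply/eqP; rewrite eq_le hc sumr_ge0 // => j _; exact: sqr_ge0.
  move/eqP; rewrite psumr_eq0 => [/allP /(_ i ir)|j _]; last exact: sqr_ge0.
  by rewrite Pi sqrf_eq0 => /eqP ->; rewrite mul0r.
have [A1|A1] := eqVneq A 0.
  by rewrite zero ?mulr_ge0 //; move: ha; rewrite A1 expr0n.
have [B1|B1] := eqVneq B 0.
  under eq_bigr do rewrite mulrC.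
  by rewrite zero ?mulr_ge0 //; move: hb; rewrite B1 expr0n.
have Ap : 0 < A by rewrite lt_def A1.
have Bp : 0 < B by rewrite lt_def B1.
have -> : A * B = (B / A * A ^+ 2 + A / B * B ^+ 2) / 2 by field; apply/andP.
apply: (@le_trans _ _
  ((B / A * \sum_(i <- r | P i) a i ^+ 2 + A / B * \sum_(i <- r | P i) b i ^+ 2) / 2)).
  rewrite !mulr_sumr -big_split /= mulr_suml; apply: ler_sum => i _.
  rewrite -subr_ge0.
  have -> : (B / A * a i ^+ 2 + A / B * b i ^+ 2) / 2 - a i * b i =
     (B * a i - A * b i) ^+ 2 / (2 * A * B) by field; apply/andP.
  by rewrite divr_ge0 ?sqr_ge0 // !mulr_ge0.
by rewrite ler_pM2r ?invr_gt0 // lerD // ler_wpM2l // divr_ge0.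
Qed.

End sums.

Section norming.
Context {R : realType}.
Implicit Types (le : nat -> nat -> Prop) (x y d : nat -> R) (A B : pred nat).

Definition cutoff A x : nat -> R := fun n => if A n then x n else 0.

Definition convex le A :=
  forall u w v, A u -> A v -> le u w -> le w v -> A w.

Definition segment le A :=
  (forall u v, A u -> A v -> le u v \/ le v u) /\ convex le A.

Definition labelled le (L : finType) (l : nat -> L) (P : pred L) :=
  forall i, P i -> segment le [pred n | l n == i].

(** Fibres of a labelling are disjoint for free. Only labels with a nonzero coefficient must be
    segments: a label with coefficient 0 can absorb the rest of the naturals. *)
Definition norming le : set (nat -> R) :=
  [set d | exists (L : finType) (l : nat -> L) (a : L -> R),
     [/\ labelled le l [pred i | a i != 0], \sum_i a i ^+ 2 <= 1 &
         d = fun n => a (l n)]].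

Definition pairing d x N := \sum_(n < N) d n * x n.

Definition values le x : set R :=
  [set r | exists d N, norming le d /\ r = pairing d x N].

(* A junk value unless [pbounded le x]. *)
Definition pnorm le x : R := sup (values le x).

Definition pbounded le x := has_ubound (values le x).

Definition supp_lt x N := forall n, (N <= n)%N -> x n = 0.

Lemma segmentI le A B : segment le A -> convex le B ->
  segment le [pred n | A n && B n].
Proof.
move=> [A1 A2] cB; split=> [u v /andP[Au _] /andP[Av _]|]; first exact: A1.
move=> u w v /andP[Au Bu] /andP[Av Bv] uw wv /=.
by rewrite (A2 u w v) ?(cB u w v).
Qed.

Lemma eq_segment le A B : A =1 B -> segment le A -> segment le B.
Proof.
move=> AB [h1 h2]; split=> [u v|u w v]; rewrite -!AB; [exact: h1|exact: h2].
Qed.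

Lemma cutoff_supp A x N : supp_lt x N -> supp_lt (cutoff A x) N.
Proof. by move=> xN n /xN h; rewrite /cutoff h if_same. Qed.

Lemma pairing_supp d x N M : supp_lt x N -> (N <= M)%N ->
  pairing d x M = pairing d x N.
Proof.
move=> xN NM; rewrite /pairing [RHS](big_ord_widen M (fun n => d n * x n)) //.
rewrite [RHS]big_mkcond /=; apply: eq_bigr => i _.
by case: ltnP => // /xN ->; rewrite mulr0.
Qed.

Lemma pairing_trunc d x N M : (N <= M)%N ->
  pairing (cutoff (fun n => (n < N)%N) d) x M = pairing d x N.
Proof.
move=> NM; rewrite /pairing [RHS](big_ord_widen M (fun n => d n * x n)) //.
rewrite [RHS]big_mkcond /=; apply: eq_bigr => i _.
by rewrite /cutoff; case: ltnP => //; rewrite mul0r.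
Qed.

Lemma pairingD d x y N : pairing d (x \+ y) N = pairing d x N + pairing d y N.
Proof. by rewrite /pairing -big_split; apply: eq_bigr => i _; rewrite mulrDr. Qed.

Lemma pairingZ d (c : R) x N : pairing d (fun n => c * x n) N = c * pairing d x N.
Proof. by rewrite /pairing mulr_sumr; apply: eq_bigr => i _; rewrite mulrCA. Qed.

Lemma pairingDl d d' x N :
  pairing (fun n => d n + d' n) x N = pairing d x N + pairing d' x N.
Proof. by rewrite /pairing -big_split; apply: eq_bigr => i _; rewrite mulrDl. Qed.

Lemma pairingZl (c : R) d x N : pairing (fun n => c * d n) x N = c * pairing d x N.
Proof. by rewrite /pairing mulr_sumr; apply: eq_bigr => i _; rewrite mulrA. Qed.

Lemma pairing_cutoff A d x N :
  pairing d (cutoff A x) N = pairing (cutoff A d) x N.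
Proof.
by apply: eq_bigr => i _; rewrite /cutoff; case: ifP; rewrite ?mulr0 ?mul0r.
Qed.

Lemma norming0 le : norming le (fun=> 0).
Proof.
exists unit, (fun=> tt), (fun=> 0); split => //.
  by move=> i /=; rewrite eqxx.
by rewrite big1 ?ler01 // => i _; rewrite expr0n.
Qed.

Lemma normingZ le (c : R) d : `|c| <= 1 -> norming le d ->
  norming le (fun n => c * d n).
Proof.
move=> c1 [L [l [a [la a1 ->]]]].
exists L, l, (fun i => c * a i); split => //.
  by move=> i /=; rewrite mulf_eq0 negb_or => /andP[_ /la].
apply: le_trans a1; apply: ler_sum => i _.
rewrite exprMn ler_piMl ?sqr_ge0 //.
by rewrite -real_normK ?num_real // expr_le1.
Qed.

Lemma norming_le1 le d n : norming le d -> `|d n| <= 1.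
Proof.
move=> [L [l [a [_ a1 ->]]]].
rewrite -(@expr_le1 _ 2) // real_normK ?num_real //.
apply: le_trans a1; rewrite (bigD1 (l n)) //= lerDl.
by apply: sumr_ge0 => i _; exact: sqr_ge0.
Qed.

Lemma norming_cutoff le A d : convex le A -> norming le d ->
  norming le (cutoff A d).
Proof.
move=> cA [L [l [a [la a1 ->]]]].
exists (option L), (fun n => if A n then Some (l n) else None),
  (fun i => if i is Some j then a j else 0); split.
- move=> [i|] /=; last by rewrite eqxx.
  move=> /la /segmentI /(_ cA); apply: eq_segment => n /=.
  by case: (A n); rewrite ?andbT ?andbF.
- rewrite (bigD1 None) //= expr0n add0r (reindex_omap Some id) /=.
    by move: a1; congr (_ <= _); apply: eq_big => // i; rewrite eqxx.
  by case.
- by apply/funext => n; rewrite /cutoff; case: (A n).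
Qed.

(** Source of the lower 2-estimate: test sequences on disjoint convex sets may be combined with any
    coefficients from the l2 unit disc. *)
Lemma norming_comb le A B d1 d2 (s t : R) :
  convex le A -> convex le B -> (forall n, A n -> B n -> False) ->
  s ^+ 2 + t ^+ 2 <= 1 -> norming le d1 -> norming le d2 ->
  norming le (fun n => s * cutoff A d1 n + t * cutoff B d2 n).
Proof.
move=> cA cB AB st [L1 [l1 [a1 [h1 k1 ->]]]] [L2 [l2 [a2 [h2 k2 ->]]]].
exists (option (L1 + L2)%type),
  (fun n => if A n then Some (inl (l1 n)) else if B n then Some (inr (l2 n))
            else None),
  (fun i => match i with Some (inl j) => s * a1 j | Some (inr j) => t * a2 j
            | None => 0 end); split.
- move=> [[i|i]|] /=; last by rewrite eqxx.
  + rewrite mulf_eq0 negb_or => /andP[_ /h1 /segmentI /(_ cA)].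
    apply: eq_segment => n /=.
    by case: (A n); rewrite ?andbT ?andbF //; case: (B n).
  + rewrite mulf_eq0 negb_or => /andP[_ /h2 /segmentI /(_ cB)].
    apply: eq_segment => n /=; have := AB n.
    case: (A n); case: (B n); rewrite ?andbT ?andbF //.
    by move=> /(_ isT isT).
- rewrite (bigD1 None) //= expr0n add0r (reindex_omap Some id) /=; last by case.
  apply: le_trans st.
  under eq_bigl do rewrite eqxx.
  rewrite big_sumType /= (eq_bigr (fun i => s ^+ 2 * a1 i ^+ 2)); last first.
    by move=> i _; rewrite exprMn.
  rewrite [X in _ + X](eq_bigr (fun i => t ^+ 2 * a2 i ^+ 2)); last first.
    by move=> i _; rewrite exprMn.
  by rewrite -!mulr_sumr lerD // ler_piMr ?sqr_ge0.
- apply/funext => n; rewrite /cutoff; have := AB n.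
  case: (A n); case: (B n); rewrite ?mulr0 ?addr0 ?add0r //.
  by move=> /(_ isT isT).
Qed.

(** With pairs as labels, a fibre is a segment for [le] cut by a set convex for [le']; the inclusion
    of the orders makes that set convex for [le], and the sum of squares factors. Two orders are
    allowed for the sake of products of a tree and a line sequence. *)
Lemma normingM le le' d d' : (forall u v, le u v -> le' u v) ->
  norming le d -> norming le' d' -> norming le (fun n => d n * d' n).
Proof.
move=> lele [L1 [l1 [a1 [h1 k1 ->]]]] [L2 [l2 [a2 [h2 k2 ->]]]].
exists (L1 * L2)%type, (fun n => (l1 n, l2 n)), (fun i => a1 i.1 * a2 i.2).
split => //.
- move=> [i j] /=; rewrite mulf_eq0 negb_or => /andP[/h1 H1 /h2 [_ H2]].
  apply: (eq_segment _ (segmentI H1 (B := [pred n | l2 n == j]) _)) => //.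
  by move=> u w v Au Av /lele uw /lele wv; exact: H2 uw wv.
- rewrite -(pair_bigA _ (fun i j => (a1 i * a2 j) ^+ 2)) /=.
  rewrite (eq_bigr (fun i => a1 i ^+ 2 * \sum_j a2 j ^+ 2)); last first.
    by move=> i _; rewrite mulr_sumr; apply: eq_bigr => j _; rewrite exprMn.
  rewrite -mulr_suml mulr_ile1 //; apply: sumr_ge0 => i _; exact: sqr_ge0.
Qed.

Lemma norming_segment le A : segment le A -> norming le (fun n => (A n)%:R).
Proof.
move=> sA; exists bool, A, (fun b : bool => (b : nat)%:R); split => //.
  move=> [] /=; last by rewrite eqxx.
  by move=> _; apply: eq_segment sA => n /=; case: (A n).
by rewrite big_bool /= expr1n expr0n addr0.
Qed.

Lemma values0 le x : values le x !=set0.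
Proof. by exists (pairing (fun=> 0) x 0); exists (fun=> 0), 0%N; split => //; exact: norming0. Qed.

Lemma pairing_pnorm le x d N : pbounded le x -> norming le d ->
  pairing d x N <= pnorm le x.
Proof. by move=> bx dd; apply: ub_le_sup => //; exists d, N. Qed.

Lemma pairing_pnorm_abs le x d N : pbounded le x -> norming le d ->
  `|pairing d x N| <= pnorm le x.
Proof.
move=> bx dd; rewrite ler_norml pairing_pnorm // andbT lerNl -mulN1r -pairingZl.
by apply: pairing_pnorm => //; apply: normingZ => //; rewrite normrN1.
Qed.

Lemma pnorm_ub le x (M : R) :
  (forall d N, norming le d -> pairing d x N <= M) ->
  pbounded le x /\ pnorm le x <= M.
Proof.
move=> h; have ub : ubound (values le x) M by move=> _ [d [N [dd ->]]]; exact: h.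
by split; [exists M|exact: ge_sup (values0 _ _) ub].
Qed.

Lemma pnorm_ge0 le x : pbounded le x -> 0 <= pnorm le x.
Proof.
move=> bx; have := pairing_pnorm 0 bx (norming0 le).
by rewrite /pairing big_ord0.
Qed.

Lemma pbounded_supp le x N : supp_lt x N -> pbounded le x.
Proof.
move=> xN; pose y n := `|x n|.
have yN : supp_lt y N by move=> n /xN h; rewrite /y h normr0.
exists (pairing (fun=> 1) y N) => _ [d [M [dd ->]]].
rewrite -(pairing_supp _ yN (leq_maxr M N)).
apply: (@le_trans _ _ (pairing (fun=> 1) y M)).
  apply: ler_sum => i _; rewrite mul1r (le_trans (ler_norm _)) // normrM.
  by rewrite ler_piMl // (norming_le1 i dd).
rewrite /pairing (big_ord_widen (maxn M N) (fun n => 1 * y n)) ?leq_maxl //.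
rewrite big_mkcond /=; apply: ler_sum => i _; case: ifP => // _.
by rewrite mul1r normr_ge0.
Qed.

Lemma pnorm0 le : pnorm le (fun=> 0) = 0.
Proof.
apply/eqP; rewrite eq_le pnorm_ge0 ?andbT; last exact: (@pbounded_supp _ _ 0%N).
by apply: (pnorm_ub _).2 => d M _; rewrite /pairing big1 // => i _; exact: mulr0.
Qed.

Lemma pnormD le x y : pbounded le x -> pbounded le y ->
  pbounded le (x \+ y) /\ pnorm le (x \+ y) <= pnorm le x + pnorm le y.
Proof.
move=> bx bY; apply: pnorm_ub => d N dd.
by rewrite pairingD lerD // pairing_pnorm.
Qed.

Lemma pnormZ_le le (c : R) x : pbounded le x ->
  pbounded le (fun n => c * x n) /\ pnorm le (fun n => c * x n) <= `|c| * pnorm le x.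
Proof.
move=> bx; apply: pnorm_ub => d N dd; rewrite pairingZ.
by rewrite (le_trans (ler_norm _)) // normrM ler_wpM2l // pairing_pnorm_abs.
Qed.

Lemma pnorm_cutoff le A x : convex le A -> pbounded le x ->
  pbounded le (cutoff A x) /\ pnorm le (cutoff A x) <= pnorm le x.
Proof.
move=> cA bx; apply: pnorm_ub => d N dd; rewrite pairing_cutoff.
by apply: pairing_pnorm => //; exact: norming_cutoff.
Qed.

Lemma scale_pnorm_ub le x (s c : R) : 0 <= s ->
  (forall d N, norming le d -> s * pairing d x N <= c) -> s * pnorm le x <= c.
Proof.
move=> s0 h; have [->|sn0] := eqVneq s 0.
  by have := h _ 0%N (norming0 le); rewrite /pairing big_ord0 mulr0 mul0r.
have sp : 0 < s by rewrite lt_def sn0.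
rewrite mulrC -ler_pdivlMr //.
by apply: (pnorm_ub _).2 => d N dd; rewrite ler_pdivlMr // mulrC h.
Qed.

Lemma convex_ltn le N : (forall u v, le u v -> (u <= v)%N) ->
  convex le (fun n => (n < N)%N).
Proof. by move=> h u w v _ vN _ /h wv; exact: leq_ltn_trans wv vN. Qed.

Lemma convex_geq le N : (forall u v, le u v -> (u <= v)%N) ->
  convex le (fun n => (N <= n)%N).
Proof. by move=> h u w v uN _ /h uw _; exact: leq_trans uN uw. Qed.

(** [x] is tested against [s d1] on [A] plus [t d2] on [B], where [(s, t)] is the direction of the
    vector of the two norms; suprema over [d1] and [d2] give the length of that vector. *)
Lemma pnorm_lower le A B x : (forall u v, le u v -> (u <= v)%N) ->
  convex le A -> convex le B ->
  (forall n, A n -> B n -> False) -> pbounded le x ->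
  pnorm le (cutoff A x) ^+ 2 + pnorm le (cutoff B x) ^+ 2 <= pnorm le x ^+ 2.
Proof.
move=> le_leq cA cB AB bx.
have [bA _] := pnorm_cutoff cA bx; have [bB _] := pnorm_cutoff cB bx.
have p0 := pnorm_ge0 bx; have pA := pnorm_ge0 bA; have pB := pnorm_ge0 bB.
set p := pnorm le x in p0 *; set a := pnorm le _ in pA *; set b := pnorm le _ in pB *.
have key (s t : R) : 0 <= s -> 0 <= t -> s ^+ 2 + t ^+ 2 <= 1 -> s * a + t * b <= p.
  move=> s0 t0 st.
  rewrite -lerBrDr; apply: scale_pnorm_ub => // d1 N1 h1.
  rewrite lerBrDr -lerBrDl; apply: scale_pnorm_ub => // d2 N2 h2.
  rewrite lerBrDl.
  (* The two pairings have different lengths. Cutting off [d1] and [d2] allows a common one; this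
     stays norming because initial intervals are convex. *)
  rewrite -(@pairing_trunc d1 _ _ (maxn N1 N2)) ?leq_maxl //.
  rewrite -(@pairing_trunc d2 _ _ (maxn N1 N2)) ?leq_maxr //.
  rewrite !pairing_cutoff -!pairingZl -pairingDl.
  apply: pairing_pnorm => //; apply: norming_comb => //; apply: norming_cutoff => //;
    exact: convex_ltn.
pose r := Num.sqrt (a ^+ 2 + b ^+ 2).
have rr : r ^+ 2 = a ^+ 2 + b ^+ 2 by rewrite sqr_sqrtr // addr_ge0 ?sqr_ge0.
have r0 : 0 <= r := sqrtr_ge0 _.
have [r1|r1] := eqVneq r 0; first by rewrite -rr r1 expr0n sqr_ge0.
have : a / r * a + b / r * b <= p.
  apply: key; rewrite ?divr_ge0 // !expr_div_n -mulrDl -rr divff //.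
  by rewrite expf_neq0.
have -> : a / r * a + b / r * b = r.
  have -> : a / r * a + b / r * b = (a ^+ 2 + b ^+ 2) / r by ring.
  by rewrite -rr expr2 mulfK.
by move=> rp; rewrite -rr ler_pXn2r.
Qed.

Lemma pairing_labels (L : finType) (l : nat -> L) (a : L -> R) x N :
  pairing (fun n => a (l n)) x N =
  \sum_i a i * \sum_(n < N | l n == i) x n.
Proof.
rewrite /pairing (partition_big (fun n : 'I_N => l n) xpredT) //=.
apply: eq_bigr => i _; rewrite mulr_sumr; apply: eq_bigr => n /eqP <- //.
Qed.

(** Coefficients proportional to the segment sums are extremal. Together with the converse below,
    this identifies [pnorm] with the usual James norm, the supremum of l2 norms of sums over
    disjoint segments. *)
Lemma sum_sqr_le_pnorm le x (L : finType) (l : nat -> L) (P : pred L) N :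
  labelled le l P -> pbounded le x ->
  \sum_(i | P i) (\sum_(n < N | l n == i) x n) ^+ 2 <= pnorm le x ^+ 2.
Proof.
move=> lP bx; pose v i := \sum_(n < N | l n == i) x n.
pose r := Num.sqrt (\sum_(i | P i) v i ^+ 2).
have s0 : 0 <= \sum_(i | P i) v i ^+ 2 by apply: sumr_ge0 => i _; exact: sqr_ge0.
have rr : r ^+ 2 = \sum_(i | P i) v i ^+ 2 by rewrite sqr_sqrtr.
have [r1|r1] := eqVneq r 0; first by rewrite -rr r1 expr0n sqr_ge0.
have r0 : 0 < r by rewrite lt_def r1 sqrtr_ge0.
rewrite -rr ler_pXn2r ?nnegrE ?(ltW r0) ?pnorm_ge0 //.
pose a i := if P i then v i / r else 0.
have <- : pairing (fun n => a (l n)) x N = r.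
  rewrite pairing_labels -/(v _) (bigID P) /= [X in _ + X]big1 ?addr0; last first.
    by move=> i /negbTE Pi; rewrite /a Pi mul0r.
  under eq_bigr => i Pi do rewrite /a Pi -/(v i) mulrAC -expr2.
  by rewrite -mulr_suml -rr expr2 mulfK.
apply: pairing_pnorm => //; exists L, l, a; split => //.
  by move=> i /=; rewrite /a; case: ifP => [Pi _|]; [exact: lP|rewrite eqxx].
rewrite (bigID P) /= [X in _ + X]big1 ?addr0; last first.
  by move=> i /negbTE Pi; rewrite /a Pi expr0n.
under eq_bigr => i Pi do rewrite /a Pi expr_div_n.
by rewrite -mulr_suml -rr divff // expf_neq0.
Qed.

Lemma pnorm_le_of_sum_sqr le x (M : R) : 0 <= M ->
  (forall (L : finType) (l : nat -> L) (P : pred L) N, labelled le l P ->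
    \sum_(i | P i) (\sum_(n < N | l n == i) x n) ^+ 2 <= M ^+ 2) ->
  pbounded le x /\ pnorm le x <= M.
Proof.
move=> M0 h; apply: pnorm_ub => _ N [L [l [a [la a1 ->]]]].
rewrite pairing_labels (bigID (fun i => a i != 0)) /= [X in _ + X]big1 ?addr0; last first.
  by move=> i; rewrite negbK => /eqP ->; rewrite mul0r.
rewrite -[M]mul1r; apply: sum_mul_le => //; last exact: h.
rewrite expr1n; apply: le_trans a1; rewrite big_mkcond /=.
by apply: ler_sum => i _; case: ifP => // _; exact: sqr_ge0.
Qed.

Lemma segment_le_pnorm le x A N : segment le A -> pbounded le x ->
  `|\sum_(n < N | A n) x n| <= pnorm le x.
Proof.
move=> sA bx; have := pairing_pnorm_abs N bx (norming_segment sA).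
by congr (`|_| <= _); rewrite /pairing [RHS]big_mkcond; apply: eq_bigr => i _; case: (A i);
   rewrite ?mul1r ?mul0r.
Qed.

Lemma segment1 le m : (forall u v, le u v -> (u <= v)%N) -> le m m ->
  segment le (fun n => n == m).
Proof.
move=> h mm; split=> [u v /eqP -> /eqP ->|u w v /eqP -> /eqP -> /h mw /h wm].
  by left.
by rewrite eqn_leq wm mw.
Qed.

Lemma coord_le_pnorm le x m : (forall u v, le u v -> (u <= v)%N) -> le m m ->
  pbounded le x -> `|x m| <= pnorm le x.
Proof.
move=> h mm bx; have := segment_le_pnorm m.+1 (segment1 h mm) bx.
by rewrite (big_pred1 (@ord_max m)).
Qed.

End norming.

(** * Splitting functionals *)

Section splitting.
Context {R : realType}.
Implicit Types (x z phi a : nat -> R).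

(** One-dimensional Hahn-Banach extension with the smallest admissible value [c]. Sublinearity is
    asked only on [D], because [pnorm] can be junk outside the finitely supported vectors. *)
Lemma hahn_banach_step (V : lmodType R) (D W : set V) (q f : V -> R) (v : V) :
  (forall u w, D u -> D w -> D (u + w)) -> (forall t u, D u -> D (t *: u)) ->
  (forall u w, D u -> D w -> q (u + w) <= q u + q w) ->
  (forall t u, 0 < t -> D u -> q (t *: u) <= t * q u) ->
  W `<=` D -> W 0 -> (forall u w, W u -> W w -> W (u + w)) ->
  (forall t u, W u -> W (t *: u)) -> D v ->
  (forall u w, W u -> W w -> f (u + w) = f u + f w) ->
  (forall t u, W u -> f (t *: u) = t * f u) ->
  (forall u, W u -> f u <= q u) ->
  exists c, forall t u, W u -> f u + t * c <= q (u + t *: v).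
Proof.
move=> DD DZ qD qZ WD W0 WA WZ Dv fD fZ fq.
pose E : set R := [set r | exists2 u, W u & r = f u - q (u - v)].
have DN : D (- v) by rewrite -scaleN1r; exact: DZ.
have ubE u : W u -> ubound E (q (u + v) - f u).
  move=> Wu _ [w Ww ->].
  suff : f (u + w) <= q (u + v) + q (w - v) by rewrite fD //; lra.
  rewrite (le_trans (fq _ (WA _ _ Wu Ww))) //.
  have -> : u + w = (u + v) + (w - v) by rewrite addrACA subrr addr0.
  by apply: qD; apply: DD => //; exact: WD.
have supE : has_sup E.
  by split; [exists (f 0 - q (0 - v)), 0|exists (q (0 + v) - f 0); exact: ubE].
exists (sup E) => t u Wu; have [t0|t0|->] := ltrgtP t 0; last first.
- by rewrite mul0r scale0r !addr0 fq.
- have Wt : W (t^-1 *: u) by exact: WZ.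
  have tn0 : t != 0 by rewrite gt_eqF.
  have : sup E <= q (t^-1 *: u + v) - f (t^-1 *: u).
    by apply: ge_sup; [case: supE|exact: ubE].
  have : q (t^-1 *: u + v) <= t^-1 * q (u + t *: v).
    have -> : t^-1 *: u + v = t^-1 *: (u + t *: v).
      by rewrite scalerDr scalerA mulVf // scale1r.
    by apply: qZ; [rewrite invr_gt0|apply: DD; [exact: WD|exact: DZ]].
  rewrite fZ // => h1 h2; have := le_trans h2 (lerB h1 (lexx _)).
  rewrite -mulrBr mulrC ler_pdivlMr // => h; lra.
- have s0 : 0 < - t by rewrite oppr_gt0.
  have Wt : W ((- t)^-1 *: u) by exact: WZ.
  have tn0 : - t != 0 by rewrite gt_eqF.
  have : f ((- t)^-1 *: u) - q ((- t)^-1 *: u - v) <= sup E.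
    by apply: ub_le_sup; [case: supE|exists ((- t)^-1 *: u)].
  have : q ((- t)^-1 *: u - v) <= (- t)^-1 * q (u + t *: v).
    have -> : (- t)^-1 *: u - v = (- t)^-1 *: (u + t *: v).
      rewrite scalerDr scalerA (_ : (- t)^-1 * t = -1) ?scaleN1r //.
      by field; rewrite -oppr_eq0.
    by apply: qZ; [rewrite invr_gt0|apply: DD; [exact: WD|exact: DZ]].
  rewrite fZ // => h1 h2; have := le_trans (lerB (lexx _) h1) h2.
  rewrite -mulrBr mulrC ler_pdivrMr // => h; lra.
Qed.

(** On pairs [(z, x)] the functional [phi z] is below [q (z, 0)]. Extending it to
    [phi z + a x <= q (z, x)], one coordinate of [x] at a time, yields [a]; the pairs [(0, x)] and
    [(x, -x)] then give the two bounds. *)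
Lemma pnorm_split le1 le2 phi (C : R) : 0 <= C ->
  (forall x N, supp_lt x N ->
     pairing phi x N <= C * (pnorm le1 x + pnorm le2 x)) ->
  exists a, (forall x N, supp_lt x N -> pairing a x N <= C * pnorm le1 x) /\
    (forall x N, supp_lt x N ->
       pairing (fun n => phi n - a n) x N <= C * pnorm le2 x).
Proof.
move=> C0 hphi.
pose V := ((nat -> R^o) * (nat -> R^o))%type.
pose D : set V := [set u | exists N, supp_lt u.1 N /\ supp_lt u.2 N].
pose q (u : V) := C * (pnorm le1 (u.1 + u.2) + pnorm le2 u.1).
pose inv n a := forall z x N, supp_lt z N -> supp_lt x n -> (n <= N)%N ->
  pairing phi z N + pairing a x n <= q (z, x).
pose set_at n a c k := if k == n then c else a k : R.
have suppD x y N M : supp_lt x N -> supp_lt y M -> supp_lt (x + y) (maxn N M).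
  move=> hx hy n; rewrite geq_max => /andP[h1 h2].
  by rewrite fctE hx // hy // addr0.
have suppZ (t : R) (x : nat -> R^o) N : supp_lt x N -> supp_lt (t *: x) N.
  by move=> hx n /hx h; rewrite fctE h scaler0.
have suppW x N M : supp_lt x N -> (N <= M)%N -> supp_lt x M.
  by move=> hx NM n /(leq_trans NM) /hx.
have pD le (x y : nat -> R^o) N M : supp_lt x N -> supp_lt y M ->
    pnorm le (x + y) <= pnorm le x + pnorm le y.
  move=> hx hy; have -> : x + y = ((x : nat -> R) \+ (y : nat -> R)) by apply/funext.
  exact: (pnormD (@pbounded_supp R le x N hx) (@pbounded_supp R le y M hy)).2.
have pZ le (t : R) (x : nat -> R^o) N : 0 < t -> supp_lt x N ->
    pnorm le (t *: x) <= t * pnorm le x.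
  move=> t0 hx; rewrite -[X in X * _](gtr0_norm t0).
  exact: (pnormZ_le t (@pbounded_supp R le x N hx)).2.
have step n a : inv n a -> exists c, inv n.+1 (set_at n a c).
  move=> ia.
  pose W : set V := [set u | (exists N, supp_lt u.1 N) /\ supp_lt u.2 n].
  (* Pairings past the support do not depend on the length, so on [W] this set is a singleton and
     [sup] merely extracts its element. *)
  pose f (u : V) := sup [set r | exists N, [/\ supp_lt u.1 N, (n <= N)%N &
                                 r = pairing phi u.1 N + pairing a u.2 n]].
  have fE (u : V) N : supp_lt u.1 N -> (n <= N)%N ->
      f u = pairing phi u.1 N + pairing a u.2 n.
    move=> h1 h2; rewrite /f -[RHS]sup1; congr sup; apply/seteqP; split => r /=.
      move=> [M [h3 h4 ->]]; congr (_ + _).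
      by rewrite -(pairing_supp phi h3 (leq_maxl M N)) -(pairing_supp phi h1 (leq_maxr M N)).
    by move=> ->; exists N.
  pose e : V := (0, fun k => (k == n)%:R).
  have De : D e.
    exists n.+1; split=> k //= nk.
    by rewrite gtn_eqF.
  have [] := @hahn_banach_step V D W q f e.
  - move=> u w [N [h1 h2]] [M [h3 h4]]; exists (maxn N M).
    by split; apply: suppD.
  - by move=> t u [N [h1 h2]]; exists N; split; exact: suppZ.
  - move=> [u1 u2] [w1 w2] [N [/= h1 h2]] [M [/= h3 h4]].
    rewrite /q /= -mulrDr ler_wpM2l // addrACA.
    rewrite [leRHS]addrACA lerD //.
      exact: (pD _ _ _ _ _ (suppD _ _ _ _ h1 h2) (suppD _ _ _ _ h3 h4)).
    exact: (pD _ _ _ _ _ h1 h3).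
  - move=> t [u1 u2] t0 [N [/= h1 h2]].
    rewrite /q /= mulrCA ler_wpM2l // mulrDr -scalerDr lerD //.
      exact: (pZ _ _ _ _ t0 (suppD _ _ _ _ h1 h2)).
    exact: (pZ _ _ _ _ t0 h1).
  - move=> [u1 u2] [[N /= h1] h2]; exists (maxn N n); split => /=.
      exact: suppW h1 (leq_maxl _ _).
    exact: suppW h2 (leq_maxr _ _).
  - by split; [exists 0%N|].
  - move=> u w [[N h1] h2] [[M h3] h4]; split.
      by exists (maxn N M); exact: suppD.
    by have := suppD _ _ _ _ h2 h4; rewrite maxnn.
  - by move=> t u [[N h1] h2]; split; [exists N|]; exact: suppZ.
  - exact: De.
  - move=> [u1 u2] [w1 w2] [[N /= h1] h2] [[M /= h3] h4].
    pose K := maxn n (maxn N M).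
    rewrite !(@fE _ K) ?leq_maxl //=.
    + by rewrite !pairingD addrACA.
    + by apply: suppW h3 _; rewrite /K !leq_max leqnn !orbT.
    + by apply: suppW h1 _; rewrite /K !leq_max leqnn !orbT.
    + by apply: suppW (suppD _ _ _ _ h1 h3) _; rewrite /K leq_maxr.
  - move=> t [u1 u2] [[N /= h1] h2]; pose K := maxn n N.
    rewrite !(@fE _ K) ?leq_maxl //=.
    + by rewrite !pairingZ mulrDr.
    + by apply: suppW h1 _; rewrite /K leq_maxr.
    + by apply: suppZ; apply: suppW h1 _; rewrite /K leq_maxr.
  - move=> [u1 u2] [[N /= h1] h2]; pose K := maxn n N.
    have h : supp_lt u1 K by apply: suppW h1 _; rewrite /K leq_maxr.
    by rewrite (@fE _ K) ?leq_maxl //=; apply: ia; rewrite ?leq_maxl.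
  move=> c hc; exists c => z x N hz hx nN.
  pose x' := cutoff (fun k => (k < n)%N) x.
  have hx' : supp_lt x' n by move=> k nk; rewrite /x' /cutoff ltnNge nk.
  have := hc (x n) (z, x'); rewrite (@fE _ N) ?(ltnW nN) //= => h.
  have -> : pairing (set_at n a c) x n.+1 = pairing a x' n + x n * c.
    rewrite /pairing big_ord_recr /= /set_at eqxx mulrC; congr (_ + _).
    by apply: eq_bigr => i _; rewrite /x' /cutoff ltn_ord ltn_eqF.
  rewrite addrA (le_trans (h _)) //.
    by split; [exists N|].
  rewrite [X in q X](_ : _ = (z, x)) //; apply: injective_projections.
    by apply/funext => k; rewrite /= !fctE scaler0 addr0.
  apply/funext => k; rewrite /= !fctE /x' /cutoff /GRing.scale /=.
  have [kn|kn|->] := ltngtP k n; rewrite ?mulr0 ?mulr1 ?addr0 ?add0r //.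
  by rewrite hx.
have inv0 : inv 0%N (fun=> 0).
  move=> z x N hz hx _; rewrite [X in _ + X]/pairing big_ord0 addr0 (le_trans (hphi _ _ hz)) //.
  rewrite /q /=; have -> : x = 0 by apply/funext => k; exact: hx.
  by rewrite addr0.
pose T n := {a | inv n a}.
pose next n (a : T n) : T n.+1 :=
  let c := cid (step n _ (svalP a)) in exist _ (set_at n (sval a) (sval c)) (svalP c).
pose A := nat_rect T (exist _ _ inv0) next.
(* Stage [k.+1] fixes coordinate [k], and later stages leave it unchanged. *)
pose a k := sval (A k.+1) k.
have AE n k : (k < n)%N -> sval (A n) k = a k.
  elim: n => // n IH; rewrite ltnS leq_eqVlt => /orP[/eqP -> //|kn].
  by rewrite /= /set_at ltn_eqF // IH.
have aA x n : pairing a x n = pairing (sval (A n)) x n.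
  by apply: eq_bigr => i _; rewrite AE.
exists a; split => x N xN; rewrite ?aA.
  have := svalP (A N) 0 x N; rewrite /q /= => h.
  have /h {h} h : supp_lt (0 : nat -> R) N by [].
  have := h xN (leqnn N); rewrite add0r.
  have -> : pairing phi 0 N = 0 by apply: big1 => i _; exact: mulr0.
  have -> : pnorm le2 (0 : nat -> R) = 0 by exact: pnorm0.
  by rewrite add0r addr0.
have := svalP (A N) x (- x) N xN; rewrite /q /= -aA => h.
have : supp_lt (- x) N by move=> n /xN h'; rewrite fctE h' oppr0.
move=> /h /(_ (leqnn N)); rewrite subrr.
have -> : pnorm le1 (0 : nat -> R) = 0 by exact: pnorm0.
rewrite add0r; congr (_ <= _); rewrite /pairing -big_split; apply: eq_bigr => i _ /=.
by rewrite fctE; ring.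
Qed.

End splitting.

(** * Trees *)

Definition ancestor (par : nat -> nat) (u v : nat) := exists k, iter k par v = u.

(** The inequalities make 0 the root of a tree numbered increasingly along ancestry; the bounded
    fibres are finite branching, for Koenig's lemma. *)
Record is_parent (par : nat -> nat) : Prop := IsParent {
  parent_le : forall n, (par n <= n)%N;
  parent_lt : forall n, (0 < n)%N -> (par n < n)%N;
  parent_fiber : forall m, exists K, forall n, par n = m -> (n < K)%N }.

Section tree.
Context {par : nat -> nat} (parP : is_parent par).
Local Notation anc := (ancestor par).
Implicit Types (u v w s t n : nat) (b : pred nat).

Definition branch b :=
  [/\ forall u v, b u -> b v -> anc u v \/ anc v u,
      forall u v, b v -> anc u v -> b u &
      forall n, exists2 s, (n <= s)%N & b s].

Lemma anc_refl u : anc u u.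
Proof. by exists 0%N. Qed.

Lemma anc_trans u v w : anc u v -> anc v w -> anc u w.
Proof. by move=> [k <-] [l <-]; exists (k + l)%N; rewrite iterD. Qed.

Lemma anc_leq u v : anc u v -> (u <= v)%N.
Proof.
move=> [k <-]; elim: k => //= k IH.
by apply: leq_trans (parent_le parP _) IH.
Qed.

Lemma anc_chain u v w : anc u w -> anc v w -> anc u v \/ anc v u.
Proof.
have sub k l : (k <= l)%N -> anc (iter l par w) (iter k par w).
  by move=> kl; exists (l - k)%N; rewrite -iterD subnK.
move=> [k <-] [l <-]; case/orP: (leq_total k l) => /sub; first by right.
by left.
Qed.

Lemma anc0 v : anc 0%N v.
Proof.
elim/ltn_ind: v => n IH.
have [->|n0] := posnP n; first exact: anc_refl.
by apply: anc_trans (IH _ (parent_lt parP n0)) _; exists 1%N.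
Qed.

Lemma anc_child u t : anc u t -> u != t -> exists v, [/\ par v = u, (u < v)%N & anc v t].
Proof.
move=> [k]; elim: k u => [u /= -> |k IH u /= ku ut]; first by rewrite eqxx.
have [uv|uv] := eqVneq (iter k par t) u.
  by apply: IH => //.
exists (iter k par t); split => //; last by exists k.
rewrite ltn_neqAle eq_sym uv -ku parent_le //.
Qed.

Lemma branch_chain b u v : branch b -> b u -> b v -> (u <= v)%N -> anc u v.
Proof.
move=> [ch _ _] bu bv uv; case: (ch u v bu bv) => // vu.
have -> : u = v by apply/eqP; rewrite eqn_leq uv anc_leq.
exact: anc_refl.
Qed.

Lemma branch_segment b : branch b -> segment anc b.
Proof.
move=> [ch dn _]; split => // u w v _ bv _ wv; exact: dn wv.
Qed.

Lemma branch_tail_segment b n : branch b ->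
  segment anc [pred s | b s && (n <= s)%N].
Proof.
move=> /branch_segment /segmentI; apply; apply: convex_geq; exact: anc_leq.
Qed.

(** Branches are closed under ancestors, so past a node lying on only one of them a common node
    would put that node on both. *)
Lemma branch_separation b b' : branch b -> branch b' -> b != b' ->
  exists n, forall s, (n <= s)%N -> b s -> b' s -> False.
Proof.
move=> hb hb' nbb'.
have [s bs] : exists s, b s != b' s.
  apply/not_existsP => h; move/eqP: nbb'; apply; apply/funext => s.
  by apply/eqP; apply: contrapT => /negP; exact: h.
exists s.+1 => t st bt b't; have [_ dn _] := hb; have [_ dn' _] := hb'.
move: bs; case bs: (b s); case b's: (b' s) => //= _.
  by move: b's; rewrite (dn' s t) //; apply: (branch_chain hb) => //; exact: ltnW.
by move: bs; rewrite (dn s t) //; apply: (branch_chain hb') => //; exact: ltnW.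
Qed.

Lemma branches_separation (B : seq (pred nat)) : (forall b, b \in B -> branch b) ->
  exists n, forall b b' s, b \in B -> b' \in B -> b != b' ->
    (n <= s)%N -> b s -> b' s -> False.
Proof.
move=> hB.
have /choice[f hf] : forall bb : pred nat * pred nat, exists n,
    bb.1 \in B -> bb.2 \in B -> bb.1 != bb.2 ->
    forall s, (n <= s)%N -> bb.1 s -> bb.2 s -> False.
  move=> [b b'] /=.
  have [[h1 [h2 h3]]|h] := pselect (b \in B /\ b' \in B /\ b != b').
    have [n hn] := branch_separation (hB _ h1) (hB _ h2) h3.
    by exists n => _ _ _.
  by exists 0%N => h1 h2 h3; case: h.
exists (\max_(b <- B) \max_(b' <- B) f (b, b'))%N => b b' s bB b'B bb' ns.
apply: (hf (b, b')) => //=; apply: leq_trans ns.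
apply: leq_trans (leq_bigmax_seq _ bB _) => //.
exact: (@leq_bigmax_seq _ _ _ (fun b' => f (b, b'))).
Qed.

(** The branch descends through nodes with bad descendants beyond every bound. If no child of such a
    node were of this kind, the maximum of finitely many bounds would leave no bad descendant far
    out. *)
Lemma koenig (bad : nat -> Prop) : (forall u v, anc u v -> bad v -> bad u) ->
  (forall n, exists2 t, (n <= t)%N & bad t) ->
  exists2 b, branch b & forall s, b s -> bad s.
Proof.
move=> mono inf_bad.
pose P u := forall n, exists t, [/\ (n <= t)%N, bad t & anc u t].
have P0 : P 0%N by move=> n; have [t nt bt] := inf_bad n; exists t; split => //; exact: anc0.
have step u : P u -> exists v, [/\ par v = u, (u < v)%N & P v].
  move=> Pu; apply: contrapT => /forallNP h.
  have [K hK] := parent_fiber parP u.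
  have /choice[f hf] : forall v, exists n, par v = u -> (u < v)%N ->
      forall t, (n <= t)%N -> bad t -> ~ anc v t.
    move=> v; have [[pv uv]|nv] := pselect (par v = u /\ (u < v)%N); last first.
      by exists 0%N => pv uv; case: nv.
    have /existsNP[n hn] : ~ P v by move=> Pv; apply: (h v).
    by exists n => _ _ t nt bt vt; apply: hn; exists t.
  have [t [tn bt ut]] := Pu (maxn u.+1 (\max_(v < K) f v)).
  move: tn; rewrite geq_max => /andP[ut' tK].
  have [|v [pv uv vt]] := anc_child ut; first by rewrite ltn_eqF.
  apply: (hf v pv uv t _ bt vt); apply: leq_trans tK.
  by apply: (@leq_bigmax _ (fun v : 'I_K => f v) (Ordinal (hK _ pv))).
have /choice[g hg] : forall u, exists v, P u -> [/\ par v = u, (u < v)%N & P v].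
  move=> u; have [/step[v hv]|nP] := pselect (P u); first by exists v.
  by exists 0%N.
pose f n := iter n g 0%N.
have Pf n : P (f n) by elim: n => //= n /hg[].
have parf n : par (f n.+1) = f n by have [] := hg _ (Pf n).
have ltf n : (f n < f n.+1)%N by have [] := hg _ (Pf n).
have gef n : (n <= f n)%N by elim: n => // n IH; exact: leq_ltn_trans IH (ltf n).
have ancf m n : (m <= n)%N -> anc (f m) (f n).
  move=> /subnK <-; elim: (n - m)%N => [|k IH]; first exact: anc_refl.
  by apply: anc_trans IH _; exists 1%N; rewrite addSn /= -/(f _) parf.
have ff n k : exists m, iter k par (f n) = f m.
  elim: k => [|k [m /= ->]]; first by exists n.
  case: m => [|m]; last by exists m.
  by exists 0%N; apply/eqP; rewrite -leqn0 parent_le.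
exists (fun s => `[< exists n, f n = s >]); last first.
  move=> s /asboolP[n <-]; have [t [_ bt st]] := Pf n 0%N.
  exact: mono st bt.
split.
- move=> _ _ /asboolP[m <-] /asboolP[n <-].
  by case/orP: (leq_total m n) => /ancf; [left|right].
- by move=> u _ /asboolP[n <-] [k <-]; apply/asboolP; have [m ->] := ff n k; exists m.
- by move=> n; exists (f n) => //; apply/asboolP; exists n.
Qed.

(* The least ancestor of [s] that is at least [m]: the node through which the
   branch of [s] enters the tail [[m, oo)]. *)
Lemma entrance m : exists e : nat -> nat,
  (forall s, (m <= s)%N -> (m <= e s)%N /\ anc (e s) s) /\
  (forall s t, (m <= s)%N -> anc s t -> e s = e t).
Proof.
have /choice[e he] : forall s, exists u, (m <= s)%N ->
    [/\ (m <= u)%N, anc u s & forall w, (m <= w)%N -> anc w s -> (u <= w)%N].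
  move=> s; have [ms|] := leqP m s; last by exists 0%N.
  have ex : exists u, (m <= u)%N && `[< anc u s >].
    by exists s; rewrite ms; apply/asboolP; exact: anc_refl.
  case: (ex_minnP ex) => u /andP[mu /asboolP us] hu; exists u => _; split => // w mw ws.
  by apply: hu; rewrite mw; apply/asboolP.
exists e; split=> [s /he[] //|s t ms st].
have mt := leq_trans ms (anc_leq st).
have [h1 h2 h3] := he s ms; have [k1 k2 k3] := he t mt.
apply/eqP; rewrite eqn_leq k3 //; last exact: anc_trans h2 st.
rewrite andbT; case: (anc_chain k2 st) => [kt|kt]; first exact: h3.
by rewrite (leq_trans (anc_leq h2)) // anc_leq.
Qed.

End tree.

(** * Functionals along branches *)

Section finite_vectors.
Context {R : realType} {le : nat -> nat -> Prop}.
Implicit Types (x y F : nat -> R) (A : pred nat).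

Definition indicator A : nat -> R := fun n => (A n)%:R.

Definition delta s : nat -> R := fun n => (n == s)%:R.

Definition dominated F (C : R) :=
  forall x N, supp_lt x N -> `|pairing F x N| <= C * pnorm le x.

Lemma supp_ltW x N M : supp_lt x N -> (N <= M)%N -> supp_lt x M.
Proof. by move=> xN NM n /(leq_trans NM) /xN. Qed.

Lemma supp_ltD x y N : supp_lt x N -> supp_lt y N -> supp_lt (x \+ y) N.
Proof. by move=> xN yN n Nn; rewrite /= xN // yN // addr0. Qed.

Lemma supp_ltZ (c : R) x N : supp_lt x N -> supp_lt (fun n => c * x n) N.
Proof. by move=> xN n /xN ->; rewrite mulr0. Qed.

Lemma delta_supp s : supp_lt (delta s) s.+1.
Proof. by move=> n sn; rewrite /delta gtn_eqF. Qed.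

Lemma pairing_delta F s N : (s < N)%N -> pairing F (delta s) N = F s.
Proof.
move=> sN; rewrite /pairing (bigD1 (Ordinal sN)) //= /delta eqxx mulr1.
rewrite big1 ?addr0 // => i; rewrite -val_eqE /= => /negbTE ->.
by rewrite mulr0.
Qed.

Lemma pnorm_ge0_supp x N : supp_lt x N -> 0 <= pnorm le x.
Proof. by move=> xN; apply: pnorm_ge0; exact: pbounded_supp xN. Qed.

Lemma pnorm_ub_supp x K (M : R) : (forall u v, le u v -> (u <= v)%N) ->
  supp_lt x K -> (forall d, norming le d -> pairing d x K <= M) -> pnorm le x <= M.
Proof.
move=> le_leq xK h; apply: (pnorm_ub _).2 => d N dd.
rewrite -(pairing_trunc d x (leq_maxl N K)) (pairing_supp _ xK (leq_maxr N K)).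
by apply: h; apply: norming_cutoff => //; exact: convex_ltn.
Qed.

Lemma pnorm_delta s : pnorm le (delta s) <= 1.
Proof.
apply: (pnorm_ub _).2 => d N dd; have [sN|Ns] := ltnP s N.
  by rewrite pairing_delta // (le_trans (ler_norm _)) // (norming_le1 s dd).
rewrite /pairing big1 // => i _; rewrite /delta ltn_eqF ?mulr0 //.
exact: leq_trans (ltn_ord i) Ns.
Qed.

Lemma pairing_indicator A x N : pairing (indicator A) x N = \sum_(n < N | A n) x n.
Proof.
rewrite /pairing [RHS]big_mkcond; apply: eq_bigr => i _; rewrite /indicator.
by case: (A i); rewrite ?mul1r ?mul0r.
Qed.

Lemma segment_norm_le A x N M : segment le A -> supp_lt x M ->
  `|pairing (indicator A) x N| <= pnorm le x.
Proof.
move=> sA xM; apply: pairing_pnorm_abs; first exact: pbounded_supp xM.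
exact: norming_segment.
Qed.

End finite_vectors.
Arguments dominated {R} le F C.

Section branch_functionals.
Context {R : realType} {par : nat -> nat} (parP : is_parent par).
Local Notation anc := (ancestor par).
Local Notation pn := (pnorm anc).
Implicit Types (x y F : nat -> R) (b : pred nat).

Let anc_le := anc_leq parP.

(* Vectors which move further and further down one branch and on which that
   branch vanishes have a weak upper 2-estimate: a segment meeting several of
   them covers all but the first and the last along the branch. *)
Lemma branch_blocks (b : pred nat) (eta : R) F : branch b (par := par) ->
  (forall n, exists s y M, [/\ (n <= s)%N, b s, supp_lt y M,
     forall k, y k != 0 -> anc s k &
     [/\ pn y <= 2, pairing (indicator b) y M = 0 & eta < pairing F y M]]) ->
  forall k, exists Y N, [/\ supp_lt Y N, k%:R * eta <= pairing F Y N,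
    (forall (L : finType) (l : nat -> L) (P : pred L) M, labelled anc l P ->
      \sum_(i | P i) (\sum_(n < M | l n == i) Y n) ^+ 2 <= 12 * k%:R) &
    forall j, `|pairing (indicator [pred n | b n && (j <= n)%N]) Y N| <= 2].
Proof.
move=> hb bad; elim=> [|k [Y [N [YN FY sqY tailY]]]].
  exists (fun=> 0), 0%N; split => //.
  - by rewrite mul0r /pairing big_ord0.
  - move=> L l P M _; rewrite mulr0 big1 // => i _.
    by rewrite big1 ?expr0n // => j _.
  - by move=> j; rewrite /pairing big_ord0 normr0.
have [s [y [M [Ns bs yM sy [y2 yb Fy]]]]] := bad N.
pose K := maxn N M.
have YK : supp_lt Y K := supp_ltW YN (leq_maxl _ _).
have yK : supp_lt y K := supp_ltW yM (leq_maxr _ _).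
have PY G : pairing G Y K = pairing G Y N by rewrite (pairing_supp G YN (leq_maxl _ _)).
have Py G : pairing G y K = pairing G y M by rewrite (pairing_supp G yM (leq_maxr _ _)).
have y_lt n : (n < s)%N -> y n = 0.
  by move=> ns; apply/eqP; apply: contraTT ns => /sy /anc_le; rewrite -leqNgt.
have tail_y j : (j <= s)%N -> pairing (indicator [pred n | b n && (j <= n)%N]) y K = 0.
  move=> js; rewrite -yb -Py; apply: eq_bigr => n _; rewrite /indicator /=.
  have [sn|ns] := leqP s n; first by rewrite (leq_trans js sn) andbT.
  by rewrite y_lt // !mulr0.
have seg_y A n : segment anc A -> `|pairing (indicator A) y n| <= 2.
  by move=> sA; apply: le_trans y2; exact: segment_norm_le sA yM.
exists (Y \+ y), K; split.
- exact: supp_ltD.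
- rewrite pairingD PY Py -(natr1 k) mulrDl mul1r.
  by rewrite lerD // ltW.
- move=> L l P M' lP.
  have sum2 : \sum_(i | P i) (\sum_(n < M' | l n == i) y n) ^+ 2 <= 4.
    have -> : 4 = 2 ^+ 2 :> R by rewrite -natrX.
    apply: (le_trans (sum_sqr_le_pnorm _ lP (pbounded_supp _ yM))).
    by rewrite ler_pXn2r // ?nnegrE // (pnorm_ge0_supp yM).
  pose a i := \sum_(n < M' | l n == i) Y n; pose c i := \sum_(n < M' | l n == i) y n.
  (* Only the segment through [s] can meet both the old vector, which ends before [s], and the new
     one, which lives below [s]. On it the old sum is a tail sum along [b], bounded by the
     invariant. *)
  have cross : \sum_(i | P i) a i * c i <= 4.
    have [M's|sM'] := leqP M' s.
      rewrite big1 // => i _; rewrite [c i]big1 ?mulr0 // => n _.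
      by rewrite y_lt // (leq_trans (ltn_ord n)).
    have off i : i != l s -> P i -> a i * c i = 0.
      move=> ils Pi.
      have [/existsP[n1 /andP[/eqP ln1 Yn1]]|/existsPn h] :=
          boolP [exists n : 'I_M', (l n == i) && (Y n != 0)]; last first.
        rewrite [a i]big1 ?mul0r // => n ln; have := h n.
        by rewrite ln /= negbK => /eqP.
      rewrite [c i]big1 ?mulr0 // => n2 /eqP ln2; apply/eqP/negPn/negP => /sy sn2.
      case: (lP i Pi) => ch cv.
      have n1N : (n1 < N)%N by rewrite ltnNge; apply: contra Yn1 => /YN ->.
      have n1s : (n1 < s)%N by exact: leq_trans n1N Ns.
      have n12 : anc n1 n2.
        case: (ch n1 n2); rewrite /= ?ln1 ?ln2 // => /anc_le n21.
        by have := leq_trans (anc_le sn2) n21; rewrite leqNgt n1s.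
      have a1s : anc n1 s.
        case: (anc_chain n12 sn2) => // /anc_le; by rewrite leqNgt n1s.
      have := cv n1 s n2; rewrite /= ln1 ln2 !eqxx => /(_ isT isT a1s sn2) /eqP lsi.
      by rewrite lsi eqxx in ils.
    have [Pls|nPls] := boolP (P (l s)); last first.
      rewrite big1 // => i Pi; apply: off => //.
      by apply: contraNneq nPls => <-.
    rewrite (bigD1 (l s)) //= big1 ?addr0; last by move=> i /andP[Pi ils]; exact: off.
    have [ch cv] := lP _ Pls.
    have c2 : `|c (l s)| <= 2.
      by rewrite /c -(@pairing_indicator R [pred n | l n == l s]) seg_y.
    have a2 : `|a (l s)| <= 2.
      have anc_s n : (n < N)%N -> l n == l s -> anc n s.
        move=> nN ln; case: (ch n s); rewrite /= ?ln ?eqxx // => /anc_le sn.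
        by have := leq_trans (leq_trans nN Ns) sn; rewrite ltnn.
      have [_ dn _] := hb.
      rewrite /a -(pairing_indicator [pred n | l n == l s]).
      rewrite (pairing_supp _ YN (ltnW (leq_ltn_trans Ns sM'))).
      have [exS|noS] := pselect (exists n, (n < N)%N && (l n == l s)); last first.
        rewrite /pairing big1 ?normr0 // => n _; rewrite /indicator /=.
        case: eqP => [ln|]; last by rewrite mul0r.
        by case: noS; exists n; rewrite ln eqxx ltn_ord.
      case: (ex_minnP exS) => j /andP[jN lj] jmin.
      have bj : b j by apply: dn bs _; exact: anc_s.
      have -> : pairing (indicator [pred n | l n == l s]) Y N =
                pairing (indicator [pred n | b n && (j <= n)%N]) Y N.
        apply: eq_bigr => n _; rewrite /indicator /=; congr (_%:R * _).
        congr nat_of_bool; apply/idP/idP => [ln|/andP[bn jn]].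
          by rewrite jmin ?ln ?ltn_ord // (dn _ _ bs) //; exact: anc_s.
        apply: (cv j n s) => //=.
          exact: (branch_chain parP hb).
        by apply: (branch_chain parP hb) => //; exact: leq_trans (ltnW (ltn_ord n)) Ns.
      exact: tailY.
    rewrite (le_trans (ler_norm _)) // normrM.
    have -> : 4 = 2 * 2 :> R by rewrite -natrM.
    exact: ler_pM.
  rewrite (eq_bigr (fun i => a i ^+ 2 + c i ^+ 2 + 2 * (a i * c i))); last first.
    by move=> i _; rewrite big_split /= -/(a i) -/(c i); ring.
  rewrite !big_split /= -mulr_sumr -(natr1 k).
  have := sqY L l P M' lP; rewrite -/(a _) => h.
  (* The new block adds 4 to the squares and twice 4 for the cross term, hence 12. *)
  have -> : 12 * (k%:R + 1) = 12 * k%:R + 4 + 2 * 4 :> R by ring.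
  by rewrite !lerD // ler_pM2l.
(* A tail starting at or before [s] contains the whole new block, on which [b] vanishes; a later
   tail misses the old vector. *)
- move=> j; rewrite pairingD PY; have [js|sj] := leqP j s.
    by rewrite tail_y // addr0.
  rewrite [pairing _ Y N]big1 ?add0r; last first.
    move=> n _; rewrite /indicator /= (_ : (j <= n)%N = false) ?andbF ?mul0r //.
    by apply/negbTE; rewrite -ltnNge (leq_trans (ltn_ord n)) // (leq_trans Ns) // ltnW.
  by apply: seg_y; exact: branch_tail_segment.
Qed.

End branch_functionals.

Section branch_limits.
Context {R : realType} {par : nat -> nat} (parP : is_parent par).
Local Notation anc := (ancestor par).
Local Notation pn := (pnorm anc).
Local Notation branch := (branch (par := par)).
Implicit Types (x y F : nat -> R) (b : pred nat) (B : seq (pred nat)).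

Let anc_le := anc_leq parP.

Lemma pairingBl F G x N :
  pairing (fun n => F n - G n) x N = pairing F x N - pairing G x N.
Proof. by rewrite /pairing -sumrB; apply: eq_bigr => i _; rewrite mulrBl. Qed.

Lemma pairing_suml (I : eqType) (r : seq I) (P : pred I) (G : I -> nat -> R) x N :
  pairing (fun n => \sum_(i <- r | P i) G i n) x N =
  \sum_(i <- r | P i) pairing (G i) x N.
Proof.
by rewrite /pairing exchange_big /=; apply: eq_bigr => i _; rewrite mulr_suml.
Qed.

Lemma pairing_sumr (I : eqType) (r : seq I) (P : pred I) (c : I -> R)
    (y : I -> nat -> R) F N :
  pairing F (fun n => \sum_(i <- r | P i) c i * y i n) N =
  \sum_(i <- r | P i) c i * pairing F (y i) N.
Proof.
transitivity (\sum_(n < N) \sum_(i <- r | P i) c i * (F n * y i n)).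
  by apply: eq_bigr => n _; rewrite mulr_sumr; apply: eq_bigr => i _; rewrite mulrCA.
by rewrite exchange_big /=; apply: eq_bigr => i _; rewrite mulr_sumr.
Qed.

(** If this fails, normalized vectors [x - chi delta s] satisfy the hypothesis of [branch_blocks]. A
    sum of [k] of them has norm at most [sqrt (12 k)] and value at least [k eta], which a bounded
    functional excludes for large [k]. *)
Lemma branch_local F (C : R) b (eta : R) : 0 <= C -> dominated anc F C -> branch b ->
  0 < eta -> exists n, forall s, b s -> (n <= s)%N -> forall x N, supp_lt x N ->
    (forall k, x k != 0 -> anc s k) ->
    `|pairing F x N - F s * pairing (indicator b) x N| <= eta * pn x.
Proof.
move=> C0 hF hb eta0; apply: contrapT => /forallNP nex.
have bad : forall n, exists s y M, [/\ (n <= s)%N, b s, supp_lt y M,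
     forall k, y k != 0 -> anc s k &
     [/\ pn y <= 2, pairing (indicator b) y M = 0 & eta < pairing F y M]].
  move=> n; have := nex n; move=> /existsNP[s /not_implyP[bs /not_implyP[ns]]].
  move=> /existsNP[x /existsNP[N /not_implyP[xN /not_implyP[xs /negP]]]].
  rewrite -ltNge; set chi := pairing (indicator b) x N; set D := pairing F x N - _ => hD.
  have r0 : 0 <= pn x := pnorm_ge0_supp xN.
  have chir : `|chi| <= pn x by exact: (segment_norm_le N (branch_segment hb) xN).
  have rp : 0 < pn x.
    rewrite lt_def r0 andbT; apply: contraTneq hD => r1; rewrite -leNgt r1 mulr0.
    rewrite (le_trans (ler_normB _ _)) // normrM.
    have := hF _ _ xN; rewrite r1 mulr0 => h1; move: chir; rewrite r1 => h2.
    have -> : `|chi| = 0 by apply/eqP; rewrite eq_le h2 normr_ge0.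
    by rewrite mulr0 addr0.
  pose c := Num.sg D / pn x; pose K := maxn N s.+1.
  have xK : supp_lt x K := supp_ltW xN (leq_maxl _ _).
  have dK : supp_lt (delta s : nat -> R) K := supp_ltW (@delta_supp R s) (leq_maxr _ _).
  (* The correction at [s] makes [b] vanish on [z] and turns the value of [F] into [D], while the
     norm at most doubles. *)
  pose z n := x n + (- chi) * delta s n.
  have zK : supp_lt z K := supp_ltD xK (supp_ltZ _ dK).
  have pz G : pairing G (fun n => c * z n) K = c * (pairing G x N - chi * G s).
    rewrite pairingZ (pairingD G x (fun n => (- chi) * delta s n)) pairingZ.
    by rewrite (pairing_supp G xN (leq_maxl _ _)) pairing_delta ?leq_maxr // mulNr.
  exists s, (fun n => c * z n), K; split => //.
  - exact: supp_ltZ.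
  - move=> k; rewrite /z /delta; have [-> _|ks] := eqVneq k s; first exact: anc_refl.
    by rewrite mulr0 addr0 mulf_eq0 negb_or => /andP[_ /xs].
  split.
  - apply: (le_trans (pnormZ_le c (pbounded_supp anc zK)).2).
    have cr : `|c| <= (pn x)^-1.
      rewrite /c normrM normfV (ger0_norm r0) ler_piMl ?invr_ge0 //.
      by rewrite normr_sg; case: (D != 0).
    have pz2 : pn z <= 2 * pn x.
      apply: (le_trans (pnormD (pbounded_supp anc xN)
                 (pbounded_supp anc (supp_ltZ (- chi) dK))).2).
      rewrite mulr_natl mulr2n lerD2l.
      apply: (le_trans (pnormZ_le _ (pbounded_supp anc dK)).2).
      rewrite normrN (le_trans _ chir) // ler_piMr //; exact: pnorm_delta.
    apply: (le_trans (ler_pM _ _ cr pz2)) => //; first exact: pnorm_ge0_supp zK.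
    by rewrite mulrCA mulVf ?mulr1 // gt_eqF.
  - by rewrite pz -/chi /indicator bs mulr1 subrr mulr0.
  - rewrite pz (mulrC chi) -/D /c mulrAC -normrEsg.
    by rewrite ltr_pdivlMr.
pose k := Num.bound (12 * C ^+ 2 / eta ^+ 2).
have kP : 12 * C ^+ 2 / eta ^+ 2 < k%:R.
  by apply: archi_boundP; apply: divr_ge0; rewrite ?sqr_ge0 ?mulr_ge0 ?sqr_ge0 ?ler0n.
have k0 : 0 < k%:R :> R.
  by apply: le_lt_trans kP; apply: divr_ge0; rewrite ?sqr_ge0 ?mulr_ge0 ?sqr_ge0 ?ler0n.
have [Y [N [YN FY sqY _]]] := branch_blocks parP hb bad k.
pose M := Num.sqrt (12 * k%:R : R).
have MM : M ^+ 2 = 12 * k%:R by rewrite sqr_sqrtr // mulr_ge0.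
have pY : pn Y <= M.
  apply: (pnorm_le_of_sum_sqr _ _).2; first exact: sqrtr_ge0.
  by move=> L l P M' lP; rewrite MM; exact: sqY.
have h : k%:R * eta <= C * M.
  rewrite (le_trans FY) // (le_trans (ler_norm _)) // (le_trans (hF _ _ YN)) //.
  by rewrite ler_wpM2l.
have : (k%:R * eta) ^+ 2 <= (C * M) ^+ 2.
  by rewrite ler_pXn2r // nnegrE mulr_ge0 // ?sqrtr_ge0 // ltW.
rewrite !exprMn MM.
have -> : C ^+ 2 * (12 * k%:R) = k%:R * (12 * C ^+ 2) by ring.
rewrite expr2 -mulrA ler_pM2l // -ler_pdivlMr ?exprn_gt0 //.
by rewrite leNgt kP.
Qed.

(** The lower limit of [F] along [b]; for dominated [F] it is a limit, by [blimP]. *)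
Definition blim F b : R := sup [set r | exists n, forall s, b s -> (n <= s)%N -> r <= F s].

(** Applied to [delta t] with [t] on the branch, [branch_local] says that [F t] is close to [F s0],
    so [F] is Cauchy along the branch. *)
Lemma blimP F (C : R) b (eta : R) : 0 <= C -> dominated anc F C -> branch b ->
  0 < eta -> exists n, forall s, b s -> (n <= s)%N -> `|F s - blim F b| <= eta.
Proof.
move=> C0 hF hb eta0.
have e2 : 0 < eta / 2 by rewrite divr_gt0.
have [n0 hn0] := branch_local C0 hF hb e2.
have [_ _ unb] := hb; have [s0 ns0 bs0] := unb n0.
have osc t : b t -> (s0 <= t)%N -> `|F t - F s0| <= eta / 2.
  move=> bt st; have := hn0 s0 bs0 ns0 (delta t) t.+1 (@delta_supp R t).
  rewrite !pairing_delta // /indicator bt mulr1 => h.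
  have {h}h := h _; apply: (le_trans (h _)); last first.
    by rewrite ler_piMr ?(ltW e2) // pnorm_delta.
  move=> k; rewrite /delta; have [-> _|_] := eqVneq k t; last by rewrite eqxx.
  exact: (branch_chain parP hb).
exists s0; move=> s bs s0s.
pose E := [set r : R | exists n, forall s, b s -> (n <= s)%N -> r <= F s].
have ubE t : (forall u, b u -> (s0 <= u)%N -> F u <= t) -> ubound E t.
  move=> h r [n hr]; have [u nu bu] := unb (maxn n s0).
  move: nu; rewrite geq_max => /andP[nu s0u].
  exact: le_trans (hr u bu nu) (h u bu s0u).
have inE t : (forall u, b u -> (s0 <= u)%N -> t <= F u) -> E t by exists s0.
have E0 : E (F s0 - eta / 2).
  by apply: inE => u bu su; have := osc u bu su; rewrite ler_norml; lra.
have supE : has_sup E.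
  split; first by exists (F s0 - eta / 2).
  exists (F s0 + eta / 2); apply: ubE => u bu su.
  by have := osc u bu su; rewrite ler_norml; lra.
have h1 : F s0 - eta / 2 <= blim F b by apply: ub_le_sup => //; case: supE.
have h2 : blim F b <= F s0 + eta / 2.
  apply: ge_sup; first by case: supE.
  by apply: ubE => u bu su; have := osc u bu su; rewrite ler_norml; lra.
by have := osc s bs s0s; rewrite !ler_norml; lra.
Qed.

End branch_limits.

(** * Square summability of the limits along branches *)

Section branch_families.
Context {R : realType} {par : nat -> nat} (parP : is_parent par).
Local Notation anc := (ancestor par).
Local Notation pn := (pnorm anc).
Local Notation branch := (branch (par := par)).
Implicit Types (x y F : nat -> R) (b : pred nat) (B : seq (pred nat)).

Let anc_le := anc_leq parP.

Definition branches B := uniq B /\ forall b, b \in B -> branch b.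

Lemma branches_catr B B' : branches (B ++ B') -> branches B'.
Proof.
move=> [u h]; split; first by move: u; rewrite cat_uniq => /and3P[].
by move=> b bB; apply: h; rewrite mem_cat bB orbT.
Qed.

Lemma branch_limit_local F (C : R) b (eta : R) : 0 <= C -> dominated anc F C ->
  branch b -> 0 < eta -> exists n, forall s, b s -> (n <= s)%N ->
    forall x N, supp_lt x N -> (forall k, x k != 0 -> anc s k) ->
    `|pairing F x N - blim F b * pairing (indicator b) x N| <= eta * pn x.
Proof.
move=> C0 hF hb eta0; have e2 : 0 < eta / 2 by rewrite divr_gt0.
have [n1 h1] := branch_local parP C0 hF hb e2.
have [n2 h2] := blimP parP C0 hF hb e2.
exists (maxn n1 n2) => s bs; rewrite geq_max => /andP[n1s n2s] x N xN xs.
have := h1 s bs n1s x N xN xs; have := h2 s bs n2s.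
have chi := segment_norm_le N (branch_segment hb) xN.
set u := pairing F x N; set v := pairing _ x N in chi *; set p := pn x in chi *.
move=> k1 k2.
have -> : u - blim F b * v = (u - F s * v) + (F s - blim F b) * v by ring.
rewrite (le_trans (ler_normD _ _)) // normrM.
have -> : eta * p = eta / 2 * p + eta / 2 * p by field.
by rewrite lerD // ler_pM.
Qed.

Lemma sum_le_single (I : eqType) (r : seq I) (P : pred I) (v : R) : uniq r ->
  (forall i j, i \in r -> j \in r -> P i -> P j -> i = j) -> 0 <= v ->
  \sum_(i <- r | P i) v <= v.
Proof.
move=> ur h v0; rewrite big_const_seq iter_addr_0.
have : (count P r <= 1)%N.
  rewrite -size_filter.
  have : uniq ([seq i <- r | P i]) by exact: filter_uniq.
  have : forall i j, i \in [seq i <- r | P i] -> j \in [seq i <- r | P i] -> i = j.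
    move=> i j; rewrite !mem_filter => /andP[Pi ir] /andP[Pj jr]; exact: h.
  case: ([seq i <- r | P i]) => [|i [|j t]] //= /(_ i j) -> //; rewrite ?inE ?eqxx ?orbT //.
by case: (count P r) => [|[|]].
Qed.

(** Pick a node far out on each branch. Beyond the separation level no segment contains two of them,
    so [\sum c b * delta (s b)] has norm at most [sqrt S], while [F] takes nearly the value [S] on
    it. Hence [S <= C sqrt S]. *)
Lemma blim_l2 F (C : R) B : 0 <= C -> dominated anc F C -> branches B ->
  \sum_(b <- B) blim F b ^+ 2 <= C ^+ 2.
Proof.
move=> C0 hF [uB hB]; set c := blim F.
pose S := \sum_(b <- B) c b ^+ 2; pose T := \sum_(b <- B) `|c b|.
have S0 : 0 <= S by apply: sumr_ge0 => b _; exact: sqr_ge0.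
have T0 : 0 <= T by exact: sumr_ge0.
have rr : Num.sqrt S ^+ 2 = S by rewrite sqr_sqrtr.
have [n0 sep] := branches_separation parP hB.
have key (eta : R) : 0 < eta -> S <= C * Num.sqrt S + eta * T.
  move=> eta0.
  have /choice[s hs] : forall b, exists s, b \in B ->
      [/\ b s, (n0 <= s)%N & `|F s - c b| <= eta].
    move=> b; have [bB|] := boolP (b \in B); last by exists 0%N.
    have [n hn] := blimP parP C0 hF (hB b bB) eta0.
    have [_ _ unb] := hB b bB; have [t] := unb (maxn n0 n).
    rewrite geq_max => /andP[n0t nt] bt; exists t => _; split => //; exact: hn.
  pose K := (\max_(b <- B) s b).+1.
  have sK b : b \in B -> (s b < K)%N.
    by move=> bB; rewrite ltnS; exact: leq_bigmax_seq.
  pose x n := \sum_(b <- B) c b * delta (s b) n.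
  have pairx G : pairing G x K = \sum_(b <- B) c b * G (s b).
    rewrite pairing_sumr big_seq [RHS]big_seq; apply: eq_bigr => b bB.
    by rewrite pairing_delta ?sK.
  have xK : supp_lt x K.
    move=> n Kn; rewrite /x big_seq big1 // => b bB.
    by rewrite (@delta_supp R (s b)) ?mulr0 // (leq_trans (sK b bB)).
  have pnx : pn x <= Num.sqrt S.
    apply: (pnorm_ub_supp anc_le xK) => _ [L [l [a [la a1 ->]]]].
    rewrite pairx -[leRHS]mulr1; apply: sum_mul_le; rewrite ?sqrtr_ge0 //.
      by rewrite rr.
    rewrite expr1n; apply: le_trans a1.
    rewrite (partition_big (fun b => l (s b)) xpredT) //=; apply: ler_sum => i _.
    rewrite (eq_bigr (fun=> a i ^+ 2)); last by move=> b /eqP ->.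
    have [->|ai] := eqVneq (a i) 0; first by rewrite big1 ?sqr_ge0 // => b _; rewrite expr0n.
    apply: sum_le_single => //; last exact: sqr_ge0.
    move=> b b' bB b'B /eqP lb /eqP lb'; apply: contrapT => /eqP bb'.
    have [ch _] := la i ai; have [bs n0s _] := hs b bB; have [b's' n0s' _] := hs b' b'B.
    have [_ dn _] := hB b bB; have [_ dn' _] := hB b' b'B.
    case: (ch (s b) (s b')); rewrite /= ?lb ?lb' // => h.
      by apply: (sep b b' (s b)) => //; exact: dn' h.
    by apply: (sep b b' (s b')) => //; exact: dn h.
  have : pairing F x K <= C * Num.sqrt S.
    rewrite (le_trans (ler_norm _)) // (le_trans (hF _ _ xK)) //.
    by rewrite ler_wpM2l.
  rewrite pairx; set Q := \sum_(b <- B) _ => hle.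
  suff h : S - eta * T <= Q by lra.
  rewrite /S /T /Q mulr_sumr -sumrB big_seq [leRHS]big_seq; apply: ler_sum => b bB.
  have [_ _ h] := hs b bB.
  have : - (c b * (F (s b) - c b)) <= `|c b| * eta.
    by rewrite (le_trans (ler_norm _)) // normrN normrM ler_wpM2l.
  by rewrite expr2 mulrBr [eta * _]mulrC; lra.
have SC : S <= C * Num.sqrt S.
  apply/ler_addgt0Pr => e e0.
  have T1 : 0 < T + 1 by lra.
  apply: le_trans (key (e / (T + 1)) _) _; first by rewrite divr_gt0.
  by rewrite lerD2l mulrAC ler_pdivrMr // ler_wpM2l ?(ltW e0) //; lra.
have [S1|S1] := eqVneq (Num.sqrt S) 0; first by rewrite -/S -rr expr2 S1 mul0r sqr_ge0.
have sp : 0 < Num.sqrt S by rewrite lt_def S1 sqrtr_ge0.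
rewrite -/S -rr ler_pXn2r ?nnegrE ?sqrtr_ge0 //.
by rewrite -(ler_pM2r sp) -expr2 rr.
Qed.

(** Beyond the separation level the tails of the branches are the fibres of one labelling, and
    Cauchy-Schwarz applies to their sums. *)
Lemma branch_sum_le (c : pred nat -> R) B : branches B -> exists n, forall x N,
  supp_lt x N -> (forall k, (k < n)%N -> x k = 0) ->
  `|\sum_(b <- B) c b * pairing (indicator b) x N| <=
    Num.sqrt (\sum_(b <- B) c b ^+ 2) * pn x.
Proof.
move=> [uB hB]; have [n sep] := branches_separation parP hB.
exists n => x N xN xn; pose m := size B.
(* [find] returns [m] at a node on no branch, so the label [ord_max] collects these nodes and
   everything below [n]. *)
pose l k : 'I_m.+1 := if (k < n)%N then ord_max else inord (find (fun b => b k) B).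
pose bb k : pred nat := nth (xpred0 : pred nat) B k.
have bbB k : (k < m)%N -> bb k \in B by move=> km; exact: mem_nth.
have lE (i : 'I_m.+1) k : (i < m)%N -> (l k == i) = (bb i k && (n <= k)%N).
  move=> im; rewrite /l; have [kn|nk] := ltnP k n.
    by rewrite andbF -val_eqE /= gtn_eqF.
  rewrite andbT -val_eqE /= inordK; last by rewrite ltnS find_size.
  apply/eqP/idP => [fi|bk].
    have : has (fun b => b k) B by rewrite has_find fi.
    by move=> /(nth_find (xpred0 : pred nat)); rewrite fi.
  have hk : has (fun b => b k) B by apply/hasP; exists (bb i) => //; exact: bbB.
  have fm : (find (fun b => b k) B < m)%N by rewrite -has_find.
  apply/eqP; rewrite -(nth_uniq (xpred0 : pred nat) fm im uB); apply/eqP; apply: contrapT => /eqP ne.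
  have fk := nth_find (xpred0 : pred nat) hk.
  by apply: (sep _ _ k _ _ ne nk fk bk); exact: bbB.
have lP : labelled anc l (fun i => (i < m)%N).
  move=> i im; apply: eq_segment (branch_tail_segment parP n (hB _ (bbB i im))).
  by move=> k /=; rewrite lE.
have := sum_sqr_le_pnorm N lP (pbounded_supp _ xN).
have vE (i : 'I_m.+1) : (i < m)%N ->
    \sum_(k < N | l k == i) x k = pairing (indicator (bb i)) x N.
  move=> im; rewrite pairing_indicator [LHS]big_mkcond [RHS]big_mkcond /=.
  apply: eq_bigr => k _; rewrite lE //.
  have [nk|kn] := leqP n k; first by rewrite andbT.
  by rewrite xn // !if_same.
rewrite (eq_bigr (fun i : 'I_m.+1 => pairing (indicator (bb i)) x N ^+ 2)); last first.
  by move=> i im; rewrite vE.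
rewrite (big_ord_narrow (leqnSn m)) /= => hs.
rewrite !(big_nth (xpred0 : pred nat)) !big_mkord.
set a := \sum_(i < size B) _.
have S0 : 0 <= \sum_(i < size B) c (bb i) ^+ 2 by apply: sumr_ge0 => i _; exact: sqr_ge0.
have pos := pnorm_ge0_supp (le := anc) xN.
rewrite ler_norml lerNl; apply/andP; split.
  rewrite -sumrN; under eq_bigr do rewrite -mulNr.
  apply: sum_mul_le; rewrite ?sqrtr_ge0 // sqr_sqrtr //.
  by under eq_bigr do rewrite sqrrN.
by apply: sum_mul_le; rewrite ?sqrtr_ge0 // sqr_sqrtr.
Qed.

End branch_families.

(** * Subtracting branch indicators from a functional *)

Section branch_density.
Context {R : realType} {par : nat -> nat} (parP : is_parent par).
Local Notation anc := (ancestor par).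
Local Notation pn := (pnorm anc).
Local Notation branch := (branch (par := par)).
Local Notation branches := (branches (par := par)).
Implicit Types (x y F G : nat -> R) (b : pred nat) (B : seq (pred nat)).

Let anc_le := anc_leq parP.

Definition residual F B n := F n - \sum_(b <- B) blim F b * indicator b n.

Lemma pairing_residual F B x N : pairing (residual F B) x N =
  pairing F x N - \sum_(b <- B) blim F b * pairing (indicator b) x N.
Proof.
rewrite /residual pairingBl pairing_suml; congr (_ - _).
by apply: eq_bigr => b _; rewrite pairingZl.
Qed.

(** Greedy choice: each failure adds a batch of new branches with square sum above [eta], and
    [blim_l2] bounds the total by [C^2]. *)
Lemma exhaust F (C : R) B (eta : R) : 0 <= C -> dominated anc F C -> branches B ->
  0 < eta -> exists B1, branches (B ++ B1) /\
    forall B2, branches ((B ++ B1) ++ B2) -> \sum_(b <- B2) blim F b ^+ 2 <= eta.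
Proof.
move=> C0 hF hB eta0; apply: contrapT => /forallNP nex.
have : forall k : nat, exists B1, branches (B ++ B1) /\
    k%:R * eta <= \sum_(b <- B1) blim F b ^+ 2.
  elim=> [|k [B1 [h1 h2]]]; first by exists [::]; rewrite cats0 mul0r big_nil.
  have /not_andP[//|/existsNP[B2 /not_implyP[h3 /negP]]] := nex B1.
  rewrite -ltNge => h4; exists (B1 ++ B2); rewrite catA big_cat; split => //=.
  by rewrite -(natr1 k) mulrDl mul1r lerD // ltW.
move=> /(_ (Num.bound (C ^+ 2 / eta))) [B1 [h1 h2]].
have := archi_boundP (divr_ge0 (sqr_ge0 C) (ltW eta0)).
rewrite ltr_pdivrMr // ltNge (le_trans h2) //.
exact: (blim_l2 parP C0 hF (branches_catr h1)).
Qed.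

(** Nodes where flatness fails are closed under ancestors, so Koenig's lemma gives a branch of them.
    Far along it [F] is nearly its limit times the indicator; this term is subtracted if the branch
    is listed, and small by exhaustion if not. *)
Lemma flat_residual F (C : R) B (eta : R) : 0 <= C -> dominated anc F C ->
  branches B -> 0 < eta -> exists B1 n, branches (B ++ B1) /\
    forall t, (n <= t)%N -> forall x N, supp_lt x N ->
      (forall k, x k != 0 -> anc t k) ->
      `|pairing (residual F (B ++ B1)) x N| <= eta * pn x.
Proof.
move=> C0 hF hB eta0; have e2 : 0 < eta / 2 by rewrite divr_gt0.
have [B1 [hB1 small]] := exhaust C0 hF hB (exprn_gt0 2 e2).
exists B1; pose BB := B ++ B1; rewrite -/BB in hB1 small *.
pose good t := forall x N, supp_lt x N -> (forall k, x k != 0 -> anc t k) ->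
  `|pairing (residual F BB) x N| <= eta * pn x.
suff [n hn] : exists n, forall t, (n <= t)%N -> good t by exists n.
apply: contrapT => /forallNP nex.
have mono u v : anc u v -> ~ good v -> ~ good u.
  move=> uv nv gu; apply: nv => x N xN xv; apply: gu => // k /xv.
  exact: anc_trans.
have inf_bad n : exists2 t, (n <= t)%N & ~ good t.
  by have /existsNP[t /not_implyP[nt ngt]] := nex n; exists t.
have [b hb bad] := koenig parP mono inf_bad.
have [n1 loc] := branch_limit_local parP C0 hF hb e2.
have [n2 sep] : exists n, forall b1 b2 s, b1 \in b :: BB -> b2 \in b :: BB ->
    b1 != b2 -> (n <= s)%N -> b1 s -> b2 s -> False.
  apply: (branches_separation parP) => b'; rewrite inE => /orP[/eqP -> //|].
  by case: hB1 => _ h0; exact: h0.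
have [_ _ unb] := hb; have [s] := unb (maxn n1 n2).
rewrite geq_max => /andP[n1s n2s] bs; apply: (bad s bs) => x N xN xs.
have h := loc s bs n1s x N xN xs.
have chi := segment_norm_le N (branch_segment hb) xN.
have pos := pnorm_ge0_supp (le := anc) xN.
have zero b' : b' \in BB -> b' != b -> blim F b' * pairing (indicator b') x N = 0.
  move=> b'B b'b; rewrite [pairing _ _ _]big1 ?mulr0 // => k _.
  rewrite /indicator; case b'k: (b' k); rewrite ?mul0r // mul1r.
  apply/eqP; apply: contrapT => /negP /xs sk.
  have [_ dn _] : branch b' by case: hB1 => _ h0; exact: h0.
  by apply: (sep b' b s) => //; rewrite ?inE ?eqxx ?b'B ?orbT //; exact: dn sk.
rewrite pairing_residual; have [bB|bB] := boolP (b \in BB).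
  rewrite (bigD1_seq b) //=; last by case: hB1.
  rewrite big_seq_cond big1 => [|b' /andP[b'B b'b]]; last exact: zero.
  rewrite addr0 (le_trans h) // ler_wpM2r //; lra.
rewrite big_seq big1 => [|b' b'B]; last first.
  by apply: zero => //; apply: contraNneq bB => <-.
have hc : `|blim F b| <= eta / 2.
  have : \sum_(b <- [:: b]) blim F b ^+ 2 <= (eta / 2) ^+ 2.
    apply: small; split; first by case: hB1 => u _; rewrite cat_uniq u /= orbF bB.
    move=> b'; rewrite mem_cat inE => /orP[|/eqP -> //]; by case: hB1 => _ h0; exact: h0.
  by rewrite big_seq1 -real_normK ?num_real // ler_pXn2r ?nnegrE ?normr_ge0 ?(ltW e2).
set u := pairing F x N in h *; set v := pairing _ x N in chi h *.
have -> : u - 0 = (u - blim F b * v) + blim F b * v by ring.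
rewrite (le_trans (ler_normD _ _)) // normrM.
have -> : eta * pn x = eta / 2 * pn x + eta / 2 * pn x by field.
by rewrite lerD // ler_pM.
Qed.

Lemma normalize G (c : R) x N : 0 <= c -> supp_lt x N ->
  c * pn x < `|pairing G x N| -> exists a, pn (fun k => a * x k) <= 1 /\
  c < pairing G (fun k => a * x k) N.
Proof.
move=> c0 xN; set D := pairing G x N => h.
have r0 := pnorm_ge0_supp (le := anc) xN.
have rp : 0 < pn x.
  rewrite lt_def r0 andbT; apply: contraTneq h => r1; rewrite -leNgt r1 mulr0.
  rewrite /D /pairing big1 ?normr0 // => k _.
  have := coord_le_pnorm anc_le (@anc_refl par k) (pbounded_supp anc xN).
  by rewrite r1 normr_le0 => /eqP ->; rewrite mulr0.
exists (Num.sg D / pn x); split.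
  apply: (le_trans (pnormZ_le _ (pbounded_supp anc xN)).2).
  rewrite normrM normfV (gtr0_norm rp) -mulrA mulVf ?gt_eqF // mulr1.
  by rewrite normr_sg; case: (D != 0).
by rewrite pairingZ -/D mulrAC -normrEsg ltr_pdivlMr.
Qed.

Lemma pnorm_le_of_sum_sqr_supp x K (M : R) : 0 <= M -> supp_lt x K ->
  (forall (L : finType) (l : nat -> L) (P : pred L), labelled anc l P ->
    \sum_(i | P i) (pairing (indicator [pred n | l n == i]) x K) ^+ 2 <= M ^+ 2) ->
  pn x <= M.
Proof.
move=> M0 xK h; apply: (pnorm_ub_supp anc_le xK) => _ [L [l [a [la a1 ->]]]].
rewrite pairing_labels (bigID (fun i => a i != 0)) /= [X in _ + X]big1 ?addr0; last first.
  by move=> i; rewrite negbK => /eqP ->; rewrite mul0r.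
rewrite -[M]mul1r; apply: sum_mul_le => //.
  rewrite expr1n; apply: le_trans a1; rewrite big_mkcond /=.
  by apply: ler_sum => i _; case: ifP => // _; exact: sqr_ge0.
apply: le_trans (h L l _ la); apply: ler_sum => i _.
by rewrite pairing_indicator.
Qed.

(* A vector whose residual value is nearly extremal is pruned: the at most
   1/kappa^2 entrance nodes carrying a segment on which it exceeds kappa are cut
   off, at little cost since the functional is flat below each of them. *)
Lemma prune G (kappa eps : R) m y M : 0 < kappa -> 0 < eps ->
  (forall t, (m <= t)%N -> forall x N, supp_lt x N ->
      (forall k, x k != 0 -> anc t k) ->
      `|pairing G x N| <= kappa ^+ 2 * eps * pn x) ->
  supp_lt y M -> (forall k, (k < m)%N -> y k = 0) -> pn y <= 1 ->
  exists y', [/\ supp_lt y' M, forall k, (k < m)%N -> y' k = 0, pn y' <= 1,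
    forall S, segment anc S -> `|pairing (indicator S) y' M| <= kappa &
    pairing G y M - eps <= pairing G y' M].
Proof.
move=> k0 e0 flat yM ym y1.
have by_ := pbounded_supp anc yM.
have [e [e1 e2]] := entrance parP m.
pose part t := cutoff [pred n | (m <= n)%N && (e n == t)] y.
pose good t := forall S, segment anc S -> `|pairing (indicator S) (part t) M| <= kappa.
pose y' := cutoff [pred n | (m <= n)%N && `[< good (e n) >]] y.
have cpart t : convex anc [pred n | (m <= n)%N && (e n == t)].
  move=> u w v /= /andP[mu /eqP eu] _ uw _.
  by rewrite (leq_trans mu (anc_le uw)) -(e2 u w) // eu eqxx.
have cgood : convex anc [pred n | (m <= n)%N && `[< good (e n) >]].
  move=> u w v /= /andP[mu gu] _ uw _.
  by rewrite (leq_trans mu (anc_le uw)) -(e2 u w).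
have partM t : supp_lt (part t) M by exact: cutoff_supp.
have y'M : supp_lt y' M by exact: cutoff_supp.
pose bad (t : 'I_M) := ~~ `[< good t >].
have split_y n : y n = y' n + \sum_(t | bad t) 1 * part t n.
  have [nm|mn] := ltnP n m.
    rewrite [y' n]/cutoff ym // if_same add0r big1 // => t _.
    by rewrite /part /cutoff ym // if_same mulr0.
  have [Mn|nM] := leqP M n.
    by rewrite [y' n]/cutoff yM // if_same add0r big1 // => t _; rewrite partM ?mulr0.
  have [_ en] := e1 n mn; have eM : (e n < M)%N := leq_ltn_trans (anc_le en) nM.
  rewrite [y' n]/cutoff /= mn /=; case: asboolP => [gn|ngn].
    rewrite big1 ?addr0 // => t bt; rewrite /part /cutoff /= mn /=.
    have [et|] := eqVneq (e n) t; last by rewrite mulr0.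
    by move: bt; rewrite /bad -et asboolT.
  rewrite add0r (bigD1 (Ordinal eM)) /=; last by rewrite /bad /= asboolF.
  rewrite mul1r big1 => [|t /andP[_ te]].
    by rewrite addr0 /part /cutoff /= mn eqxx.
  rewrite /part /cutoff /= mn /=; case: eqP => [et|]; last by rewrite mulr0.
  by move: te; rewrite -val_eqE /= et eqxx.
(* Each bad entrance node carries its own segment with sum above [kappa]; these segments are
   disjoint, so the squares add up to at most [pn y ^ 2 <= 1]. *)
have count_bad : \sum_(t | bad t) kappa ^+ 2 <= 1.
  have /choice[S hS] : forall t, exists S : pred nat, ~ good t ->
      segment anc S /\ kappa < `|pairing (indicator S) (part t) M|.
    move=> t; have [gt|/existsNP[S /not_implyP[h1 /negP]]] := pselect (good t).
      by exists xpred0.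
    by rewrite -ltNge => h2; exists S.
  pose l n : option 'I_M := if (m <= n)%N && S (e n) n then insub (e n) else None.
  pose P (i : option 'I_M) := if i is Some t then bad t else false.
  have lE (t : 'I_M) n : (l n == Some t) = S t n && ((m <= n)%N && (e n == t)).
    rewrite /l; case: (leqP m n) => mn /=; last by rewrite andbF.
    have [et|et] := eqVneq (e n) t.
      by rewrite et andbT; case: (S t n) => //; rewrite valK eqxx.
    rewrite andbF; case: ifP => // _; case: insubP => // u _ ut.
    by apply/eqP => -[tu]; move: et; rewrite -ut tu eqxx.
  have lP : labelled anc l P.
    move=> [t|] //= bt; have [sS _] := hS t (fun g => negP bt (asboolT g)).
    by apply: eq_segment (segmentI sS (cpart t)) => n; rewrite /= lE.
  have := sum_sqr_le_pnorm M lP by_; rewrite (reindex_omap Some id) /=; last by case.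
  rewrite (eq_bigl bad) => [h|t]; last by rewrite /= ?eqxx ?andbT.
  have y21 : pn y ^+ 2 <= 1 by rewrite expr_le1 // (pnorm_ge0 by_).
  apply: (le_trans _ (le_trans h y21)).
  apply: ler_sum => t bt; have [_ kS] := hS t (fun g => negP bt (asboolT g)).
  rewrite (_ : \sum_(n < M | l n == Some t) y n = pairing (indicator (S t)) (part t) M).
    rewrite -[leRHS]real_normK ?num_real // ler_pXn2r ?nnegrE ?(ltW k0) //.
    exact: ltW.
  rewrite pairing_indicator [LHS]big_mkcond [RHS]big_mkcond /=.
  apply: eq_bigr => n _; rewrite lE /part /cutoff /=.
  by case: (S t n).
exists y'; split => //.
- by move=> k km; rewrite /y' /cutoff ym // if_same.
- exact: le_trans (pnorm_cutoff cgood by_).2 y1.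
(* The nodes of a segment beyond [m] share one entrance node, so the segment meets a single part,
   which is either good or cut off. *)
- move=> S sS; have [[n0 [Sn mn gn]]|no] :=
      pselect (exists n, [/\ S n, (m <= n)%N & good (e n)]).
    have -> : pairing (indicator S) y' M = pairing (indicator S) (part (e n0)) M.
      apply: eq_bigr => n _; rewrite /indicator; case Snn: (S n); rewrite ?mul0r // !mul1r.
      rewrite /y' /part /cutoff /=; case: (leqP m n) => mn' //=.
      have -> : e n = e n0.
        by case: sS => ch _; case: (ch n n0 Snn Sn) => h; [|apply/esym]; exact: e2 h.
      by rewrite eqxx asboolT.
    exact: gn.
  rewrite [pairing _ _ _]big1 ?normr0 ?(ltW k0) // => n _.
  rewrite /indicator; case Sn: (S n); rewrite ?mul0r // mul1r.
  rewrite /y' /cutoff /=; case: (leqP m n) => mn //=.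
  by case: asboolP => // gn; case: no; exists n.
have -> : pairing G y M = pairing G y' M + \sum_(t | bad t) 1 * pairing G (part t) M.
  rewrite -pairing_sumr -pairingD; apply: eq_bigr => n _; by rewrite split_y.
have ke0 : 0 <= kappa ^+ 2 * eps by apply: mulr_ge0; [exact: sqr_ge0|exact: ltW].
rewrite lerBlDr lerD2l; apply: (@le_trans _ _ (\sum_(t | bad t) kappa ^+ 2 * eps)).
  apply: ler_sum => t bt; rewrite mul1r (le_trans (ler_norm _)) //.
  have [mt|tm] := leqP m t.
    apply: (le_trans (flat t mt _ _ (partM t) _)).
      move=> k; rewrite /part /cutoff /=; case: ifP; last by rewrite eqxx.
      by move=> /andP[mk /eqP <-] _; case: (e1 k mk).
    rewrite ler_piMr //.
    exact: le_trans (pnorm_cutoff (cpart t) by_).2 y1.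
  rewrite [pairing _ _ _]big1 ?normr0 // => n _.
  rewrite /part /cutoff /=; case: ifP; last by rewrite mulr0.
  move=> /andP[mn /eqP et]; have [me _] := e1 n mn.
  by move: tm; rewrite -et ltnNge me.
by rewrite -mulr_suml ler_piMl // ltW.
Qed.

End branch_density.

Section density.
Context {R : realType} {par : nat -> nat} (parP : is_parent par).
Local Notation anc := (ancestor par).
Local Notation pn := (pnorm anc).
Local Notation branches := (branches (par := par)).
Implicit Types (x y F G : nat -> R) (b : pred nat) (B : seq (pred nat)).

Let anc_le := anc_leq parP.

Definition tail_bound G (c : R) n := forall x N, supp_lt x N ->
  (forall k, (k < n)%N -> x k = 0) -> `|pairing G x N| <= c * pn x.

(** The segment sums of [x] have total absolute value at most [\sum_(n < m) |x n| <= m], so the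
    cross term is at most [m * kappa <= 1 / 16]. The squares add up to at most [1 + 1 + 2 / 16],
    below [(3 / 2) ^ 2 = 9 / 4]. *)
Lemma pnorm_add_flat x y m M (kappa : R) : 0 <= kappa -> 16 * m%:R * kappa <= 1 ->
  supp_lt x m -> supp_lt y M -> pn x <= 1 -> pn y <= 1 ->
  (forall S, segment anc S -> `|pairing (indicator S) y M| <= kappa) ->
  pn (x \+ y) <= 3 / 2.
Proof.
move=> k0 mk xm yM x1 y1 flat; pose K := maxn m M.
have xK := supp_ltW xm (leq_maxl m M); have yK := supp_ltW yM (leq_maxr m M).
have sq1 (z : nat -> R) : pn z <= 1 -> 0 <= pn z -> pn z ^+ 2 <= 1 by move=> *; rewrite expr_le1.
apply: (pnorm_le_of_sum_sqr_supp parP _ (supp_ltD xK yK)) => [|L l P lP].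
  by rewrite divr_ge0.
pose a i := pairing (indicator [pred n | l n == i]) x K.
pose c i := pairing (indicator [pred n | l n == i]) y K.
have sa : \sum_(i | P i) a i ^+ 2 <= 1.
  apply: (le_trans _ (sq1 x x1 (pnorm_ge0_supp xm))).
  apply: (le_trans _ (sum_sqr_le_pnorm K lP (pbounded_supp _ xm))).
  by apply: ler_sum => i _; rewrite /a pairing_indicator.
have sc : \sum_(i | P i) c i ^+ 2 <= 1.
  apply: (le_trans _ (sq1 y y1 (pnorm_ge0_supp yM))).
  apply: (le_trans _ (sum_sqr_le_pnorm K lP (pbounded_supp _ yM))).
  by apply: ler_sum => i _; rewrite /c pairing_indicator.
have cross : \sum_(i | P i) a i * c i <= m%:R * kappa.
  apply: (@le_trans _ _ (\sum_(i | P i) `|a i| * kappa)).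
    apply: ler_sum => i Pi; rewrite (le_trans (ler_norm _)) // normrM ler_wpM2l //.
    by rewrite /c (pairing_supp _ yM (leq_maxr m M)); apply: flat; exact: lP.
  rewrite -mulr_suml ler_wpM2r //.
  apply: (@le_trans _ _ (\sum_i \sum_(n < K | l n == i) `|x n|)).
    rewrite big_mkcond /=; apply: ler_sum => i _.
    have h : `|a i| <= \sum_(n < K | l n == i) `|x n|.
      by rewrite /a pairing_indicator ler_norm_sum.
    by case: (P i) => //; exact: sumr_ge0.
  have -> : \sum_i \sum_(n < K | l n == i) `|x n| =
      pairing (fun=> 1) (fun n => `|x n|) K.
    rewrite /pairing [RHS](partition_big (fun n : 'I_K => l n) xpredT) //=.
    by apply: eq_bigr => i _; apply: eq_bigr => n _; rewrite mul1r.
  rewrite (@pairing_supp _ _ _ m) ?leq_maxl //; last by move=> n /xm ->; rewrite normr0.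
  have -> : m%:R = \sum_(n < m) (1 : R) by rewrite sumr_const card_ord.
  apply: ler_sum => n _; rewrite mul1r; apply: le_trans x1.
  exact: coord_le_pnorm anc_le (@anc_refl par n) (pbounded_supp _ xm).
rewrite (eq_bigr (fun i => a i ^+ 2 + c i ^+ 2 + 2 * (a i * c i))); last first.
  by move=> i _; rewrite pairingD -/(a i) -/(c i); ring.
rewrite !big_split /= -mulr_sumr.
have -> : (3 / 2) ^+ 2 = 9 / 4 :> R by field.
by lra.
Qed.

(* Two nearly extremal vectors, the second one pruned and far beyond the first,
   have a sum of norm at most 3/2, while the residual adds up to nearly 2 c on it. *)
Lemma density_step F (C eta c : R) B : 0 <= C -> dominated anc F C -> branches B ->
  0 < eta -> (forall B2, branches (B ++ B2) ->
    \sum_(b <- B2) blim F b ^+ 2 <= (eta / 20) ^+ 2) -> eta <= c ->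
  (exists n, tail_bound (residual F B) c n) ->
  exists n, tail_bound (residual F B) (9 / 10 * c) n.
Proof.
move=> C0 hF hB eta0 small etac [n1 hc]; apply: contrapT => /forallNP nex.
have c0 : 0 < c := lt_le_trans eta0 etac.
have c9 : 0 <= 9 / 10 * c by rewrite mulr_ge0 ?divr_ge0 // ltW.
have far m : exists y M, [/\ supp_lt y M, forall k, (k < m)%N -> y k = 0,
    pn y <= 1 & 9 / 10 * c < pairing (residual F B) y M].
  have /existsNP[x /existsNP[N /not_implyP[xN /not_implyP[xm /negP]]]] := nex m.
  rewrite -ltNge => /(normalize parP c9 xN)[a [h1 h2]].
  exists (fun k => a * x k), N; split => //; first exact: supp_ltZ.
  by move=> k /xm ->; rewrite mulr0.
have [y1 [m1 [y1m y1n y11 Gy1]]] := far n1.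
(* [kappa] is fitted to the length of [y1] for [pnorm_add_flat]; the successor avoids dividing by
   zero. An error [eps] occurs three times: once for pruning and twice for changing the family. *)
pose kappa : R := (16 * m1.+1%:R)^-1; pose eps := eta / 20.
have kappa0 : 0 < kappa by rewrite invr_gt0 mulr_gt0.
have eps0 : 0 < eps by rewrite divr_gt0.
(* Flatness at this finer scale needs further branches [B2]; by [small] they change values far out
   by at most [eps]. *)
have [B2 [n2 [hB2 flat]]] := flat_residual parP C0 hF hB
  (mulr_gt0 (exprn_gt0 2 kappa0) eps0).
have [n3 up] := branch_sum_le parP (blim F) (branches_catr hB2).
pose m := maxn (maxn n1 m1) (maxn n2 n3).
have [y [M [yM ym y_1 Gy]]] := far m.
have [y' [y'M y'm y'1 flat' Gy']] : exists y', [/\ supp_lt y' M,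
    forall k, (k < m)%N -> y' k = 0, pn y' <= 1,
    forall S, segment anc S -> `|pairing (indicator S) y' M| <= kappa &
    pairing (residual F (B ++ B2)) y M - eps <= pairing (residual F (B ++ B2)) y' M].
  apply: (prune parP) => // t mt x N xN xt; apply: (flat t _ x N xN xt).
  by apply: leq_trans mt; rewrite !leq_max leqnn !orbT.
have change z : supp_lt z M -> (forall k, (k < m)%N -> z k = 0) -> pn z <= 1 ->
    `|pairing (residual F B) z M - pairing (residual F (B ++ B2)) z M| <= eps.
  move=> zM zm z1; rewrite !pairing_residual big_cat /=.
  set A := pairing F z M; set D := \sum_(b <- B) _; set E := \sum_(b <- B2) _.
  have -> : A - D - (A - (D + E)) = E by ring.
  have : `|E| <= Num.sqrt (\sum_(b <- B2) blim F b ^+ 2) * pn z.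
    apply: up => // k kn; apply: zm; apply: leq_trans kn _.
    by rewrite !leq_max leqnn !orbT.
  move=> h; apply: (le_trans h); rewrite -[leRHS]mulr1; apply: ler_pM;
    rewrite ?sqrtr_ge0 ?(pnorm_ge0_supp zM) //.
  rewrite -[leRHS](@ger0_norm _ eps) ?(ltW eps0) // -sqrtr_sqr.
  by rewrite ler_sqrt ?sqr_ge0 //; exact: small.
have /(_ yM ym y_1) := change y; have /(_ y'M y'm y'1) := change y'.
rewrite !ler_norml => /andP[h1 _] /andP[_ h2].
have : pn (y1 \+ y') <= 3 / 2.
  apply: (pnorm_add_flat (ltW kappa0) _ y1m y'M y11 y'1 flat').
  rewrite /kappa ler_pdivrMr ?mulr_gt0 // mul1r ler_pM2l // ler_nat.
  exact: leqnSn.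
move=> h3; pose K := maxn m1 M.
have := hc (y1 \+ y') K (supp_ltD (supp_ltW y1m (leq_maxl _ _)) (supp_ltW y'M (leq_maxr _ _))).
have hs k : (k < n1)%N -> (y1 \+ y') k = 0.
  move=> kn; rewrite /= y1n // add0r y'm //; apply: leq_trans kn _.
  by rewrite !leq_max leqnn.
move=> /(_ hs) h4; have := le_trans (ler_norm _) h4.
rewrite pairingD (pairing_supp _ y1m (leq_maxl m1 M)) (pairing_supp _ y'M (leq_maxr m1 M)).
have h5 : c * pn (y1 \+ y') <= c * (3 / 2) by rewrite ler_wpM2l // ltW.
(* The value on [y1 + y'] exceeds [9/5 c - 3/20 eta], hence [33/20 c], against the bound [3/2 c]. *)
move=> h6; have h7 : eps = eta / 20 by [].
lra.
Qed.

(** The family is exhausted once, at level [eta / 20], and stays fixed while [density_step] shrinks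
    the tail bound by [9 / 10] at a time, from the crude bound [c0] down to [eta]. *)
Lemma branch_density F (C eta : R) : 0 <= C -> dominated anc F C -> 0 < eta ->
  exists B n, branches B /\ tail_bound (residual F B) eta n.
Proof.
move=> C0 hF eta0.
have [//|B [/= hB small]] := exhaust parP C0 hF (B := [::]) _
  (exprn_gt0 2 (divr_gt0 eta0 (ltr0n R 20))).
exists B; have [n0 up] := branch_sum_le parP (blim F) hB.
pose c0 := C + Num.sqrt (\sum_(b <- B) blim F b ^+ 2).
have c00 : 0 <= c0 by rewrite addr_ge0 ?sqrtr_ge0.
have start : exists n, tail_bound (residual F B) c0 n.
  exists n0 => x N xN xn; rewrite pairing_residual (le_trans (ler_normB _ _)) //.
  by rewrite mulrDl lerD //; [exact: hF|exact: up].
have iter k : exists n, tail_bound (residual F B) (Num.max eta ((9 / 10) ^+ k * c0)) n.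
  elim: k => [|k [n IH]].
    have [n hn] := start; exists n => x N xN xn; apply: (le_trans (hn x N xN xn)).
    rewrite ler_wpM2r ?(pnorm_ge0_supp xN) //.
    by rewrite expr0 mul1r le_max lexx orbT.
  have [small_c|big_c] := leP ((9 / 10) ^+ k * c0) eta.
    exists n => x N xN xn; apply: (le_trans (IH x N xN xn)).
    rewrite ler_wpM2r ?(pnorm_ge0_supp xN) //.
    by rewrite (max_idPl small_c) le_max lexx.
  have [n' hn'] := density_step C0 hF hB eta0 small (ltW big_c)
    (ex_intro _ n (eq_ind _ (fun d => tail_bound _ d n) IH _ (max_idPr (ltW big_c)))).
  exists n' => x N xN xn; apply: (le_trans (hn' x N xN xn)).
  rewrite ler_wpM2r ?(pnorm_ge0_supp xN) //.
  by rewrite exprS mulrA le_max lexx orbT.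
have [k hk] : exists k : nat, (9 / 10) ^+ k * c0 <= eta.
  (* Bernoulli's inequality [(10 / 9) ^ k >= 1 + k / 9]. *)
  have bern k : (9 / 10) ^+ k * (9 + k%:R) <= 9 :> R.
    elim: k => [|k IH]; first by rewrite expr0 mul1r addr0.
    have e0 : 0 <= (9 / 10 : R) ^+ k by rewrite exprn_ge0 // divr_ge0.
    have k0 : 0 <= k%:R :> R := ler0n _ _.
    rewrite exprS -(natr1 k); apply: le_trans IH.
    rewrite -mulrA mulrCA ler_wpM2l //; lra.
  pose k := Num.bound (9 * c0 / eta); exists k.
  have kP : 9 * c0 / eta < k%:R.
    by apply: archi_boundP; apply: divr_ge0; rewrite ?mulr_ge0 // ltW.
  rewrite ltr_pdivrMr // in kP.
  have k9 : 0 < 9 + k%:R :> R by rewrite ltr_wpDr.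
  rewrite -(ler_pM2r k9) mulrAC; apply: (@le_trans _ _ (9 * c0)).
    by rewrite ler_wpM2r.
  by nra.
have [n hn] := iter k; exists n; split => //.
by rewrite (max_idPl hk) in hn.
Qed.

End density.

(** * Small averages *)

Section signs.
Context {R : realType}.
Implicit Types (x F : nat -> R) (M : seq (nat -> R)) (eps : nat -> R).

(** Each new sign is chosen against the accumulated scalar product, so the cross terms are never
    positive. *)
Lemma sign_choice M K : exists eps, (forall i, `|eps i| = 1) /\
  \sum_(a <- M) (\sum_(i < K) eps i * a i) ^+ 2 <= \sum_(i < K) \sum_(a <- M) a i ^+ 2.
Proof.
elim: K => [|K [eps [e1 IH]]].
  exists (fun=> 1); split=> [i|]; first exact: normr1.
  by rewrite big_ord0 big1 // => a _; rewrite big_ord0 expr0n.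
pose X := \sum_(a <- M) (\sum_(i < K) eps i * a i) * a K.
pose s : R := if 0 <= X then -1 else 1.
exists (fun i => if i == K then s else eps i); split=> [i|].
  by case: eqP => // _; rewrite /s; case: ifP; rewrite ?normrN1 ?normr1.
have -> : \sum_(a <- M) (\sum_(i < K.+1) (if i == K :> nat then s else eps i) * a i) ^+ 2 =
   \sum_(a <- M) (\sum_(i < K) eps i * a i) ^+ 2 + \sum_(a <- M) a K ^+ 2 + 2 * (s * X).
  rewrite /X !mulr_sumr -!big_split; apply: eq_bigr => a _ /=.
  rewrite big_ord_recr /= eqxx.
  rewrite (eq_bigr (fun i : 'I_K => eps i * a i)); last first.
    by move=> i _; rewrite ltn_eqF.
  have s2 : s ^+ 2 = 1 by rewrite /s; case: ifP; rewrite ?sqrrN expr1n.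
  by rewrite sqrrD exprMn s2; ring.
rewrite big_ord_recr /=.
have : s * X <= 0.
  rewrite /s; case: ifP => h; first by rewrite mulN1r oppr_le0.
  by rewrite mul1r ltW // ltNge h.
by lra.
Qed.

End signs.

Section tail_signs.
Context {R : realType} {par : nat -> nat} (parP : is_parent par).
Local Notation anc := (ancestor par).
Local Notation pn := (pnorm anc).

Lemma sum_subset (I : eqType) (s r : seq I) (f : I -> R) : uniq s -> uniq r ->
  {subset s <= r} -> \sum_(i <- r | i \in s) f i = \sum_(i <- s) f i.
Proof.
move=> us ur sr; rewrite -big_filter; apply: perm_big; apply: uniq_perm => //.
  exact: filter_uniq.
by move=> i; rewrite mem_filter; case: (boolP (i \in s)) => // /sr ->.
Qed.

(** [M] lists, branch by branch, the limits of the [F i] whose own family contains that branch. It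
    is fixed before the signs, so one choice of signs can serve two trees and finitely many
    coordinates at once. *)
Lemma tail_signs (F : nat -> nat -> R) K (C delta : R) : 0 <= C -> 0 < delta ->
  (forall i, (i < K)%N -> dominated anc (F i) C) ->
  exists M : seq (nat -> R), (forall i, (i < K)%N -> \sum_(a <- M) a i ^+ 2 <= C ^+ 2) /\
    forall eps : nat -> R, (forall i, `|eps i| <= 1) ->
    exists n, tail_bound (par := par) (fun n => \sum_(i < K) eps i * F i n)
     (K%:R * delta + Num.sqrt (\sum_(a <- M) (\sum_(i < K) eps i * a i) ^+ 2)) n.
Proof.
move=> C0 d0 hF.
have /choice[Bn hBn] : forall i, exists Bn : seq (pred nat) * nat, (i < K)%N ->
    branches (par := par) Bn.1 /\
    tail_bound (par := par) (residual (F i) Bn.1) delta Bn.2.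
  move=> i; have [iK|] := boolP (i < K)%N; last by exists ([::], 0%N).
  by have [B [n h]] := branch_density parP C0 (hF i iK) d0; exists (B, n).
pose B := undup (flatten [seq (Bn i).1 | i <- iota 0 K]).
have inB i b : (i < K)%N -> b \in (Bn i).1 -> b \in B.
  move=> iK bi; rewrite mem_undup; apply/flattenP; exists (Bn i).1 => //.
  by apply/mapP; exists i; rewrite ?mem_iota.
have hB : branches (par := par) B.
  split=> [|b]; first exact: undup_uniq.
  rewrite mem_undup => /flattenP[s /mapP[i]]; rewrite mem_iota add0n => /andP[_ iK] ->.
  by have [[_ h] _] := hBn i iK; exact: h.
pose a b i := if b \in (Bn i).1 then blim (F i) b else 0.
have sumB i (f : pred nat -> R) : (i < K)%N ->
    \sum_(b <- B | b \in (Bn i).1) f b = \sum_(b <- (Bn i).1) f b.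
  move=> iK; have [[u _] _] := hBn i iK; apply: sum_subset => //; first by case: hB.
  by move=> b; exact: inB.
exists [seq a b | b <- B]; split=> [i iK|eps eps1].
  rewrite big_map; have [hb _] := hBn i iK.
  apply: le_trans (blim_l2 parP C0 (hF i iK) hb).
  rewrite -sumB // [leRHS]big_mkcond; apply: ler_sum => b _.
  by rewrite /a; case: ifP => // _; rewrite expr0n.
pose c b := \sum_(i < K) eps i * a b i.
have [n0 up] := branch_sum_le parP c hB.
exists (maxn n0 (\max_(i < K) (Bn i).2)) => x N xN xn.
have pos := pnorm_ge0_supp (le := anc) xN.
have xn0 k : (k < n0)%N -> x k = 0 by move=> kn; apply: xn; rewrite leq_max kn.
have := up x N xN xn0; rewrite big_map => hc.
rewrite pairing_suml.
have -> : \sum_(i < K) pairing (fun n => eps i * F i n) x N =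
    \sum_(i < K) eps i * pairing (residual (F i) (Bn i).1) x N +
    \sum_(b <- B) c b * pairing (indicator b) x N.
  have -> : \sum_(b <- B) c b * pairing (indicator b) x N =
     \sum_(i < K) eps i * \sum_(b <- (Bn i).1) blim (F i) b * pairing (indicator b) x N.
    under eq_bigr do rewrite mulr_suml.
    rewrite exchange_big /=; apply: eq_bigr => i _.
    rewrite -sumB // mulr_sumr [RHS]big_mkcond /=; apply: eq_bigr => b _.
    by rewrite /a; case: ifP; rewrite ?mulrA // mulr0 mul0r.
  rewrite -big_split; apply: eq_bigr => i _ /=.
  by rewrite pairing_residual pairingZl -mulrDr subrK.
rewrite (le_trans (ler_normD _ _)) // mulrDl lerD //.
rewrite (le_trans (ler_norm_sum _ _ _)) //.
have -> : K%:R * delta * pn x = \sum_(i < K) delta * pn x.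
  by rewrite sumr_const card_ord -mulrA mulr_natl.
apply: ler_sum => i _; rewrite normrM -[leRHS]mul1r ler_pM //.
have [_ h] := hBn i (ltn_ord i); apply: h => // k kn; apply: xn.
rewrite leq_max; apply/orP; right; apply: leq_trans kn _.
exact: (@leq_bigmax _ (fun i : 'I_K => (Bn i).2)).
Qed.

End tail_signs.

Section small_averages.
Context {R : realType} {par1 par2 : nat -> nat}.
Context (par1P : is_parent par1) (par2P : is_parent par2).
Local Notation le1 := (ancestor par1).
Local Notation le2 := (ancestor par2).
Implicit Types (x : nat -> R) (phi : nat -> nat -> R).

Definition nm x := pnorm le1 x + pnorm le2 x.

Lemma nm_ge0 x N : supp_lt x N -> 0 <= nm x.
Proof. by move=> xN; rewrite addr_ge0 // (pnorm_ge0_supp xN). Qed.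

(** The branch limits on both trees and the first [p] coordinates have, per functional, square sum
    at most [D]. Good signs keep the square sum of the combination below [K D], so after division by
    [K] its root is of order [sqrt (D / K)]. *)
Lemma flat_block phi (C tau : R) p : 0 <= C -> 0 < tau ->
  (forall i x N, supp_lt x N -> `|pairing (phi i) x N| <= C * nm x) ->
  exists (K : nat) (eps : nat -> R) (q : nat), [/\ (0 < K)%N, forall i, `|eps i| = 1,
    forall x, supp_lt x p ->
      `|pairing (fun n => \sum_(i < K) eps i / K%:R * phi i n) x p| <= tau * nm x &
    forall x N, supp_lt x N -> (forall k, (k < q)%N -> x k = 0) ->
      `|pairing (fun n => \sum_(i < K) eps i / K%:R * phi i n) x N| <= tau * nm x].
Proof.
move=> C0 d0 hphi.
have /choice[psi hpsi] : forall i, exists a : nat -> R,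
    dominated le1 a C /\ dominated le2 (fun n => phi i n - a n) C.
  move=> i; have [x N xN|a [h1 h2]] := @pnorm_split R le1 le2 (phi i) C C0.
    exact: le_trans (ler_norm _) (hphi i x N xN).
  have abs le (G : nat -> R) : (forall x N, supp_lt x N -> pairing G x N <= C * pnorm le x) ->
      dominated le G C.
    move=> hG x N xN; rewrite ler_norml hG // andbT lerNl -mulN1r -pairingZ.
    apply: (le_trans (hG _ N (supp_ltZ _ xN))); rewrite ler_wpM2l //.
    by apply: (le_trans (pnormZ_le _ (pbounded_supp le xN)).2); rewrite normrN1 mul1r.
  by exists a; split; exact: abs.
pose D : R := C ^+ 2 + C ^+ 2 + p%:R * (2 * C) ^+ 2.
have D0 : 0 <= D by rewrite !addr_ge0 ?mulr_ge0 ?sqr_ge0.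
(* The 4 serves the tail, where [sqrt (K D)] must be at most half of [K tau]; the [p ^ 2] serves the
   head, where [p] coordinates are added. *)
pose K := (Num.bound ((4 + p%:R ^+ 2) * D / tau ^+ 2)).+1.
have K0 : 0 < K%:R :> R by rewrite ltr0n.
have KD : (4 + p%:R ^+ 2) * D <= K%:R * tau ^+ 2.
  rewrite -ler_pdivrMr ?exprn_gt0 //; apply: (@le_trans _ _ (Num.bound ((4 + p%:R ^+ 2) * D / tau ^+ 2))%:R).
    apply/ltW/archi_boundP; rewrite divr_ge0 ?sqr_ge0 // mulr_ge0 // addr_ge0 ?sqr_ge0 //.
  by rewrite ler_nat.
have d2 : 0 < tau / 2 by rewrite divr_gt0.
have [M1 [s1 t1]] := tail_signs par1P C0 d2 (fun i _ => (hpsi i).1) (K := K).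
have [M2 [s2 t2]] := tail_signs par2P C0 d2 (fun i _ => (hpsi i).2) (K := K).
pose M3 := [seq (fun i => phi i n) | n <- iota 0 p].
have phi_le i n : `|phi i n| <= 2 * C.
  have := hphi i (delta n) n.+1 (@delta_supp R n).
  rewrite pairing_delta // => h; apply: (le_trans h).
  by rewrite mulrC ler_wpM2r // /nm lerD // pnorm_delta.
have [eps [e1 hs]] := sign_choice (M1 ++ M2 ++ M3) K.
have e1' i : `|eps i| <= 1 by rewrite e1.
pose S (M : seq (nat -> R)) := \sum_(a <- M) (\sum_(i < K) eps i * a i) ^+ 2.
have S0 M : 0 <= S M by apply: sumr_ge0 => a _; exact: sqr_ge0.
have Scat : S (M1 ++ M2 ++ M3) = S M1 + S M2 + S M3 by rewrite /S !big_cat /= addrA.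
pose T := S (M1 ++ M2 ++ M3).
have TK : T <= K%:R * D.
  apply: (le_trans hs); have -> : K%:R * D = \sum_(i < K) D.
    by rewrite sumr_const card_ord mulr_natl.
  apply: ler_sum => i _; rewrite !big_cat /= /D addrA !lerD ?s1 ?s2 //.
  rewrite big_map; have -> : p%:R * (2 * C) ^+ 2 = \sum_(n <- iota 0 p) (2 * C) ^+ 2.
    by rewrite big_const_seq count_predT size_iota iter_addr_0 mulr_natl.
  apply: ler_sum => n _; rewrite -real_normK ?num_real //.
  by rewrite ler_pXn2r ?nnegrE ?mulr_ge0.
pose r := Num.sqrt T.
have r0 : 0 <= r := sqrtr_ge0 _.
have rT : r ^+ 2 = T by rewrite /r sqr_sqrtr //; exact: S0.
have r1 : r <= K%:R * (tau / 2).
  have Kt0 : 0 <= K%:R * (tau / 2) by apply: mulr_ge0; exact: ltW.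
  rewrite -(@ler_pXn2r _ 2) ?nnegrE // rT.
  apply: (le_trans TK); rewrite exprMn expr2 -mulrA ler_pM2l //.
  have : 0 <= p%:R ^+ 2 * D by rewrite mulr_ge0 ?sqr_ge0.
  by move: KD; rewrite expr_div_n mulrDl; lra.
have r2 : p%:R * r <= K%:R * tau.
  have Kt0 : 0 <= K%:R * tau by apply: mulr_ge0; exact: ltW.
  rewrite -(@ler_pXn2r _ 2) ?nnegrE ?Kt0 ?mulr_ge0 //.
  rewrite !exprMn rT expr2 [K%:R ^+ 2]expr2 -mulrA -[in leRHS]mulrA.
  apply: (@le_trans _ _ (p%:R ^+ 2 * (K%:R * D))).
    by rewrite expr2 -!mulrA !ler_wpM2l.
  rewrite mulrCA ler_pM2l //; apply: le_trans KD.
  by rewrite mulrDl lerDr mulr_ge0.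
have sub M : S M <= T -> Num.sqrt (S M) <= r by move=> h; rewrite /r ler_sqrt //; exact: S0.
have sub1 : Num.sqrt (S M1) <= r by apply: sub; rewrite /T Scat; have := S0 M2; have := S0 M3; lra.
have sub2 : Num.sqrt (S M2) <= r by apply: sub; rewrite /T Scat; have := S0 M1; have := S0 M3; lra.
have [n1 h1] := t1 eps e1'; have [n2 h2] := t2 eps e1'.
have hE x N : pairing (fun n => \sum_(i < K) eps i / K%:R * phi i n) x N =
    K%:R^-1 * pairing (fun n => \sum_(i < K) eps i * phi i n) x N.
  rewrite -pairingZl; apply: eq_bigr => n _; congr (_ * _).
  by rewrite mulr_sumr; apply: eq_bigr => i _; rewrite mulrA [_ * eps i]mulrC.
exists K, eps, (maxn n1 n2); split => // [x xp|x N xN xn]; rewrite hE normrM.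
  rewrite (ger0_norm (ltW _)) ?invr_gt0 // mulrC ler_pdivrMr //.
  apply: (@le_trans _ _ (\sum_(n < p) r * nm x)); last first.
    have -> : tau * nm x * K%:R = (K%:R * tau) * nm x by ring.
    rewrite sumr_const card_ord -[_ *+ p]mulr_natl mulrA.
    by rewrite ler_wpM2r ?(nm_ge0 xp).
  rewrite (le_trans (ler_norm_sum _ _ _)) //; apply: ler_sum => n _.
  rewrite normrM ler_pM //; last first.
    have := coord_le_pnorm (anc_leq par1P) (@anc_refl par1 n) (pbounded_supp le1 xp).
    move=> h; apply: (le_trans h); rewrite /nm lerDl; exact: pnorm_ge0_supp xp.
  rewrite -(@ler_pXn2r _ 2) ?nnegrE // rT real_normK ?num_real //.
  have : (\sum_(i < K) eps i * phi i n) ^+ 2 <= S M3.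
    rewrite /S big_map (bigD1_seq (n : nat)) ?mem_iota ?iota_uniq //=.
    by rewrite lerDl; apply: sumr_ge0 => k _; exact: sqr_ge0.
  by move=> h; apply: (le_trans h); rewrite /T Scat; have := S0 M1; have := S0 M2; lra.
have xn1 k : (k < n1)%N -> x k = 0 by move=> kn; apply: xn; rewrite leq_max kn.
have xn2 k : (k < n2)%N -> x k = 0 by move=> kn; apply: xn; rewrite leq_max kn orbT.
rewrite (ger0_norm (ltW _)) ?invr_gt0 // mulrC ler_pdivrMr //.
have -> : pairing (fun n => \sum_(i < K) eps i * phi i n) x N =
   pairing (fun n => \sum_(i < K) eps i * psi i n) x N +
   pairing (fun n => \sum_(i < K) eps i * (phi i n - psi i n)) x N.
  rewrite -pairingDl; apply: eq_bigr => n _; congr (_ * _).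
  by rewrite -big_split; apply: eq_bigr => i _ /=; ring.
rewrite (le_trans (ler_normD _ _)) //.
have -> : tau * nm x * K%:R = K%:R * tau * pnorm le1 x + K%:R * tau * pnorm le2 x.
  by rewrite /nm; ring.
apply: lerD.
  apply: (le_trans (h1 x N xN xn1)); rewrite ler_wpM2r ?(pnorm_ge0_supp xN) //.
  by move: (le_trans sub1 r1); rewrite -/(S M1); lra.
apply: (le_trans (h2 x N xN xn2)); rewrite ler_wpM2r ?(pnorm_ge0_supp xN) //.
by move: (le_trans sub2 r1); rewrite -/(S M2); lra.
Qed.

End small_averages.

(** * Stacking blocks by the lower 2-estimate *)

Section averages_of_blocks.
Context {R : realType} {par1 par2 : nat -> nat}.
Context (par1P : is_parent par1) (par2P : is_parent par2).
Local Notation le1 := (ancestor par1).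
Local Notation le2 := (ancestor par2).
Local Notation nm := (nm (par1 := par1) (par2 := par2)).
Implicit Types (x : nat -> R) (phi : nat -> nat -> R).

(** An equivalent norm, in which the lower 2-estimates of the two norms simply add up. *)
Let w x := Num.sqrt (pnorm le1 x ^+ 2 + pnorm le2 x ^+ 2).

Let w2 x : w x ^+ 2 = pnorm le1 x ^+ 2 + pnorm le2 x ^+ 2.
Proof. by rewrite sqr_sqrtr // addr_ge0 ?sqr_ge0. Qed.

Let nm_le_w x N : supp_lt x N -> nm x <= 2 * w x.
Proof.
move=> xN; have h1 := pnorm_ge0_supp (le := le1) xN.
have h2 := pnorm_ge0_supp (le := le2) xN; have w0 : 0 <= w x := sqrtr_ge0 _.
rewrite -(@ler_pXn2r _ 2) ?nnegrE ?mulr_ge0 ?addr_ge0 //.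
rewrite exprMn w2 /nm; nra.
Qed.

Let w_le_nm x N : supp_lt x N -> w x <= nm x.
Proof.
move=> xN; have h1 := pnorm_ge0_supp (le := le1) xN.
have h2 := pnorm_ge0_supp (le := le2) xN; have w0 : 0 <= w x := sqrtr_ge0 _.
rewrite -(@ler_pXn2r _ 2) ?nnegrE ?addr_ge0 //.
rewrite w2 /nm; nra.
Qed.

Let below q x := cutoff (fun n => (n < q)%N) x.
Let block q r x := cutoff (fun n => (q <= n < r)%N) x.

Let w_blocks x N q r : supp_lt x N -> (q <= r)%N ->
  w (below q x) ^+ 2 + w (block q r x) ^+ 2 <= w (below r x) ^+ 2.
Proof.
move=> xN qr; rewrite !w2.
have low le : (forall u v, le u v -> (u <= v)%N) ->
    pnorm le (below q x) ^+ 2 + pnorm le (block q r x) ^+ 2 <= pnorm le (below r x) ^+ 2.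
  move=> h.
  have -> : below q x = cutoff (fun n => (n < q)%N) (below r x).
    apply/funext => n; rewrite /below /cutoff; case: ifP => // nq.
    by rewrite (leq_trans nq qr).
  have -> : block q r x = cutoff (fun n => (q <= n)%N) (below r x).
    by apply/funext => n; rewrite /block /below /cutoff; case: (q <= n)%N.
  apply: pnorm_lower => //; [exact: convex_ltn|exact: convex_geq|move=> n nq|].
    by rewrite leqNgt nq.
  exact: pbounded_supp (cutoff_supp _ xN).
have := low _ (anc_leq par1P); have := low _ (anc_leq par2P); lra.
Qed.

(** Cauchy-Schwarz for [(sqrt k, 1)] and [(a, b)]: with one more window the factor grows from
    [sqrt k] to [sqrt k.+1]. *)
Let cauchy2 (k : nat) (a b c : R) : 0 <= a -> 0 <= b -> 0 <= c ->
  a ^+ 2 + b ^+ 2 <= c ^+ 2 ->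
  Num.sqrt k%:R * a + b <= Num.sqrt k.+1%:R * c.
Proof.
move=> a0 b0 c0 h; set s := Num.sqrt k%:R.
have s0 : 0 <= s := sqrtr_ge0 _; have s2 : s ^+ 2 = k%:R by rewrite sqr_sqrtr.
rewrite -(@ler_pXn2r _ 2) ?nnegrE ?addr_ge0 ?mulr_ge0 ?sqrtr_ge0 //.
rewrite exprMn sqr_sqrtr // -(natr1 k) -s2.
apply: (@le_trans _ _ ((s ^+ 2 + 1) * (a ^+ 2 + b ^+ 2))); last first.
  by rewrite ler_wpM2l // addr_ge0 // sqr_ge0.
have : 0 <= (a - s * b) ^+ 2 by exact: sqr_ge0.
by nra.
Qed.

(** Flat blocks are stacked so that each is small before and after a window of its own; on the
    windows, [k] blocks together cost [2 C sqrt k] by the lower 2-estimate. Division by [k] leaves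
    [2 tau + 2 C / sqrt k], each term at most [c / 2]. *)
Lemma small_average phi (C c : R) : 0 <= C -> 0 < c ->
  (forall i x N, supp_lt x N -> `|pairing (phi i) x N| <= C * nm x) ->
  exists (n : nat) (u : nat -> R), \sum_(i < n) `|u i| = 1 /\
    forall x N, supp_lt x N ->
      `|pairing (fun m => \sum_(i < n) u i * phi i m) x N| <= c * nm x.
Proof.
move=> C0 c0 hphi; pose tau := c / 4.
have tau0 : 0 < tau by rewrite divr_gt0.
have main (k : nat) : exists (n q : nat) (u : nat -> R), \sum_(i < n) `|u i| = k%:R /\
    forall x N, supp_lt x N ->
      `|pairing (fun m => \sum_(i < n) u i * phi i m) x N| <=
        2 * k%:R * tau * nm x + 2 * C * (Num.sqrt k%:R * w (below q x)).
  elim: k => [|k [n [q [u [su hu]]]]].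
    exists 0%N, 0%N, (fun=> 0); split=> [|x N xN]; first by rewrite big_ord0.
    rewrite [pairing _ _ _]big1 => [|i _]; last by rewrite big_ord0 mul0r.
    by rewrite sqrtr0 !(mul0r, mulr0) addr0 normr0.
  have [K [eps [q1 [K0 e1 head tail]]]] := flat_block par1P par2P q C0 tau0
    (fun i => hphi (n + i)%N).
  pose r := maxn q q1; pose v i := if (i < n)%N then u i else eps (i - n)%N / K%:R.
  have Kn0 : K%:R != 0 :> R by rewrite pnatr_eq0 -lt0n.
  have split_sum (f : nat -> R -> R) : \sum_(i < n + K) f i (v i) =
      \sum_(i < n) f i (u i) + \sum_(i < K) f (n + i)%N (eps i / K%:R).
    rewrite big_split_ord /=; congr (_ + _); apply: eq_bigr => i _ /=.
      by rewrite /v ltn_ord.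
    by rewrite /v ltnNge leq_addr /= addKn.
  exists (n + K)%N, r, v; split=> [|x N xN].
    rewrite (split_sum (fun _ a => `|a|)) su.
    rewrite (eq_bigr (fun=> K%:R^-1)) => [|i _]; last first.
      by rewrite normrM e1 mul1r ger0_norm // invr_ge0.
    by rewrite sumr_const card_ord -[_ *+ K]mulr_natr mulVf // natr1.
  pose h := fun m => \sum_(i < K) eps i / K%:R * phi (n + i)%N m.
  have -> : pairing (fun m => \sum_(i < n + K) v i * phi i m) x N =
      pairing (fun m => \sum_(i < n) u i * phi i m) x N + pairing h x N.
    rewrite -pairingDl; apply: eq_bigr => m _; congr (_ * _).
    exact: (split_sum (fun i a => a * phi i m)).
  have xr : supp_lt (block q r x) r.
    by move=> m rm; rewrite /block /cutoff [(m < r)%N]ltnNge rm andbF.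
  have bx : supp_lt (below q x) q by move=> m qm; rewrite /below /cutoff ltnNge qm.
  pose above := cutoff (fun m => (r <= m)%N) x.
  have aN : supp_lt above N by exact: cutoff_supp.
  pose M := maxn N r.
  have xsplit : pairing h x N = pairing h (below q x) q + pairing h (block q r x) M +
      pairing h above N.
    rewrite -(pairing_supp h xN (leq_maxl N r)) -(pairing_supp h aN (leq_maxl N r)).
    have qM : (q <= M)%N by rewrite /M !leq_max leqnn !orbT.
    rewrite -(pairing_supp h bx qM) -!pairingD; apply: eq_bigr => m _; congr (_ * _).
    rewrite /below /block /above /cutoff /=.
    have [mq|qm] := ltnP m q.
      have mr : (m < r)%N := leq_trans mq (leq_maxl _ _).
      by rewrite [(r <= m)%N]leqNgt mr !addr0.
    by rewrite add0r; have [mr|rm] := ltnP m r; rewrite ?addr0 ?add0r.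
  have cut_nm A : (forall le, (forall u v, le u v -> (u <= v)%N) -> convex le A) ->
      nm (cutoff A x) <= nm x.
    move=> cA; rewrite /nm lerD //.
      exact: (pnorm_cutoff (cA _ (anc_leq par1P)) (pbounded_supp _ xN)).2.
    exact: (pnorm_cutoff (cA _ (anc_leq par2P)) (pbounded_supp _ xN)).2.
  have h1 : `|pairing h (below q x) q| <= tau * nm x.
    apply: (le_trans (head _ bx)); rewrite ler_wpM2l ?(ltW tau0) //.
    by apply: cut_nm => le hle; exact: convex_ltn.
  have h3 : `|pairing h above N| <= tau * nm x.
    apply: (@le_trans _ _ (tau * nm above)).
      apply: tail aN _ => m mq; rewrite /above /cutoff leqNgt.
      by have -> : (m < r)%N := leq_trans mq (leq_maxr _ _).
    rewrite ler_wpM2l ?(ltW tau0) //.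
    by apply: cut_nm => le hle; exact: convex_geq.
  have h2 : `|pairing h (block q r x) M| <= 2 * C * w (block q r x).
    apply: (@le_trans _ _ (C * nm (block q r x))); last first.
      by rewrite [2 * C]mulrC -mulrA ler_wpM2l // (nm_le_w xr).
    have xM := supp_ltW xr (leq_maxr N r).
    rewrite /h pairing_suml (le_trans (ler_norm_sum _ _ _)) //.
    apply: (@le_trans _ _ (\sum_(i < K) K%:R^-1 * (C * nm (block q r x)))).
      apply: ler_sum => i _; rewrite pairingZl normrM normrM e1 mul1r.
      rewrite ger0_norm ?invr_ge0 // ler_wpM2l ?invr_ge0 //.
      exact: hphi xM.
    by rewrite sumr_const card_ord -[_ *+ K]mulr_natl mulVKf.
  have h4 := hu x N xN.
  have h5 := w_blocks xN (leq_maxl q q1).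
  have h6 := cauchy2 k (sqrtr_ge0 _) (sqrtr_ge0 _) (sqrtr_ge0 _) h5.
  have h7 : 2 * C * (Num.sqrt k%:R * w (below q x) + w (block q r x)) <=
      2 * C * (Num.sqrt k.+1%:R * w (below r x)) by rewrite ler_wpM2l // mulr_ge0.
  rewrite xsplit.
  apply: (@le_trans _ _ ((2 * k%:R * tau * nm x + 2 * C * (Num.sqrt k%:R * w (below q x)))
     + (tau * nm x + 2 * C * w (block q r x) + tau * nm x))).
    rewrite (le_trans (ler_normD _ _)) // lerD // (le_trans (ler_normD _ _)) // lerD //.
    by rewrite (le_trans (ler_normD _ _)) // lerD.
  by move: h7; rewrite -(natr1 k) mulrDr; lra.
pose k := (Num.bound ((4 * C / c) ^+ 2)).+1.
have k0 : 0 < k%:R :> R by rewrite ltr0n.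
have sk0 : 0 < Num.sqrt k%:R :> R by rewrite sqrtr_gt0.
have sk2 : Num.sqrt k%:R ^+ 2 = k%:R :> R by rewrite sqr_sqrtr // ltW.
have kC : 4 * C <= c * Num.sqrt k%:R.
  have q0 : 0 <= 4 * C / c by apply: divr_ge0; [exact: mulr_ge0|exact: ltW].
  rewrite [leRHS]mulrC -ler_pdivrMr // -(@ler_pXn2r _ 2) ?nnegrE ?(ltW sk0) // sk2.
  apply: (@le_trans _ _ (Num.bound ((4 * C / c) ^+ 2))%:R).
    by apply/ltW/archi_boundP; exact: sqr_ge0.
  by rewrite ler_nat.
have [n [q [u [su hu]]]] := main k.
exists n, (fun i => u i / k%:R); split=> [|x N xN].
  rewrite (eq_bigr (fun i : 'I_n => `|u i| * k%:R^-1)) => [|i _]; last first.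
    by rewrite normrM [X in _ * X]ger0_norm // invr_ge0 ltW.
  by rewrite -mulr_suml su divff // gt_eqF.
have -> : pairing (fun m => \sum_(i < n) u i / k%:R * phi i m) x N =
   k%:R^-1 * pairing (fun m => \sum_(i < n) u i * phi i m) x N.
  rewrite -pairingZl; apply: eq_bigr => m _; congr (_ * _).
  by rewrite mulr_sumr; apply: eq_bigr => i _; rewrite mulrA [_ * u i]mulrC.
rewrite normrM ger0_norm ?invr_ge0 ?(ltW k0) // mulrC ler_pdivrMr //.
apply: (le_trans (hu x N xN)).
have bN : supp_lt (below q x) N by exact: cutoff_supp.
have wx : w (below q x) <= nm x.
  apply: (le_trans (w_le_nm bN)); rewrite /nm /below lerD //.
    exact: (pnorm_cutoff (@convex_ltn _ q (anc_leq par1P)) (pbounded_supp _ xN)).2.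
  exact: (pnorm_cutoff (@convex_ltn _ q (anc_leq par2P)) (pbounded_supp _ xN)).2.
have n0 := nm_ge0 (par1 := par1) (par2 := par2) xN.
have : 2 * C * (Num.sqrt k%:R * w (below q x)) <= 2 * C * (Num.sqrt k%:R * nm x).
  by rewrite ler_wpM2l ?mulr_ge0 // ler_wpM2l ?sqrtr_ge0.
have : 4 * C * (Num.sqrt k%:R * nm x) <= c * Num.sqrt k%:R * (Num.sqrt k%:R * nm x).
  by rewrite ler_wpM2r // mulr_ge0 // sqrtr_ge0.
have -> : c * Num.sqrt k%:R * (Num.sqrt k%:R * nm x) = c * nm x * k%:R.
  by transitivity (c * nm x * Num.sqrt k%:R ^+ 2); [ring|rewrite sk2].
have -> : 2 * k%:R * tau * nm x = c * nm x * k%:R / 2 by rewrite /tau; field.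
by lra.
Qed.

End averages_of_blocks.

(** * The space *)

(* Heap numbering of the binary tree: the children of [n > 0] are [2n] and [2n + 1],
   and [0] is an extra root whose only child is [1]. *)
Lemma half_is_parent : is_parent half.
Proof.
split=> [n|n n0|m]; [lia|lia|].
by exists (m.*2 + 2)%N => n; lia.
Qed.

Lemma predn_is_parent : is_parent predn.
Proof.
split=> [n|n n0|m]; [exact: leq_pred|by rewrite prednK|].
by exists m.+2 => -[|n] /= <-.
Qed.

Local Notation tree := (ancestor half).
Local Notation line := (ancestor predn).

Lemma line_leq u v : line u v <-> (u <= v)%N.
Proof.
split=> [|uv]; first exact: anc_leq predn_is_parent _ _.
exists (v - u)%N; rewrite -{2}(subKn uv); elim: (v - u)%N => [|k IH] /=.
  by rewrite subn0.
by rewrite IH subnS.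
Qed.

Lemma segment_line : segment line xpredT.
Proof.
split=> // u v _ _; case/orP: (leq_total u v) => /line_leq; [by left|by right].
Qed.

Section james_space.
Context (R : realType).

Definition james_seq : {pred nat -> R^o} :=
  mem [set x : nat -> R^o | pbounded tree (x : nat -> R) /\
                            pbounded line (x : nat -> R)].

Record james := James { james_fun :> nat -> R^o; jamesP : james_fun \in james_seq }.

HB.instance Definition _ := [isSub for james_fun].
HB.instance Definition _ := [Choice of james by <:].

Lemma james_seq_submod : submod_closed james_seq.
Proof.
have b0 le : pbounded le (fun=> 0 : R) by exact: (@pbounded_supp _ _ _ 0%N).
have bDZ le (a : R) (x y : nat -> R) : pbounded le x -> pbounded le y ->
    pbounded le (fun n => a * x n + y n).
  by move=> bx bY; apply: (pnormD (pnormZ_le a bx).1 bY).1.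
split=> [|a x y]; first by rewrite inE; split; exact: b0.
by rewrite !inE => -[x1 x2] [y1 y2]; split; exact: bDZ.
Qed.

HB.instance Definition _ :=
  GRing.isSubmodClosed.Build R (nat -> R^o) james_seq james_seq_submod.
HB.instance Definition _ := [SubChoice_isSubLmodule of james by <:].

Definition james_norm (x : james) : R :=
  pnorm tree (x : nat -> R) + pnorm line (x : nat -> R).

Lemma james_tree (x : james) : pbounded tree (x : nat -> R).
Proof. by have := jamesP x; rewrite inE => -[]. Qed.

Lemma james_line (x : james) : pbounded line (x : nat -> R).
Proof. by have := jamesP x; rewrite inE => -[]. Qed.

Lemma james_normD (x y : james) : james_norm (x + y) <= james_norm x + james_norm y.
Proof.
rewrite /james_norm addrACA; apply: lerD.
  exact: (pnormD (james_tree x) (james_tree y)).2.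
exact: (pnormD (james_line x) (james_line y)).2.
Qed.

Lemma james_normZ (a : R) (x : james) : james_norm (a *: x) = `|a| * james_norm x.
Proof.
have le_normZ (b : R) (y : james) : james_norm (b *: y) <= `|b| * james_norm y.
  rewrite /james_norm mulrDr; apply: lerD.
    exact: (pnormZ_le b (james_tree y)).2.
  exact: (pnormZ_le b (james_line y)).2.
apply/eqP; rewrite eq_le le_normZ /=.
have [->|a0] := eqVneq a 0.
  rewrite normr0 mul0r addr_ge0 //; apply: pnorm_ge0; first exact: james_tree.
  exact: james_line.
rewrite -ler_pdivlMl ?normr_gt0// -normfV.
by rewrite -{1}(scale1r x) -(mulVf a0) -scalerA le_normZ.
Qed.

Lemma james_coord (x : james) n : `|x n| <= james_norm x.
Proof.
apply: (@le_trans _ _ (pnorm tree (x : nat -> R))).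
  by apply: coord_le_pnorm (james_tree x); [exact: anc_leq half_is_parent|exact: anc_refl].
by rewrite lerDl pnorm_ge0 //; exact: james_line.
Qed.

Lemma james_norm0_eq0 (x : james) : james_norm x = 0 -> x = 0.
Proof.
move=> x0; apply/val_inj/funext => n; apply/eqP.
by rewrite -normr_le0 -x0 james_coord.
Qed.

HB.instance Definition _ := Lmodule_isNormed.Build R james
  james_normD james_normZ james_norm0_eq0.

Lemma james_normE (x : james) : `|x| = pnorm tree (x : nat -> R) + pnorm line (x : nat -> R).
Proof. by []. Qed.

Lemma pnorm_tree_le (x : james) : pnorm tree (x : nat -> R) <= `|x|.
Proof. by rewrite james_normE lerDl pnorm_ge0 //; exact: james_line. Qed.

Lemma pnorm_line_le (x : james) : pnorm line (x : nat -> R) <= `|x|.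
Proof. by rewrite james_normE lerDr pnorm_ge0 //; exact: james_tree. Qed.

(** The limit is taken coordinatewise. A pairing sees finitely many coordinates, so its value on
    [x0 - L] is approximated by values on [x0 - x] with [x] in the ball; this gives both membership
    of [L] and convergence in norm. *)
Lemma james_complete (F : set_system james) : ProperFilter F -> cauchy F -> cvg F.
Proof.
move=> FF Fc.
have Fball (e : R) : 0 < e -> exists x0 : james, F (ball x0 e).
  by move=> e0; exact: ((cauchyP F).1 Fc e e0).
have coordc n : cauchy ((fun x : james => x n) @ F).
  apply: cauchy_exP => e e0; have [x0 Fx0] := Fball e e0.
  exists (x0 n); suff : F [set x : james | `|x0 n - x n| < e] by [].
  apply: filterS Fx0 => x; rewrite -ball_normE /= => x0x.
  by apply: le_lt_trans x0x; exact: (james_coord (x0 - x)).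
pose L n : R^o := lim ((fun x : james => x n) @ F).
have cL n : (fun x : james => x n) @ F --> L n by exact: cauchy_cvg (coordc n).
have near_L (e : R) N : 0 < e -> F [set x : james | forall n, (n < N)%N -> `|L n - x n| <= e].
  move=> e0.
  have : F [set x : james | forall n : 'I_N, `|L n - x n| <= e].
    by apply: filter_forall => n; have /cvgrPdist_le h := cL n; exact: (h e e0).
  by apply: filterS => x h n nN; exact: (h (Ordinal nN)).
have close le (e : R) (x0 : james) d N : 0 < e -> F (ball x0 e) ->
    (forall x : james, pbounded le (x : nat -> R)) ->
    (forall x : james, pnorm le (x : nat -> R) <= `|x|) ->
    norming le d -> pairing d (fun n => x0 n - L n) N <= e.
  move=> e0 Fx0 lb lp dd; apply/ler_addgt0Pr => t t0.
  have t1 : 0 < t / N.+1%:R by rewrite divr_gt0.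
  have [x [/= x0x xL]] := filter_ex (filterI Fx0 (near_L _ N t1)).
  have -> : pairing d (fun n => x0 n - L n) N =
      pairing d (fun n => x0 n - x n) N + pairing d (fun n => x n - L n) N.
    by rewrite -pairingD; apply: eq_bigr => n _ /=; congr (_ * _); ring.
  apply: lerD.
    have h : pairing d (fun n => x0 n - x n) N <= pnorm le ((x0 - x : james) : nat -> R).
      exact: (pairing_pnorm N (lb (x0 - x))).
    apply: (le_trans h); apply: (le_trans (lp _)).
    by move: x0x; rewrite -ball_normE /= => /ltW.
  apply: (@le_trans _ _ (\sum_(n < N) t / N.+1%:R)).
    apply: ler_sum => n _; rewrite (le_trans (ler_norm _)) // normrM -[leRHS]mul1r.
    by rewrite ler_pM ?(norming_le1 _ dd) // distrC xL.
  rewrite sumr_const card_ord -[_ *+ N]mulr_natr -mulrA ler_piMr ?(ltW t0) //.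
  by rewrite mulrC ler_pdivrMr // mul1r ler_nat.
have [x0 Fx0] := Fball 1 ltr01.
have bL le : (forall x : james, pbounded le (x : nat -> R)) ->
    (forall x : james, pnorm le (x : nat -> R) <= `|x|) -> pbounded le (L : nat -> R).
  move=> lb lp.
  have [bd _] := pnorm_ub (fun d N => close le 1 x0 d N ltr01 Fx0 lb lp).
  have := (pnormD (lb x0) (pnormZ_le (-1) bd).1).1; congr (pbounded le _).
  by apply/funext => n /=; ring.
have LP : (L : nat -> R^o) \in james_seq.
  by rewrite inE; split; apply: bL;
    [exact: james_tree|exact: pnorm_tree_le|exact: james_line|exact: pnorm_line_le].
pose LJ := James LP.
apply/cvg_ex; exists LJ; apply/cvgrPdist_lt => e e0.
have e4 : 0 < e / 4 by rewrite divr_gt0.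
have [y Fy] := Fball _ e4.
apply: filterS (Fy) => x; rewrite -ball_normE /= => yx.
have yL : `|y - LJ| <= e / 4 + e / 4.
  rewrite james_normE; apply: lerD.
    by apply: (pnorm_ub _).2 => d N dd; exact: (close tree _ y d N e4 Fy james_tree pnorm_tree_le).
  by apply: (pnorm_ub _).2 => d N dd; exact: (close line _ y d N e4 Fy james_line pnorm_line_le).
have -> : LJ - x = - (y - LJ) + (y - x) by rewrite opprB addrA subrK.
rewrite (le_lt_trans (ler_normD _ _)) // normrN; lra.
Qed.

HB.instance Definition _ := Uniform_isComplete.Build james james_complete.


End james_space.

(** * Truncations and the unit vector basis *)

Section basis.
Context (R : realType).
Local Notation X := (james R).
Local Notation nm := (@nm R half predn).
Implicit Types (x y : nat -> R) (z : X).

(** A pairing that nearly attains the norm uses only [N0] coordinates, so the head has norm at least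
    [p - t], and the lower 2-estimate leaves at most [2 p t] for the square of the norm of the
    tail. *)
Lemma pnorm_tail (le : nat -> nat -> Prop) x (e : R) : (forall u v, le u v -> (u <= v)%N) ->
  pbounded le x -> 0 < e ->
  exists N0, forall N, (N0 <= N)%N -> pnorm le (cutoff (fun n => (N <= n)%N) x) <= e.
Proof.
move=> hle bx e0; set p := pnorm le x; have p0 : 0 <= p := pnorm_ge0 bx.
pose t := e ^+ 2 / (2 * p + 1).
have p1 : 0 < 2 * p + 1 by rewrite ltr_wpDl // mulr_ge0.
have t0 : 0 < t by rewrite divr_gt0 // exprn_gt0.
have [|_ [d [N0 [dd ->]]] hd] := sup_adherent t0 (E := values le x).
  by split => //; exact: values0.
exists N0 => N N0N.
pose lo := cutoff (fun n => (n < N)%N) x; pose hi := cutoff (fun n => (N <= n)%N) x.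
have [blo plo] := pnorm_cutoff (convex_ltn (N := N) hle) bx.
have [bhi phi] := pnorm_cutoff (convex_geq (N := N) hle) bx.
have lower : pnorm le lo ^+ 2 + pnorm le hi ^+ 2 <= p ^+ 2.
  apply: pnorm_lower => //; [exact: convex_ltn|exact: convex_geq|].
  by move=> n nN; rewrite leqNgt nN.
have near_p : p - t <= pnorm le lo.
  have := pairing_pnorm N0 blo dd.
  have -> : pairing d lo N0 = pairing d x N0.
    by apply: eq_bigr => n _; rewrite /lo /cutoff (leq_trans (ltn_ord n) N0N).
  by move=> h; apply: le_trans h; exact: ltW.
have h0 := pnorm_ge0 bhi; have l0 := pnorm_ge0 blo.
rewrite -(@ler_pXn2r _ 2) ?nnegrE ?(ltW e0) //.
have te : t * (2 * p + 1) = e ^+ 2 by rewrite /t mulfVK // gt_eqF.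
rewrite -/hi -te -/lo in h0 l0 near_p plo *.
have : p ^+ 2 - pnorm le lo ^+ 2 <= t * (2 * p).
  rewrite subr_sqr; apply: ler_pM; rewrite ?subr_ge0 ?addr_ge0 //; first lra.
  by rewrite mulr_natl mulr2n lerD2l.
lra.
Qed.

Lemma trunc_subproof N x :
  (cutoff (fun n => (n < N)%N) x : nat -> R^o) \in @james_seq R.
Proof.
have h : supp_lt (cutoff (fun n => (n < N)%N) x) N.
  by move=> n Nn; rewrite /cutoff ltnNge Nn.
by rewrite inE; split; exact: pbounded_supp h.
Qed.

Definition trunc N x : X := James (trunc_subproof N x).

Definition unit_vec n : X := trunc n.+1 (delta n).

Lemma truncE N x n : trunc N x n = if (n < N)%N then x n else 0.
Proof. by []. Qed.

Lemma unit_vecE n k : unit_vec n k = (k == n)%:R.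
Proof.
rewrite truncE ltnS /delta; case: leqP => // nk.
by rewrite gtn_eqF.
Qed.

Lemma james_sumE (I : eqType) (r : seq I) (P : pred I) (F : I -> X) n :
  (\sum_(i <- r | P i) F i) n = \sum_(i <- r | P i) F i n.
Proof. by elim/big_rec2: _ => // i y1 y2 _ <-. Qed.

Lemma trunc_sum N x : trunc N x = \sum_(n < N) x n *: unit_vec n.
Proof.
apply/val_inj/funext => k.
change (trunc N x k = (\sum_(n < N) x n *: unit_vec n : X) k).
rewrite james_sumE truncE.
have E (i : 'I_N) : (x i *: unit_vec i : X) k = x i * (k == i)%:R.
  by rewrite -unit_vecE.
under eq_bigr do rewrite E.
case: ltnP => kN.
  rewrite (bigD1 (Ordinal kN)) //= eqxx mulr1 big1 ?addr0 // => i.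
  by rewrite -val_eqE /= eq_sym => /negbTE ->; rewrite mulr0.
rewrite big1 // => i _; rewrite gtn_eqF ?mulr0 //.
exact: leq_trans (ltn_ord i) kN.
Qed.

Lemma series_trunc (a : nat -> R) N :
  series (fun n => a n *: unit_vec n) N = trunc N a.
Proof. by rewrite trunc_sum /series /= big_mkord. Qed.

Lemma norm_trunc N x : supp_lt x N -> `|trunc N x| = nm x.
Proof.
move=> xN; have E : cutoff (fun n => (n < N)%N) x = x.
  by apply/funext => n; rewrite /cutoff; case: ltnP => // /xN ->.
by rewrite james_normE /nm /= E.
Qed.

Lemma norm_trunc_le N z : `|trunc N z| <= `|z|.
Proof.
rewrite !james_normE; apply: lerD.
  apply: (pnorm_cutoff _ (james_tree z)).2; apply: convex_ltn; exact: anc_leq half_is_parent.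
apply: (pnorm_cutoff _ (james_line z)).2; apply: convex_ltn; exact: anc_leq predn_is_parent.
Qed.

Lemma trunc_tail z (e : R) : 0 < e -> exists N0, forall N, (N0 <= N)%N -> `|z - trunc N z| <= e.
Proof.
move=> e0; have e2 : 0 < e / 2 by rewrite divr_gt0.
have [N1 h1] := pnorm_tail (@anc_leq _ half_is_parent) (james_tree z) e2.
have [N2 h2] := pnorm_tail (@anc_leq _ predn_is_parent) (james_line z) e2.
exists (maxn N1 N2) => N; rewrite geq_max => /andP[n1 n2].
have E : (z - trunc N z : X) = cutoff (fun n => (N <= n)%N) z :> (nat -> R).
  apply/funext => n; rewrite /cutoff; have -> : (z - trunc N z) n = z n - trunc N z n by [].
  by rewrite truncE; case: ltnP; rewrite ?subrr ?subr0.
rewrite james_normE E.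
by have := h1 N n1; have := h2 N n2; lra.
Qed.

Lemma schauder_unit_vec : schauder_basis unit_vec.
Proof.
move=> z; exists (z : nat -> R); split.
  apply/cvgrPdist_le => e e0; have [N0 h] := trunc_tail z e0.
  by exists N0 => // N /= /h; rewrite series_trunc.
move=> a /cvgrPdist_le ha; apply/funext => k; apply/eqP; rewrite -subr_eq0 -normr_le0.
apply/ler_addgt0Pr => e e0; rewrite add0r; have [N0 _ h] := ha e e0.
have := h (maxn N0 k.+1) (leq_maxl _ _); rewrite /= series_trunc.
apply: le_trans; apply: le_trans (james_coord (z - trunc _ a) k).
by rewrite -[(z - _) k]/(z k - trunc _ a k) truncE leq_max leqnn orbT.
Qed.

Lemma bounded_op_eq (W : normedModType R) (U V : bounded_op X W) :
  (forall n, U (unit_vec n) = V (unit_vec n)) -> U = V.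
Proof.
move=> h; apply/val_inj/funext => z; apply/eqP; rewrite -subr_eq0 -normr_le0.
apply/ler_addgt0Pr => e e0; rewrite add0r.
pose M := opnorm U + opnorm V + 1.
have M0 : 0 < M by rewrite ltr_wpDl // addr_ge0 ?opnorm_ge0.
have [N0 hN] := trunc_tail z (divr_gt0 e0 M0).
have eqT : U (trunc N0 z) = V (trunc N0 z).
  rewrite trunc_sum !linear_sum; apply: eq_bigr => n _.
  by rewrite !linearZ /= h.
have -> : U z - V z = U (z - trunc N0 z) - V (z - trunc N0 z).
  by rewrite (raddfB U) (raddfB V) /= eqT opprB addrA subrK.
apply: (@le_trans _ _ (M * `|z - trunc N0 z|)).
  rewrite (le_trans (ler_normB _ _)) // /M !mulrDl mul1r.
  by rewrite -[leLHS]addr0 lerD // lerD // opnormP.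
by rewrite mulrC -ler_pdivlMr // hN.
Qed.

Definition coef (f : dual X) n : R := f (unit_vec n).

Lemma coef_trunc (f : dual X) N x : f (trunc N x) = pairing (coef f) x N.
Proof.
rewrite trunc_sum linear_sum; apply: eq_bigr => n _.
by rewrite linearZ /= mulrC.
Qed.

Lemma coef_bound (f : dual X) x N : supp_lt x N ->
  `|pairing (coef f) x N| <= `|f| * nm x.
Proof. by move=> xN; rewrite -coef_trunc -(norm_trunc xN); exact: opnormP. Qed.

Lemma dual_norm_le (f : dual X) (M : R) : 0 <= M ->
  (forall x N, supp_lt x N -> `|pairing (coef f) x N| <= M * nm x) -> `|f| <= M.
Proof.
move=> M0 h; apply: opnorm_lub => z z1; apply/ler_addgt0Pr => e e0.
have f1 : 0 < opnorm f + 1 by rewrite ltr_wpDl // opnorm_ge0.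
have [N0 hN] := trunc_tail z (divr_gt0 e0 f1).
have -> : f z = f (trunc N0 z) + f (z - trunc N0 z) by rewrite -linearD /= addrCA subrr addr0.
rewrite (le_trans (ler_normD _ _)) // lerD //.
  have -> : trunc N0 z = trunc N0 (trunc N0 z).
    by apply/val_inj/funext => n /=; rewrite /cutoff; case: ifP.
  have sN : supp_lt (trunc N0 z : nat -> R) N0 by move=> n Nn; rewrite truncE ltnNge Nn.
  rewrite coef_trunc (le_trans (h _ _ sN)) // -(norm_trunc sN).
  rewrite -[leRHS]mulr1 ler_wpM2l // (le_trans (norm_trunc_le _ _)) //.
  exact: le_trans (norm_trunc_le _ _) z1.
rewrite (le_trans (opnormP f _)) //.
apply: (@le_trans _ _ ((opnorm f + 1) * `|z - trunc N0 z|)).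
  by rewrite ler_wpM2r // lerDl.
by rewrite mulrC -ler_pdivlMr // hN.
Qed.

End basis.

(** * Duality *)

Lemma bound_continuous (R : realType) (V W : normedModType R) (f : V -> W) (M : R) :
  linear f -> (forall x, `|f x| <= M * `|x|) -> continuous f.
Proof.
move=> lf fM; pose g : {linear V -> W} := HB.pack f (GRing.isLinear.Build R V W *:%R f lf).
apply: (@bounded_linear_continuous R V W g); apply/linear_boundedP.
exists M; split; first exact: num_real.
move=> r Mr x; apply: (le_trans (fM x)); rewrite ler_wpM2r //.
exact: ltW.
Qed.

Section duality.
Context (R : realType).
Local Notation X := (james R).
Local Notation nm := (@nm R half predn).
Local Notation e := (@unit_vec R).
Implicit Types (x y phi : nat -> R) (z : X).

(** The partial pairings of [phi] with [z] are Cauchy by [trunc_tail]; their limit is the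
    functional. *)
Lemma functional_of phi (M : R) : 0 <= M ->
  (forall x N, supp_lt x N -> `|pairing phi x N| <= M * nm x) ->
  exists f : dual X, forall n, coef f n = phi n.
Proof.
move=> M0 hphi.
have trunc_supp N x : supp_lt (trunc N x : nat -> R) N.
  by move=> n Nn; rewrite truncE ltnNge Nn.
have trunc_bound N z : `|pairing phi z N| <= M * `|z|.
  have -> : pairing phi z N = pairing phi (trunc N z) N.
    by apply: eq_bigr => n _; rewrite truncE ltn_ord.
  apply: (le_trans (hphi _ _ (trunc_supp N z))); rewrite ler_wpM2l //.
  apply: le_trans (norm_trunc_le N z); rewrite -(norm_trunc (trunc_supp N z)).
  exact: norm_trunc_le.
pose u z N : R^o := pairing phi z N.
have uD (a : R) z1 z2 N : u (a *: z1 + z2) N = a * u z1 N + u z2 N.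
  by rewrite /u -pairingZ -pairingD.
have cu z : cvgn (u z).
  apply: cauchy_cvg; apply: cauchy_exP => t t0.
  have M1 : 0 < M + 1 by rewrite ltr_wpDl.
  have [N0 hN] := trunc_tail z (divr_gt0 t0 M1).
  exists (u z N0); exists N0 => // N /= N0N; rewrite -ball_normE /=.
  have -> : u z N0 - u z N = - u (z - trunc N0 z) N.
    have -> : z - trunc N0 z = -1 *: trunc N0 z + z by rewrite scaleN1r addrC.
    rewrite uD mulN1r opprD opprK; congr (_ - _).
    rewrite /u (pairing_supp phi (trunc_supp N0 z) N0N).
    by apply: eq_bigr => n _; rewrite truncE ltn_ord.
  rewrite normrN; apply: (le_lt_trans (trunc_bound N _)).
  apply: (@le_lt_trans _ _ (M * (t / (M + 1)))); first by rewrite ler_wpM2l // hN.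
  by rewrite mulrCA gtr_pMr // ltr_pdivrMr // mul1r ltrDl.
pose F z : R^o := limn (u z).
have cF z : u z @ \oo --> F z := cu z.
have linF : linear F.
  move=> a z1 z2; apply: cvg_lim => //.
  rewrite (_ : u _ = (fun N => a *: u z1 N + u z2 N)); last first.
    by apply/funext => N; rewrite uD.
  by apply: cvgD; [apply: cvgZl_tmp|].
have boundF z : `|F z| <= M * `|z|.
  apply/ler_addgt0Pr => t t0; have /cvgrPdist_le/(_ t t0)[N _ hN] := cF z.
  have := hN N (leqnn N); rewrite /= => h.
  have -> : F z = u z N + (F z - u z N) by rewrite addrC subrK.
  by rewrite (le_trans (ler_normD _ _)) // lerD //; exact: trunc_bound.
have FP : F \in @bounded_linear R X R^o.
  by rewrite inE; split => //; exact: bound_continuous linF boundF.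
exists (BoundedOp FP) => n; apply: cvg_lim => //.
apply/cvgrPdist_le => t t0; exists n.+1 => // N /= nN.
have -> : u (e n) N = phi n.
  rewrite /u -(pairing_delta phi nN); apply: eq_bigr => k _.
  by rewrite unit_vecE.
by rewrite subrr normr0 ltW.
Qed.

Definition dual_norming (d : nat -> R) := norming tree d \/ norming line d.

Lemma dual_norming_bound d z N : dual_norming d -> `|pairing d z N| <= `|z|.
Proof.
move=> [dd|dd].
  exact: le_trans (pairing_pnorm_abs N (james_tree z) dd) (pnorm_tree_le z).
exact: le_trans (pairing_pnorm_abs N (james_line z) dd) (pnorm_line_le z).
Qed.

(** A mixed product is again a tree sequence, since tree ancestors are smaller numbers. *)
Lemma dual_normingM d d' : dual_norming d -> dual_norming d' ->
  dual_norming (fun n => d n * d' n).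
Proof.
have tl u v : tree u v -> line u v by move=> /(anc_leq half_is_parent) /line_leq.
move=> [h|h] [h'|h'].
- by left; apply: normingM h h'.
- by left; apply: normingM h h'.
- left; have := normingM tl h' h; congr norming; apply/funext => n; exact: mulrC.
- by right; apply: normingM h h'.
Qed.

Lemma dual_norming_cutoff d N : dual_norming d ->
  dual_norming (cutoff (fun n => (n < N)%N) d).
Proof.
move=> [h|h]; [left|right]; apply: norming_cutoff h; apply: convex_ltn.
  exact: anc_leq half_is_parent.
exact: anc_leq predn_is_parent.
Qed.

(** The test sequence [d] moves over to the vector: [d z] cut off at [N] has both norms at most
    [|z|], because a test of it is, by products, a test of [z]. Hence the factor 2 here, and 4 for
    the full norm of [mult_fun]. *)
Lemma mult_bound (f : dual X) z d N : dual_norming d ->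
  `|pairing d (fun n => coef f n * z n) N| <= 2 * `|f| * `|z|.
Proof.
move=> dd; pose y := cutoff (fun n => (n < N)%N) (fun n => d n * z n).
have yN : supp_lt y N by move=> n Nn; rewrite /y /cutoff ltnNge Nn.
have -> : pairing d (fun n => coef f n * z n) N = pairing (coef f) y N.
  by apply: eq_bigr => n _; rewrite /y /cutoff ltn_ord mulrCA.
apply: (le_trans (coef_bound f yN)).
rewrite [2 * _]mulrC -mulrA ler_wpM2l // /nm mulr_natl mulr2n.
have bound d' M : dual_norming d' -> pairing d' y M <= `|z|.
  move=> dd'; have -> : pairing d' y M =
      pairing (cutoff (fun n => (n < N)%N) (fun n => d' n * d n)) z M.
    by rewrite -pairing_cutoff; apply: eq_bigr => n _; rewrite /y /cutoff;
      case: ifP; rewrite ?mulr0 ?mulrA.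
  apply: (le_trans (ler_norm _)); apply: dual_norming_bound.
  by apply: dual_norming_cutoff; exact: dual_normingM.
by rewrite lerD //; apply: (pnorm_ub _).2 => d' M h; apply: bound; [left|right].
Qed.

Lemma mult_subproof (f : dual X) z :
  ((fun n => coef f n * z n) : nat -> R^o) \in @james_seq R.
Proof.
rewrite inE; split.
  by apply: (pnorm_ub (M := 2 * `|f| * `|z|) _).1 => d N h;
    apply: (le_trans (ler_norm _)); apply: mult_bound; left.
by apply: (pnorm_ub (M := 2 * `|f| * `|z|) _).1 => d N h;
  apply: (le_trans (ler_norm _)); apply: mult_bound; right.
Qed.

Definition mult_fun (f : dual X) z : X := James (mult_subproof f z).

Lemma mult_fun_norm f z : `|mult_fun f z| <= 4 * `|f| * `|z|.
Proof.
have -> : 4 * `|f| * `|z| = 2 * `|f| * `|z| + 2 * `|f| * `|z| by ring.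
rewrite james_normE; apply: lerD; apply: (pnorm_ub _).2 => d N h;
  apply: (le_trans (ler_norm _)); apply: mult_bound; [by left|by right].
Qed.

Lemma mult_fun_bounded f : mult_fun f \in @bounded_linear R X X.
Proof.
have lin : linear (mult_fun f).
  move=> a z1 z2; apply/val_inj/funext => n.
  change (coef f n * (a * z1 n + z2 n) = a * (coef f n * z1 n) + coef f n * z2 n).
  by ring.
rewrite inE; split => //; apply: bound_continuous lin _ => z.
exact: mult_fun_norm.
Qed.

Definition mult_bop f : bounded_op X X := BoundedOp (mult_fun_bounded f).

Lemma mult_bopE f n : mult_bop f (e n) = coef f n *: e n.
Proof.
apply/val_inj/funext => k.
change (coef f k * e n k = coef f n * e n k).
by rewrite !unit_vecE; case: eqP => [->|]; rewrite ?mulr0.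
Qed.

Lemma mult_bop_diagonal f : mult_bop f \in Defs.diagonal e.
Proof. by rewrite inE; exists (coef f) => n; exact: mult_bopE. Qed.

Definition mult_op f : diag_op e := DiagOp (mult_bop_diagonal f).

Lemma mult_op_linear : linear mult_op.
Proof.
move=> a f g; apply/val_inj; apply: bounded_op_eq => n.
change (mult_bop (a *: f + g) (e n) = a *: mult_bop f (e n) + mult_bop g (e n)).
rewrite !mult_bopE scalerA -scalerDl; congr (_ *: _).
Qed.

HB.instance Definition _ :=
  GRing.isLinear.Build R (dual X) (diag_op e) *:%R mult_op mult_op_linear.

Lemma norming_one : dual_norming (fun=> 1).
Proof. by right; exact: (norming_segment segment_line). Qed.

(** Pairing the constant 1 with [mult_fun f x] returns [f x], whence the lower constant 1. Pairing
    it with [T x] gives a functional whose coefficients are the eigenvalues of [T], whence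
    surjectivity. *)
Lemma dual_isomorphic_diag : isomorphic (dual X) (diag_op e).
Proof.
exists mult_op; split.
  exists 1, 4; split => // f; apply/andP; split; last first.
    by apply: opnorm_lub => z z1; apply: (le_trans (mult_fun_norm f z)); rewrite ler_piMr // mulr_ge0.
  rewrite mul1r; apply: dual_norm_le => // x N xN.
  have -> : pairing (coef f) x N = pairing (fun=> 1) (mult_fun f (trunc N x)) N.
    by apply: eq_bigr => n _; rewrite mul1r /= /cutoff ltn_ord.
  apply: (le_trans (dual_norming_bound _ _ norming_one)).
  by rewrite -(norm_trunc xN); exact: (opnormP (mult_bop f)).
move=> T; have := diag_opP T; rewrite inE => -[lam hlam].
have [f hf] : exists f : dual X, forall n, coef f n = lam n.
  apply: (functional_of (M := `|T|)) => // x N xN.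
  have TE : T (trunc N x) = trunc N (fun n => lam n * x n).
    rewrite !trunc_sum linear_sum; apply: eq_bigr => n _.
    by rewrite linearZ /= hlam scalerA mulrC.
  have -> : pairing lam x N = pairing (fun=> 1) (T (trunc N x)) N.
    by rewrite TE; apply: eq_bigr => n _; rewrite mul1r truncE ltn_ord.
  apply: (le_trans (dual_norming_bound _ _ norming_one)).
  by rewrite -(norm_trunc xN); exact: (opnormP (diag_op_val T)).
exists f; apply/val_inj; apply: bounded_op_eq => n.
change (mult_bop f (e n) = T (e n)).
by rewrite mult_bopE hf hlam.
Qed.

End duality.

(** * Paths of the binary tree coded by bit sequences *)

Section heap_branches.
Implicit Types (beta : nat -> bool) (j : nat).

(** Entry 0 is the extra root and entry 1 its only child, so bit [k] decides entry [k + 2]. *)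
Fixpoint heap_path beta j : nat :=
  if j is i.+1 then (if i is k.+1 then (heap_path beta i).*2 + beta k else 1)%N else 0%N.

Definition on_path beta : pred nat := fun n => `[< exists j, heap_path beta j = n >].

Lemma heap_pathSS beta j :
  heap_path beta j.+2 = ((heap_path beta j.+1).*2 + beta j)%N.
Proof. by []. Qed.

Lemma half_heap_path beta j : half (heap_path beta j.+1) = heap_path beta j.
Proof. by case: j => // j; rewrite heap_pathSS addnC half_bit_double. Qed.

Lemma heap_path_bounds beta j : (2 ^ j <= heap_path beta j.+1 < 2 ^ j.+1)%N.
Proof.
elim: j => [|j /andP[h1 h2]] //; rewrite heap_pathSS.
by rewrite [(2 ^ j.+2)%N]expnS [(2 ^ j.+1)%N]expnS in h2 *; case: (beta j); lia.
Qed.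

Lemma heap_path_inj beta beta' j k :
  heap_path beta j.+1 = heap_path beta' k.+1 -> j = k.
Proof.
move=> h; have /andP[a1 a2] := heap_path_bounds beta j.
have /andP[b1 b2] := heap_path_bounds beta' k; rewrite -h in b1 b2.
apply/eqP; rewrite eqn_leq -ltnS -[X in _ && X]ltnS.
rewrite -(ltn_exp2l _ _ (isT : (1 < 2)%N)) (leq_ltn_trans a1 b2) /=.
by rewrite -(ltn_exp2l _ _ (isT : (1 < 2)%N)) (leq_ltn_trans b1 a2).
Qed.

Lemma on_path_distinct beta beta' : beta != beta' ->
  exists n, on_path beta n && ~~ on_path beta' n.
Proof.
move=> ne; have [j bj] : exists j, beta j != beta' j.
  apply/not_existsP => h; move/eqP: ne; apply; apply/funext => j.
  by apply/eqP; apply: contrapT => /negP; exact: h.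
exists (heap_path beta j.+2); apply/andP; split; first by apply/asboolP; exists j.+2.
apply/negP => /asboolP[[|k] hk].
  by have := heap_path_bounds beta j.+1; rewrite -hk leqNgt expn_gt0.
have kj := heap_path_inj hk; rewrite kj !heap_pathSS in hk.
move: bj; have := congr1 odd hk; rewrite !oddD !odd_double.
by case: (beta j); case: (beta' j).
Qed.

Lemma segment_on_path beta : segment tree (on_path beta).
Proof.
have iter_path i j : iter i half (heap_path beta j) = heap_path beta (j - i).
  elim: i => [|i IH]; first by rewrite subn0.
  rewrite iterS IH subnS; case: (j - i)%N => [|k] //; exact: half_heap_path.
split=> [u v /asboolP[j <-] /asboolP[k <-]|u w v _ /asboolP[k <-] _ [i <-]].
  case/orP: (leq_total j k) => jk.
    by left; exists (k - j)%N; rewrite iter_path subKn.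
  by right; exists (j - k)%N; rewrite iter_path subKn.
by apply/asboolP; exists (k - i)%N; rewrite iter_path.
Qed.

End heap_branches.

(** * Nonseparability of the dual and absence of l1 *)

Section dual_structure.
Context (R : realType).
Local Notation X := (james R).
Local Notation nm := (@nm R half predn).
Local Notation e := (@unit_vec R).

Lemma path_functional (beta : nat -> bool) :
  exists f : dual X, forall n, coef f n = (on_path beta n)%:R.
Proof.
apply: (@functional_of R (indicator (on_path beta)) 1) => // x N xN.
rewrite mul1r; apply: (le_trans (segment_norm_le N (segment_on_path beta) xN)).
by rewrite /nm lerDl (pnorm_ge0_supp xN).
Qed.

Lemma norm_unit_vec n : `|e n| <= 2.
Proof.
have dn : supp_lt (delta n : nat -> R) n.+1 := @delta_supp R n.
by rewrite (norm_trunc dn) /nm -[2]/(1 + 1) lerD // pnorm_delta.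
Qed.

Lemma cantor_bits (h : (nat -> bool) -> nat) : ~ injective h.
Proof.
move=> hI; pose beta n := ~~ `[< exists g : nat -> bool, h g = n /\ g n >].
have : beta (h beta) = ~~ beta (h beta).
  rewrite {1}/beta; congr negb; apply/idP/idP => [/asboolP[g [/hI <-]] //|b].
  by apply/asboolP; exists beta.
by case: (beta _).
Qed.

(** Functionals of different paths differ by 1 at some [e n], of norm at most 2, so they are at
    least 1/2 apart and cannot share an approximant within 1/4. A countable dense [D] would thus
    inject bit sequences into the naturals. *)
Lemma dual_nonseparable : ~ separable (dual X).
Proof.
move=> [D /countable_injP[h hI] dD].
have /choice[f hf] := path_functional.
have quarter : 0 < 4^-1 :> R by rewrite invr_gt0.
have /choice[g hg] : forall beta, exists g, D g /\ `|f beta - g| < 4^-1.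
  move=> beta; have [|g [/= bg Dg]] := dD (ball (f beta) 4^-1) _ (ball_open (f beta) 4^-1).
    by exists (f beta); exact: ballxx.
  by exists g; split => //; move: bg; rewrite -ball_normE.
apply: (@cantor_bits (h \o g)) => beta beta' /= hh.
have gg : g beta = g beta'.
  by apply: hI hh; rewrite inE; [case: (hg beta)|case: (hg beta')].
apply: contrapT => /eqP/on_path_distinct[n /andP[h1 h2]].
have : `|f beta - f beta'| < 2^-1.
  have -> : f beta - f beta' = (f beta - g beta) - (f beta' - g beta').
    by rewrite gg opprB addrA subrK.
  rewrite (le_lt_trans (ler_normB _ _)) //.
  by have := (hg beta).2; have := (hg beta').2; lra.
have : 1 <= `|f beta - f beta'| * 2.
  have val : `|(f beta - f beta') (e n)| = 1.
    have -> : (f beta - f beta') (e n) = f beta (e n) - f beta' (e n) by [].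
    have := hf beta n; have := hf beta' n; rewrite /coef => -> ->.
    by rewrite h1 (negbTE h2) subr0 normr1.
  apply: (@le_trans _ _ `|(f beta - f beta') (e n)|); first by rewrite val.
  apply: (le_trans (opnormP _ _)); rewrite ler_wpM2l ?opnorm_ge0 //.
  exact: norm_unit_vec.
by lra.
Qed.

Lemma coef_sum n (u : nat -> R) (g : nat -> dual X) m :
  coef (\sum_(i < n) u i *: g i) m = \sum_(i < n) u i * coef (g i) m.
Proof. by rewrite /coef; elim/big_rec2: _ => // i y1 y2 _ <-. Qed.

Lemma no_l1_sequence (g : nat -> dual X) (C c : R) : 0 <= C -> 0 < c ->
  (forall i, `|g i| <= C) ->
  ~ (forall n (u : nat -> R), c * \sum_(i < n) `|u i| <= `|\sum_(i < n) u i *: g i|).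
Proof.
move=> C0 c0 gC low.
have c2 : 0 < c / 2 by rewrite divr_gt0.
have [|n [u [su hu]]] := small_average half_is_parent predn_is_parent
    (phi := fun i => coef (g i)) C0 c2.
  move=> i x N xN; apply: (le_trans (coef_bound _ xN)).
  by rewrite ler_wpM2r // (nm_ge0 xN).
have := low n u; rewrite su mulr1.
have : `|\sum_(i < n) u i *: g i| <= c / 2.
  apply: dual_norm_le => [|x N xN]; first exact: ltW.
  have -> : pairing (coef (\sum_(i < n) u i *: g i)) x N =
      pairing (fun m => \sum_(i < n) u i * coef (g i) m) x N.
    by apply: eq_bigr => m _; rewrite coef_sum.
  exact: hu.
by lra.
Qed.

Lemma l1_unit_subproof i : (fun k => (k == i)%:R : R^o) \in @summable_seq R.
Proof.
rewrite inE /=; apply: (is_cvg_near_cst (1 : R^o)).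
exists i.+1 => // n /= ni; rewrite /series /= big_mkord (bigD1 (Ordinal ni)) //=.
by rewrite eqxx normr1 big1 ?addr0 // => k; rewrite -val_eqE /= => /negbTE ->; rewrite normr0.
Qed.

Definition l1_unit i : l1 R := L1 (l1_unit_subproof i).

Lemma l1_norm_sum n (u : nat -> R) :
  `|\sum_(i < n) u i *: l1_unit i| = \sum_(i < n) `|u i|.
Proof.
have E k : (\sum_(i < n) u i *: l1_unit i : l1 R) k = if (k < n)%N then u k else 0.
  have -> : (\sum_(i < n) u i *: l1_unit i : l1 R) k =
      \sum_(i < n) u i * (k == i)%:R.
    by elim/big_rec2: _ => // i y1 y2 _ <-.
  case: ltnP => kn.
    rewrite (bigD1 (Ordinal kn)) //= eqxx mulr1 big1 ?addr0 // => i.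
    by rewrite -val_eqE /= eq_sym => /negbTE ->; rewrite mulr0.
  rewrite big1 // => i _; rewrite gtn_eqF ?mulr0 //.
  exact: leq_trans (ltn_ord i) kn.
apply: (lim_near_cst (@norm_hausdorff _ R^o)); exists n => // m /= nm.
rewrite /series /= big_mkord [RHS](big_ord_widen m (fun i => `|u i|)) //.
rewrite [RHS]big_mkcond /=; apply: eq_bigr => k _.
by rewrite E; case: ifP => // _; rewrite normr0.
Qed.

Lemma dual_no_l1 : ~ contains_copy (dual X) (l1 R).
Proof.
move=> [T [c [C [c0 C0 hT]]]].
have one i : `|l1_unit i| = 1.
  have := l1_norm_sum i.+1 (fun k => (k == i)%:R).
  rewrite !big_ord_recr /= eqxx scale1r normr1 !big1 ?add0r //.
    by move=> k _; rewrite ltn_eqF // normr0.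
  by move=> k _; rewrite ltn_eqF // scale0r.
apply: (@no_l1_sequence (fun i => T (l1_unit i)) C c) => //; first exact: ltW.
  by move=> i; have /andP[_] := hT (l1_unit i); rewrite one mulr1.
move=> n u; rewrite -l1_norm_sum.
have -> : \sum_(i < n) u i *: T (l1_unit i) = T (\sum_(i < n) u i *: l1_unit i).
  by rewrite linear_sum; apply: eq_bigr => i _; rewrite linearZ.
by have /andP[] := hT (\sum_(i < n) u i *: l1_unit i).
Qed.

End dual_structure.

(** * Copies of c0 in dual spaces *)

(* Rosenthal's disjointness lemma; the induction is on the number of times the
   row sums can drop by [delta]. If no row of the countably many disjoint blocks
   of indices is good, one bad index from each block forms a submatrix whose row
   sums are smaller by [delta]. *)
Lemma small_off_diagonal (R : realType) (delta : R) (k : nat) (m : nat -> nat -> R) :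
  0 < delta -> (forall i j, 0 <= m i j) ->
  (forall i (s : seq nat), uniq s -> \sum_(j <- s) m i j <= k%:R * delta) ->
  exists2 sigma : nat -> nat, injective sigma &
    forall i (s : seq nat), uniq s -> i \notin s ->
      \sum_(j <- s) m (sigma i) (sigma j) <= delta.
Proof.
move=> d0; elim: k m => [|k IH] m m0 row.
  exists id => // i s us _; apply: (le_trans (row i s us)).
  by rewrite mul0r ltW.
(* Block [a] consists of the codes of the pairs [(a, i)]. *)
pose code (i j : nat) := pickle (i, j).
have code_inj i j i' j' : code i j = code i' j' -> i = i' /\ j = j'.
  by move=> /(pcan_inj pickleK) [-> ->].
have [[a ha]|bad] := pselect (exists a, forall i (s : seq nat), uniq s -> i \notin s ->
    \sum_(j <- s) m (code a i) (code a j) <= delta).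
  by exists (code a) => // i j /code_inj[].
have /choice[is_ his] : forall a, exists is_ : nat * seq nat, [/\ uniq is_.2,
    is_.1 \notin is_.2 & delta < \sum_(j <- is_.2) m (code a is_.1) (code a j)].
  move=> a; move/forallNP: bad => /(_ a) /existsNP[i /existsNP[s]].
  move=> /not_implyP[us /not_implyP[si /negP]]; rewrite -ltNge => h.
  by exists (i, s).
pose phi a := code a (is_ a).1.
have phi_inj : injective phi by move=> a b /code_inj[].
have [i j|i s us|sigma sigma_inj hs] := IH (fun a b => m (phi a) (phi b)).
- exact: m0.
- have [u1 u2 u3] := his i.
  (* The indices [phi a] avoid the bad set of block [i], so that set takes [delta] out of the bound
     for the row. *)
  have := row (phi i) ([seq phi a | a <- s] ++ [seq code i j | j <- (is_ i).2]).
  rewrite big_cat !big_map -(natr1 k) mulrDl mul1r => h.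
  have {}h := le_trans (lerD (lexx _) (ltW u3)) (h _).
  rewrite lerD2r in h; apply: h.
  rewrite cat_uniq !map_inj_uniq ?us ?u1 ?andbT //=; last by move=> a b /code_inj[].
  apply/hasPn => x /mapP[j js ->]; apply/negP => /mapP[a _] /code_inj[ia ja].
  by move: u2; rewrite [X in (is_ X).1]ia -ja js.
- exists (phi \o sigma); first exact: inj_comp.
  by move=> i s us si; exact: hs.
Qed.

Section c0_in_dual.
Context (R : realType) (V : normedModType R).

Lemma c0_unit_subproof i : (fun k => (k == i)%:R : R^o) \in @null_seq R.
Proof.
rewrite inE /=; apply/cvgrPdist_le => e e0; exists i.+1 => // n /= ni.
by rewrite gtn_eqF // subrr normr0 ltW.
Qed.

Definition c0_unit i : c0 R := C0 (c0_unit_subproof i).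

Lemma c0_sumE (s : seq nat) (u : nat -> R) k :
  (\sum_(i <- s) u i *: c0_unit i : c0 R) k = \sum_(i <- s) u i * (k == i)%:R.
Proof. by elim/big_rec2: _ => // i y1 y2 _ <-. Qed.

Lemma c0_unit_ge1 i : 1 <= `|c0_unit i|.
Proof.
by apply: le_trans (c0_norm_ub (c0_unit i) i); rewrite /= eqxx normr1.
Qed.

Lemma c0_sum_le1 (s : seq nat) (u : nat -> R) : uniq s -> (forall i, `|u i| <= 1) ->
  `|\sum_(i <- s) u i *: c0_unit i| <= 1.
Proof.
move=> us u1; apply: c0_norm_lub => k; rewrite c0_sumE.
have [ks|ks] := boolP (k \in s).
  rewrite (bigD1_seq k) //= eqxx mulr1 big1 ?addr0 // => i ik.
  by rewrite eq_sym (negbTE ik) mulr0.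
rewrite big_seq big1 ?normr0 // => i is_; case: eqP => [ki|]; last by rewrite mulr0.
by rewrite ki is_ in ks.
Qed.

Lemma dual_sumE (I : eqType) (s : seq I) (f : I -> dual V) z :
  (\sum_(i <- s) f i) z = \sum_(i <- s) f i z.
Proof. by elim/big_rec2: _ => // i y1 y2 _ <-. Qed.

(** The [j]-th Rademacher function on the finite sign patterns, which [i] enumerates; a missing
    entry counts as -1. *)
Definition pattern_sign (j i : nat) : R :=
  if nth false (odflt [::] (unpickle i : option (seq bool))) j then 1 else -1.

Lemma pattern_sign_norm j i : `|pattern_sign j i| = 1.
Proof. by rewrite /pattern_sign; case: ifP; rewrite ?normrN1 ?normr1. Qed.

Lemma pattern_sign_realize n (u : nat -> R) : exists i, forall j, (j < n)%N ->
  u j * pattern_sign j i = `|u j|.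
Proof.
exists (pickle [seq 0 <= u j | j <- iota 0 n]) => j jn.
rewrite /pattern_sign pickleK /= (nth_map 0%N) ?size_iota // nth_iota // add0n.
by case: ifP => h; [rewrite mulr1 ger0_norm|rewrite mulrN1 ltr0_norm // ltNge h].
Qed.

(** The images [f i] of the unit vectors form a weakly unconditionally Cauchy series, so signed sums
    of them converge pointwise to bounded functionals [g j]. For given [u] some index [i0] carries
    exactly the signs of [u]. At [Z i0] its term contributes at least [c / 2] times the l1 norm of
    [u], and the others remove at most [c / 8] times that norm. *)
Lemma c0_dual_l1_sequence : contains_copy (dual V) (c0 R) ->
  exists (g : nat -> dual V) (C c : R), [/\ 0 <= C, 0 < c, forall i, `|g i| <= C &
    forall n (u : nat -> R), c * \sum_(i < n) `|u i| <= `|\sum_(i < n) u i *: g i|].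
Proof.
move=> [T [c [C [c0 C0 hT]]]].
pose f i := T (c0_unit i).
have wuc z (s : seq nat) : uniq s -> \sum_(j <- s) `|f j z| <= C * `|z|.
  move=> us; pose u j := Num.sg (f j z).
  have u1 j : `|u j| <= 1 by rewrite normr_sg; case: (_ != _).
  have -> : \sum_(j <- s) `|f j z| = T (\sum_(j <- s) u j *: c0_unit j) z.
    rewrite linear_sum dual_sumE; apply: eq_bigr => j _.
    rewrite linearZ /=; exact: normrEsg.
  apply: (le_trans (ler_norm _)); apply: (le_trans (opnormP _ _)).
  rewrite ler_wpM2r //; have /andP[_ h] := hT (\sum_(j <- s) u j *: c0_unit j).
  apply: (le_trans h); rewrite -[leRHS]mulr1 ler_wpM2l ?(ltW C0) //.
  exact: c0_sum_le1.
have /choice[z hz] : forall i, exists z, `|z| <= 1 /\ c / 2 <= f i z.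
  move=> i; apply: contrapT => /forallNP nex.
  have c2 : 0 < c / 2 by rewrite divr_gt0.
  have : `|f i| <= c / 2.
    apply: opnorm_lub => z z1; rewrite leNgt; apply/negP => h.
    have [p|p] := leP 0 (f i z).
      by apply: (nex z); split => //; rewrite -(ger0_norm p) ltW.
    apply: (nex (- z)); rewrite normrN; split => //.
    by rewrite linearN /= -(ltr0_norm p) ltW.
  have /andP[h _] := hT (c0_unit i).
  have : c <= c * `|c0_unit i| by rewrite ler_peMr ?(ltW c0) // c0_unit_ge1.
  rewrite /f; lra.
pose d := c / 8; have d0 : 0 < d by rewrite divr_gt0.
have [| |sigma sigma_inj off] := @small_off_diagonal R d (Num.bound (C / d))
    (fun i j => `|f j (z i)|) d0.
- by move=> i j; exact: normr_ge0.
- move=> i s us; apply: (le_trans (wuc _ _ us)); apply: (@le_trans _ _ C).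
    by rewrite ler_piMr ?(ltW C0) // (hz i).1.
  rewrite -ler_pdivrMr //; apply/ltW/archi_boundP; apply: divr_ge0; exact: ltW.
pose F i := f (sigma i); pose Z i := z (sigma i).
have wucF y n : \sum_(i < n) `|F i y| <= C * `|y|.
  have := wuc y [seq sigma i | i <- iota 0 n].
  rewrite big_map map_inj_uniq ?iota_uniq //.
  have -> : iota 0 n = index_iota 0 n by rewrite /index_iota subn0.
  by rewrite big_mkord; apply.
pose S j y (n : nat) : R^o := \sum_(i < n) pattern_sign j i * F i y.
have cS j y : cvgn (S j y).
  have -> : S j y = series (fun i => pattern_sign j i * F i y : R^o).
    by apply/funext => n; rewrite /S /series /= big_mkord.
  apply: normed_cvg; apply: nondecreasing_is_cvgn.
    by apply: nondecreasing_series => i _ _; exact: normr_ge0.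
  exists (C * `|y|) => _ [n _ <-].
  change (\sum_(0 <= i < n) `|pattern_sign j i * F i y| <= C * `|y|); rewrite big_mkord.
  apply: le_trans (wucF y n); apply: ler_sum => i _.
  by rewrite normrM pattern_sign_norm mul1r.
pose G j y : R^o := limn (S j y).
have cG j y : S j y @ \oo --> G j y := cS j y.
have linG j : linear (G j).
  move=> a y1 y2; apply: cvg_lim => //.
  rewrite (_ : S j _ = (fun n => a *: S j y1 n + S j y2 n)); last first.
    apply/funext => n; rewrite /S scaler_sumr -big_split; apply: eq_bigr => i _ /=.
    rewrite linearP /= /GRing.scale /=; ring.
  by apply: cvgD; [apply: cvgZl_tmp|].
have boundG j y : `|G j y| <= C * `|y|.
  have bS n : `|S j y n| <= C * `|y|.
    apply: le_trans (wucF y n); apply: (le_trans (ler_norm_sum _ _ _)).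
    by apply: ler_sum => i _; rewrite normrM pattern_sign_norm mul1r.
  rewrite ler_norml; apply/andP; split.
    apply: (cvgr_to_ge (cG j y)); near=> n.
    by have := bS n; rewrite ler_norml => /andP[].
  apply: (cvgr_to_le (cG j y)); near=> n.
  by have := bS n; rewrite ler_norml => /andP[].
have GP j : G j \in @bounded_linear R V R^o.
  by rewrite inE; split => //; exact: (@bound_continuous _ _ _ _ C (linG j) (boundG j)).
pose g j : dual V := BoundedOp (GP j).
exists g, C, (c / 4); split; [exact: ltW|by rewrite divr_gt0| |].
  move=> j; apply: opnorm_lub => y y1; apply: (le_trans (boundG j y)).
  by rewrite ler_piMr // ltW.
move=> n u; have [i0 hi0] := pattern_sign_realize n u.
set U := \sum_(j < n) `|u j|.
have U0 : 0 <= U by exact: sumr_ge0.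
pose t i := \sum_(j < n) u j * pattern_sign j i.
have ti i : `|t i| <= U.
  apply: (le_trans (ler_norm_sum _ _ _)); apply: ler_sum => j _.
  by rewrite normrM pattern_sign_norm mulr1.
have ti0 : t i0 = U by apply: eq_bigr => j _; exact: hi0.
have lower : c / 4 * U <= (\sum_(j < n) u j *: g j) (Z i0).
  have cvg_comb k : (fun m => \sum_(j < k) u j *: S j (Z i0) m : R^o) @ \oo -->
      (\sum_(j < k) u j *: G j (Z i0) : R^o).
    elim: k => [|k IH].
      rewrite big_ord0 (_ : (fun m => _) = (fun=> 0)); first exact: cvg_cst.
      by apply/funext => m; rewrite big_ord0.
    rewrite big_ord_recr /= (_ : (fun m => _) =
      (fun m => \sum_(j < k) u j *: S j (Z i0) m + u k *: S k (Z i0) m)); last first.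
      by apply/funext => m; rewrite big_ord_recr.
    by apply: cvgD => //; apply: cvgZl_tmp.
  rewrite dual_sumE; apply: (cvgr_to_ge (cvg_comb n)).
  exists i0.+1 => // m /= im.
  have -> : \sum_(j < n) u j *: S j (Z i0) m = \sum_(i < m) t i * F i (Z i0).
    rewrite /S /t; under eq_bigr do rewrite scaler_sumr.
    rewrite exchange_big /=; apply: eq_bigr => i _; rewrite mulr_suml.
    by apply: eq_bigr => j _; rewrite /GRing.scale /= mulrA.
  rewrite (bigD1 (Ordinal im)) //= ti0.
  have diag : c / 2 <= F i0 (Z i0) by exact: (hz (sigma i0)).2.
  have rest : `|\sum_(i < m | i != Ordinal im) t i * F i (Z i0)| <= U * d.
    apply: (le_trans (ler_norm_sum _ _ _)).
    apply: (@le_trans _ _ (\sum_(i < m | i != Ordinal im) U * `|F i (Z i0)|)).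
      by apply: ler_sum => i _; rewrite normrM ler_wpM2r.
    rewrite -mulr_sumr ler_wpM2l //.
    have := off i0 [seq i <- iota 0 m | i != i0].
    rewrite filter_uniq ?iota_uniq // mem_filter eqxx big_filter => /(_ isT isT).
    have -> : iota 0 m = index_iota 0 m by rewrite /index_iota subn0.
    by rewrite big_mkord.
  have : U * (c / 2) <= U * F i0 (Z i0) by rewrite ler_wpM2l.
  move: rest; rewrite ler_norml /d => /andP[h _]; nra.
apply: (le_trans lower); apply: (le_trans (ler_norm _)).
apply: (le_trans (opnormP _ _)); rewrite ler_piMr ?opnorm_ge0 //.
exact: (hz (sigma i0)).1.
Unshelve. all: by end_near.
Qed.

End c0_in_dual.

Lemma dual_no_c0 (R : realType) : ~ contains_copy (dual (james R)) (c0 R).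
Proof.
move=> /c0_dual_l1_sequence[g [C [c [C0 c0 gC low]]]].
exact: no_l1_sequence C0 c0 gC low.
Qed.

Theorem theorem1p3 (R : realType) :
  exists (X : completeNormedModType R) (e : nat -> X),
    [/\ schauder_basis e,
        isomorphic (dual X) (diag_op e),
        ~ separable (dual X),
        ~ contains_copy (dual X) (l1 R) &
        ~ contains_copy (dual X) (c0 R)].
Proof.
exists (james R), (@unit_vec R); split.
- exact: schauder_unit_vec.
- exact: dual_isomorphic_diag.
- exact: dual_nonseparable.
- exact: dual_no_l1.
- exact: dual_no_c0.
Qed.
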